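(* Let $\mathbb X$ be a virtual equipment and let $j\colon A\to E$ be a dense tight-cell in $\mathbb X$. A tight-cell $r\colon D\to E$ is strictly $j$-monadic if and only if $r$ admits a left $j$-adjoint, the induced $j$-monad admits an algebra object, and $r$ strictly creates $j$-absolute $r$-extensions.
   Context: **Virtual equipments.** A virtual double category has objects, tight-cells $f\colon A\to B$ (forming a category; both $(f;g)$ and $gf$ denote $f$ followed by $g$), loose-cells, written $p\colon X\nrightarrow Y$, and 2-cells. A 2-cell has as top a chain of loose-cells $p_1\colon A_1\nrightarrow A_0,\dots,p_n\colon A_n\nrightarrow A_{n-1}$ ($n\ge 0$), as bottom a loose-cell $q\colon B_n\nrightarrow B_0$, and as sides tight-cells $f_0\colon A_0\to B_0$, $f_n\colon A_n\to B_n$; 2-cells paste multicategorically, associatively and unitally. $p_1,\dots,p_n\Rightarrow q$ denotes a 2-cell with identity sides. A virtual equipment is a virtual double category in which: every $p\colon X\nrightarrow Y$, $f\colon Z\to Y$, $g\colon W\to X$ admit a restriction $p(f,g)\colon W\nrightarrow Z$ (2-cells with bottom $p(f,g)$ and sides $h_0,h_n$ correspond bijectively, by pasting with a cartesian 2-cell, to 2-cells with bottom $p$ and sides $(h_0;f),(h_n;g)$); and every object $A$ has a loose-identity $A(1,1)\colon A\nrightarrow A$ (with a 2-cell from the empty chain to $A(1,1)$, pasting with which gives a bijection between 2-cells whose top chain contains $A(1,1)$ at a given place and 2-cells with that entry omitted). Write $B(f,g):=B(1,1)(f,g)$. A 2-cell $f\Rightarrow g$ between parallel tight-cells into $B$ is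 a 2-cell from the empty chain to $B(f,g)$. There are composition 2-cells $B(f,g),B(g,h)\Rightarrow B(f,h)$. A tight-cell $k\colon B\to C$ induces $B(f,g)\Rightarrow C(kf,kg)$, and $(\phi;k)$ denotes the composite of $\phi\colon p_1,\dots,p_n\Rightarrow B(f,g)$ with it. For $\phi\colon E(j,e)\Rightarrow E(t,e)$, $\phi(1,x)\colon E(j,ex)\Rightarrow E(t,ex)$ denotes restriction along $x$. **Relative monads and algebras.** A $j$-monad $T=(t,\dagger,\eta)$, for $j\colon A\to E$, consists of a tight-cell $t\colon A\to E$ and 2-cells $\dagger\colon E(j,t)\Rightarrow E(t,t)$, $\eta\colon j\Rightarrow t$ such that: $\dagger$ followed by the 2-cell $E(t,t)\Rightarrow E(j,t)$ induced by $\eta$ is the identity; $\eta$ followed by $\dagger$ is the identity 2-cell on $t$; and the two 2-cells $E(j,t),E(j,t)\Rightarrow E(t,t)$, given by $(\dagger,\dagger)$ then composition, and by $\dagger$ on the second factor, then composition $E(j,t),E(t,t)\Rightarrow E(j,t)$, then $\dagger$, are equal. A $T$-algebra is a tight-cell $e\colon D\to E$ with a 2-cell $\rtimes\colon E(j,e)\Rightarrow E(t,e)$ such that $\rtimes$ followed by $E(t,e)\Rightarrow E(j,e)$ (induced by $\eta$) is the identity, and the two 2-cells $E(j,t),E(j,e)\Rightarrow E(t,e)$, given by $(\dagger,\rtimes)$ then composition, and by $\rtimes$ on the second factor, then composition $E(j,t),E(t,e)\Rightarrow E(j,e)$, then $\rtimes$, are equal. For a chain $p_1,\dots,p_n$ from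 $D$ (left end) to $D'$ (right end), a $(p_1,\dots,p_n)$-graded morphism $(e\colon D\to E,\rtimes)\to(e'\colon D'\to E,\rtimes')$ is a 2-cell $\epsilon\colon p_1,\dots,p_n\Rightarrow E(e,e')$ such that the two 2-cells $E(j,e),p_1,\dots,p_n\Rightarrow E(t,e')$, given by $\rtimes$ then composing with $\epsilon$, and by composing with $\epsilon$ then $\rtimes'$, are equal. An algebra object for $T$ is a $T$-algebra $(u_T\colon \mathrm{Alg}(T)\to E,\rtimes_T)$ such that (1) for every $T$-algebra $(e\colon D\to E,\rtimes)$ there is a unique tight-cell $\langle e\rangle\colon D\to\mathrm{Alg}(T)$ with $(\langle e\rangle;u_T)=e$ and $\rtimes_T(1,\langle e\rangle)=\rtimes$; (2) every graded $T$-algebra morphism $\epsilon\colon p_1,\dots,p_n\Rightarrow E(e,e')$ is $(\langle\epsilon\rangle;u_T)$ for a unique 2-cell $\langle\epsilon\rangle\colon p_1,\dots,p_n\Rightarrow\mathrm{Alg}(T)(\langle e\rangle,\langle e'\rangle)$. **Relative adjunctions.** A $j$-adjunction $\ell\dashv_j r$ with apex $C$ consists of tight-cells $\ell\colon A\to C$ (left $j$-adjoint), $r\colon C\to E$ (right $j$-adjoint) and an isomorphism $\sharp\colon C(\ell,1)\cong E(j,r)$. It induces a $j$-monad with carrier $(\ell;r)$, unit $j\Rightarrow r\ell$ the image under $\sharp$ of the identity on $\ell$, and extension operator $E(j,r\ell)\cong C(\ell,\ell)\Rightarrow E(r\ell,r\ell)$. A resolution of a $j$-monad $T$ is a $j$-adjunction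 inducing $T$. If $\ell\dashv_j r$ is a resolution of $T$ with apex $C$, then $r$ is a $T$-algebra via $E(j,r)\cong C(\ell,1)\Rightarrow E(r\ell,r)$; if $T$ admits an algebra object, the induced tight-cell $C\to\mathrm{Alg}(T)$ is the comparison tight-cell. **Strict monadicity.** $r\colon D\to E$ is strictly $j$-monadic if it admits a left $j$-adjoint, the induced $j$-monad $T$ admits an algebra object, and the comparison tight-cell $D\to\mathrm{Alg}(T)$ is an isomorphism. **Colimits.** For $p\colon X\nrightarrow Y$ and $f\colon Y\to Z$, a $p$-cocone for $f$ is a tight-cell $c\colon X\to Z$ with a 2-cell $\lambda\colon p\Rightarrow Z(f,c)$. It is the colimit $p\circledast f$ if, for all chains $q_1,\dots,q_n$ ($n\ge0$) from $X$ to $Z$, pasting with $\lambda$ (and composing $Z(f,c),Z(c,1)\Rightarrow Z(f,1)$) is a bijection from 2-cells $q_1,\dots,q_n\Rightarrow Z(c,1)$ to 2-cells $p,q_1,\dots,q_n\Rightarrow Z(f,1)$. For $c\colon D\to C'$ and $f\colon D\to Z$, the left extension $c\rhd f\colon C'\to Z$ is the $C'(c,1)$-weighted colimit of $f$. $j\colon A\to E$ is dense if $1_E$, with the identity 2-cell on $E(j,1)$, is the left extension $j\rhd j$. A colimit $(p\circledast f,\lambda)$ in $E$ is $j$-absolute if the 2-cell $E(j,f),p\Rightarrow E(j,p\circledast f)$ induced by $\lambda$ is left-opcartesian: every 2-cell with top chain $E(j,f),p,q_1,\dots,q_m$ ($m\ge0$) factors uniquely through it, via a 2-cell with top chain $E(j,p\circledast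 f),q_1,\dots,q_m$ (equivalently, the left-composite of $E(j,f)$ and $p$ exists and the canonical 2-cell from it to $E(j,p\circledast f)$ is invertible). **Strict creation.** For $p\colon Y\nrightarrow Z$, $f\colon Z\to W$, $g\colon W\to X$, a colimit $(p\circledast(f;g),\lambda)$ is strictly created by $g$ if there is a $p$-cocone $(w,\lambda')$ for $f$ such that $(w,\lambda')$ is the unique pair with $p\circledast(f;g)=(w;g)$ and $\lambda=(\lambda';g)$, and $(w,\lambda')$ is the colimit $p\circledast f$. **$r$-extensions.** For $r\colon D\to E$, an $r$-extension is a left extension $c\rhd r$ for some tight-cell $c$ with domain $D$, i.e. a colimit $C'(c,1)\circledast(1_D;r)$ with $c\colon D\to C'$. ''$r$ strictly creates $j$-absolute $r$-extensions'' means each $r$-extension that exists in $E$ and is $j$-absolute is strictly created by $r$ (taking $f=1_D$, $g=r$). *)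

(* Defs.v *)
From Stdlib Require Import Setoid ProofIrrelevance.

Set Implicit Arguments.
Unset Strict Implicit.
#[export] Unset Printing Implicit Defensive.

(** * Virtual double categories *)

(* [chain loose A0 An] is the type of chains p1 : A1 -|-> A0, ..., pn : An -|-> A(n-1);
   [loose X Y] is the type of loose-cells X -|-> Y, so a chain is read from its left end
   [A0] to its right end [An], against the direction of its loose-cells. *)
Inductive chain (ob : Type) (loose : ob -> ob -> Type) : ob -> ob -> Type :=
| cnil (A : ob) : chain loose A A
| ccons (A0 A1 An : ob) (p : loose A1 A0) (P : chain loose A1 An) : chain loose A0 An.

Arguments cnil {ob loose} A.

Fixpoint capp (ob : Type) (loose : ob -> ob -> Type) (A B C : ob)
    (P : chain loose A B) : chain loose B C -> chain loose A C :=
  match P with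
  | cnil _ => fun Q => Q
  | ccons p P' => fun Q => ccons p (capp P' Q)
  end.

Declare Scope vdc_scope.
Delimit Scope vdc_scope with vdc.
Open Scope vdc_scope.

Notation "P +++ Q" := (capp P Q) (at level 60, right associativity) : vdc_scope.
Notation "p :-: P" := (ccons p P) (at level 60, right associativity) : vdc_scope.
Notation "[: p ]" := (ccons p (cnil _)) (at level 0, format "[:  p ]") : vdc_scope.
Notation "[: p ; q ]" := (ccons p (ccons q (cnil _)))
  (at level 0, format "[:  p ;  q ]") : vdc_scope.

Lemma capp_nil (ob : Type) (loose : ob -> ob -> Type) (A B : ob) (P : chain loose A B) :
  P +++ cnil B = P.
Proof. induction P; simpl; congruence. Qed.

Lemma capp_assoc (ob : Type) (loose : ob -> ob -> Type) (A B C D : ob)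
    (P : chain loose A B) (Q : chain loose B C) (R : chain loose C D) :
  (P +++ Q) +++ R = P +++ (Q +++ R).
Proof. induction P; simpl; congruence. Qed.

(* A horizontally composable sequence of 2-cells: adjacent 2-cells share a side, the tops
   concatenate to the first chain and the bottoms form the second chain.  The empty sequence
   is a single tight-cell.  The top is only required to be provably equal to the
   concatenation, so that no transports along equalities of chains are ever needed. *)
Inductive cells (ob : Type) (tight loose : ob -> ob -> Type)
    (cell : forall A0 An B0 Bn : ob,
       chain loose A0 An -> loose Bn B0 -> tight A0 B0 -> tight An Bn -> Type) :
    forall A0 An B0 Bn : ob,
      chain loose A0 An -> chain loose B0 Bn -> tight A0 B0 -> tight An Bn -> Type :=
| cells_nil (A B : ob) (f : tight A B) : cells cell (cnil A) (cnil B) f f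
| cells_cons (A0 A1 An B0 B1 Bn : ob)
    (P1 : chain loose A0 A1) (P2 : chain loose A1 An) (P : chain loose A0 An)
    (q : loose B1 B0) (Q : chain loose B1 Bn)
    (f0 : tight A0 B0) (f1 : tight A1 B1) (fn : tight An Bn)
    (a : cell _ _ _ _ P1 q f0 f1) (s : cells cell P2 Q f1 fn) (eP : P1 +++ P2 = P) :
    cells cell P (q :-: Q) f0 fn.

Arguments cells_nil {ob tight loose cell A B} f.

Definition cells_one (ob : Type) (tight loose : ob -> ob -> Type)
    (cell : forall A0 An B0 Bn : ob,
       chain loose A0 An -> loose Bn B0 -> tight A0 B0 -> tight An Bn -> Type)
    (A0 An B0 Bn : ob) (P : chain loose A0 An) (q : loose Bn B0)
    (f : tight A0 B0) (g : tight An Bn) (a : cell _ _ _ _ P q f g) :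
    cells cell P [: q] f g :=
  cells_cons a (cells_nil g) (capp_nil P).

Definition cells_two (ob : Type) (tight loose : ob -> ob -> Type)
    (cell : forall A0 An B0 Bn : ob,
       chain loose A0 An -> loose Bn B0 -> tight A0 B0 -> tight An Bn -> Type)
    (A0 A1 A2 B0 B1 B2 : ob) (P1 : chain loose A0 A1) (P2 : chain loose A1 A2)
    (q1 : loose B1 B0) (q2 : loose B2 B1)
    (f0 : tight A0 B0) (f1 : tight A1 B1) (f2 : tight A2 B2)
    (a : cell _ _ _ _ P1 q1 f0 f1) (b : cell _ _ _ _ P2 q2 f1 f2) :
    cells cell (P1 +++ P2) [: q1; q2] f0 f2 :=
  cells_cons a (cells_one b) eq_refl.

Fixpoint cells_app (ob : Type) (tight loose : ob -> ob -> Type)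
    (cell : forall A0 An B0 Bn : ob,
       chain loose A0 An -> loose Bn B0 -> tight A0 B0 -> tight An Bn -> Type)
    (A0 A1 An B0 B1 Bn : ob) (P1 : chain loose A0 A1) (Q1 : chain loose B0 B1)
    (f0 : tight A0 B0) (f1 : tight A1 B1) (s : cells cell P1 Q1 f0 f1) :
    forall (P2 : chain loose A1 An) (Q2 : chain loose B1 Bn) (fn : tight An Bn)
      (P : chain loose A0 An) (Q : chain loose B0 Bn),
      cells cell P2 Q2 f1 fn -> P1 +++ P2 = P -> Q1 +++ Q2 = Q -> cells cell P Q f0 fn :=
  match s in @cells _ _ _ _ A0 A1 B0 B1 P1 Q1 f0 f1 return
    forall (P2 : chain loose A1 An) (Q2 : chain loose B1 Bn) (fn : tight An Bn)
      (P : chain loose A0 An) (Q : chain loose B0 Bn),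
      cells cell P2 Q2 f1 fn -> P1 +++ P2 = P -> Q1 +++ Q2 = Q -> cells cell P Q f0 fn
  with
  | cells_nil f => fun P2 Q2 fn P Q t eP eQ =>
      match eP in _ = P', eQ in _ = Q' return cells cell P' Q' f fn with
      | eq_refl, eq_refl => t
      end
  | @cells_cons _ _ _ _ A0 A A1 B0 B B1 R1 R2 R q Q' f0 f f1 a s' eR =>
      fun P2 Q2 fn P Q t eP eQ =>
      match eQ in _ = Q'' return cells cell P Q'' f0 fn with
      | eq_refl =>
          cells_cons a (cells_app s' t eq_refl eq_refl)
            (eq_trans (eq_sym (capp_assoc R1 R2 P2))
               (eq_trans (f_equal (fun S => S +++ P2) eR) eP))
      end
  end.

(* [paste s b] is the multicategorical composite of a sequence [s] of 2-cells with a 2-cell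
   [b] whose top is the bottom of [s].  The sides of the composite are given together with
   proofs that they are the composites of the sides, again to avoid transports.
   [tcomp f g] is f followed by g. *)
Record vdc_data := {
  ob :> Type;
  tight : ob -> ob -> Type;
  loose : ob -> ob -> Type;
  tid : forall A : ob, tight A A;
  tcomp : forall A B C : ob, tight A B -> tight B C -> tight A C;
  cell : forall A0 An B0 Bn : ob,
    chain loose A0 An -> loose Bn B0 -> tight A0 B0 -> tight An Bn -> Type;
  idcell : forall (X Y : ob) (p : loose X Y), cell [: p] p (tid Y) (tid X);
  paste : forall (A0 An B0 Bn C0 Cn : ob)
    (P : chain loose A0 An) (Q : chain loose B0 Bn) (r : loose Cn C0)
    (f0 : tight A0 B0) (fn : tight An Bn) (g0 : tight B0 C0) (gn : tight Bn Cn)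
    (h0 : tight A0 C0) (hn : tight An Cn),
    cells cell P Q f0 fn -> cell Q r g0 gn ->
    tcomp f0 g0 = h0 -> tcomp fn gn = hn -> cell P r h0 hn
}.

Arguments tid {v} A.
Arguments cell {v A0 An B0 Bn}.
Arguments idcell {v X Y} p.

Notation "f ;; g" := (tcomp f g) (at level 50, left associativity) : vdc_scope.
Notation chains X := (chain (@loose X)).
Notation pcells := (cells (@cell _)).

(* 2-cells with identity sides *)
Notation "P =>> q" := (cell P q (tid _) (tid _)) (at level 70, no associativity) : vdc_scope.

Fixpoint cells_id (X : vdc_data) (A B : X) (P : chains X A B) :
    pcells P P (tid A) (tid B) :=
  match P with
  | cnil A => cells_nil (tid A)
  | ccons p P' => cells_cons (idcell p) (cells_id P') eq_refl
  end.

(* [cells_paste s t u]: pasting the sequence [s], placed on top of the sequence [t],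
   block by block along the 2-cells of [t] yields the sequence [u]. *)
Inductive cells_paste (X : vdc_data) :
    forall (A0 An B0 Bn C0 Cn : X) (P : chains X A0 An) (Q : chains X B0 Bn)
      (R : chains X C0 Cn) (f0 : tight A0 B0) (fn : tight An Bn)
      (g0 : tight B0 C0) (gn : tight Bn Cn) (h0 : tight A0 C0) (hn : tight An Cn),
      pcells P Q f0 fn -> pcells Q R g0 gn -> pcells P R h0 hn -> Prop :=
| cells_paste_nil (A B C : X) (f : tight A B) (g : tight B C) (h : tight A C)
    (e : f ;; g = h) :
    cells_paste (cells_nil f) (cells_nil g) (cells_nil h)
| cells_paste_cons (A0 A1 An B0 B1 Bn C0 C1 Cn : X)
    (P1 : chains X A0 A1) (P2 : chains X A1 An) (P : chains X A0 An)
    (Q1 : chains X B0 B1) (Q2 : chains X B1 Bn) (Q : chains X B0 Bn)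
    (r : loose C1 C0) (R : chains X C1 Cn)
    (f0 : tight A0 B0) (f1 : tight A1 B1) (fn : tight An Bn)
    (g0 : tight B0 C0) (g1 : tight B1 C1) (gn : tight Bn Cn)
    (h0 : tight A0 C0) (h1 : tight A1 C1) (hn : tight An Cn)
    (s1 : pcells P1 Q1 f0 f1) (b : cell Q1 r g0 g1)
    (s : pcells P2 Q2 f1 fn) (t : pcells Q2 R g1 gn) (u : pcells P2 R h1 hn)
    (eP : P1 +++ P2 = P) (eQ : Q1 +++ Q2 = Q) (e0 : f0 ;; g0 = h0) (e1 : f1 ;; g1 = h1) :
    cells_paste s t u ->
    cells_paste (cells_app s1 s eP eQ) (cells_cons b t eQ)
      (cells_cons (paste s1 b e0 e1) u eP).

Record virtual_double_category := {
  vdc :> vdc_data;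
  tcomp_idl : forall (A B : vdc) (f : tight A B), tid A ;; f = f;
  tcomp_idr : forall (A B : vdc) (f : tight A B), f ;; tid B = f;
  tcomp_assoc : forall (A B C D : vdc) (f : tight A B) (g : tight B C) (h : tight C D),
    (f ;; g) ;; h = f ;; (g ;; h);
  paste_idl : forall (A0 An B0 Bn : vdc) (P : chains vdc A0 An) (q : loose Bn B0)
    (f : tight A0 B0) (g : tight An Bn) (a : cell P q f g)
    (e0 : tid A0 ;; f = f) (en : tid An ;; g = g),
    paste (cells_id P) a e0 en = a;
  paste_idr : forall (A0 An B0 Bn : vdc) (P : chains vdc A0 An) (q : loose Bn B0)
    (f : tight A0 B0) (g : tight An Bn) (a : cell P q f g)
    (e0 : f ;; tid B0 = f) (en : g ;; tid Bn = g),
    paste (cells_one a) (idcell q) e0 en = a;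
  paste_assoc : forall (A0 An B0 Bn C0 Cn D0 Dn : vdc)
    (P : chains vdc A0 An) (Q : chains vdc B0 Bn) (R : chains vdc C0 Cn) (d : loose Dn D0)
    (f0 : tight A0 B0) (fn : tight An Bn) (g0 : tight B0 C0) (gn : tight Bn Cn)
    (h0 : tight A0 C0) (hn : tight An Cn) (k0 : tight C0 D0) (kn : tight Cn Dn)
    (l0 : tight B0 D0) (ln : tight Bn Dn) (m0 : tight A0 D0) (mn : tight An Dn)
    (s : pcells P Q f0 fn) (t : pcells Q R g0 gn) (u : pcells P R h0 hn)
    (c : cell R d k0 kn)
    (e1 : g0 ;; k0 = l0) (e2 : gn ;; kn = ln) (e3 : f0 ;; l0 = m0) (e4 : fn ;; ln = mn)
    (e5 : h0 ;; k0 = m0) (e6 : hn ;; kn = mn),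
    cells_paste s t u ->
    paste s (paste t c e1 e2) e3 e4 = paste u c e5 e6
}.

(** * Virtual equipments *)

(* The inverses of the bijections "paste with the cartesian 2-cell" and "paste with the unit
   of the loose-identity" are part of the structure; they are uniquely determined. *)
Record virtual_equipment := {
  ve :> virtual_double_category;
  restr : forall (X Y Z W : ve), loose X Y -> tight Z Y -> tight W X -> loose W Z;
  cart : forall (X Y Z W : ve) (p : loose X Y) (f : tight Z Y) (g : tight W X),
    cell [: restr p f g] p f g;
  restr_fact : forall (X Y Z W A0 An : ve) (p : loose X Y) (f : tight Z Y) (g : tight W X)
    (P : chains ve A0 An) (h0 : tight A0 Z) (hn : tight An W),
    cell P p (h0 ;; f) (hn ;; g) -> cell P (restr p f g) h0 hn;
  restr_factK : forall (X Y Z W A0 An : ve) (p : loose X Y) (f : tight Z Y) (g : tight W X)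
    (P : chains ve A0 An) (h0 : tight A0 Z) (hn : tight An W)
    (a : cell P p (h0 ;; f) (hn ;; g)),
    paste (cells_one (restr_fact a)) (cart p f g) eq_refl eq_refl = a;
  restr_fact_uniq : forall (X Y Z W A0 An : ve) (p : loose X Y) (f : tight Z Y) (g : tight W X)
    (P : chains ve A0 An) (h0 : tight A0 Z) (hn : tight An W)
    (b : cell P (restr p f g) h0 hn),
    restr_fact (paste (cells_one b) (cart p f g) eq_refl eq_refl) = b;
  lid : forall A : ve, loose A A;
  lunit : forall A : ve, cnil A =>> lid A;
  lid_fact : forall (A0 A An B0 Bn : ve) (P : chains ve A0 A) (Q : chains ve A An)
    (r : loose Bn B0) (f : tight A0 B0) (g : tight An Bn),
    cell (P +++ Q) r f g -> cell (P +++ lid A :-: Q) r f g;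
  lid_factK : forall (A0 A An B0 Bn : ve) (P : chains ve A0 A) (Q : chains ve A An)
    (r : loose Bn B0) (f : tight A0 B0) (g : tight An Bn) (a : cell (P +++ Q) r f g),
    paste (cells_app (cells_id P) (cells_cons (lunit A) (cells_id Q) eq_refl) eq_refl eq_refl)
      (lid_fact a) (tcomp_idl f) (tcomp_idl g) = a;
  lid_fact_uniq : forall (A0 A An B0 Bn : ve) (P : chains ve A0 A) (Q : chains ve A An)
    (r : loose Bn B0) (f : tight A0 B0) (g : tight An Bn)
    (b : cell (P +++ lid A :-: Q) r f g),
    lid_fact (paste
      (cells_app (cells_id P) (cells_cons (lunit A) (cells_id Q) eq_refl) eq_refl eq_refl)
      b (tcomp_idl f) (tcomp_idl g)) = b
}.

Arguments lid {v} A.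
Arguments lunit {v} A.

Section Hom.
Context {X : virtual_equipment}.

(* Composition of 2-cells with identity sides *)
Definition gcomp (A0 An : X) (P : chains X A0 An) (q r : loose An A0)
    (a : P =>> q) (b : [: q] =>> r) : P =>> r :=
  paste (cells_one a) b (tcomp_idl _) (tcomp_idl _).

(* B(f,g) *)
Definition hom (Z W B : X) (f : tight Z B) (g : tight W B) : loose W Z := restr (lid B) f g.

(* The 2-cell into B(f,g) with sides h0, hn corresponding to a 2-cell into B(1,1) with
   sides (h0;f), (hn;g) *)
Definition hom_fact (Z W B A0 An : X) (f : tight Z B) (g : tight W B) (P : chains X A0 An)
    (h0 : tight A0 Z) (hn : tight An W) (k0 : tight A0 B) (kn : tight An B)
    (e0 : h0 ;; f = k0) (en : hn ;; g = kn) (a : cell P (lid B) k0 kn) :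
    cell P (hom f g) h0 hn :=
  restr_fact
    match eq_sym e0 in _ = f', eq_sym en in _ = g' return cell P (lid B) f' g' with
    | eq_refl, eq_refl => a
    end.

(* The identity 2-cell f => f *)
Definition hom_id (A B : X) (f : tight A B) : cnil A =>> hom f f :=
  hom_fact (tcomp_idl f) (tcomp_idl f)
    (paste (cells_nil f) (lunit B) (tcomp_idr f) (tcomp_idr f)).

Definition lid_mul (B : X) : [: lid B; lid B] =>> lid B :=
  lid_fact (P := cnil B) (Q := [: lid B]) (idcell (lid B)).

(* B(f,g), B(g,h) => B(f,h) *)
Definition hom_mul (Z W V B : X) (f : tight Z B) (g : tight W B) (h : tight V B) :
    [: hom f g; hom g h] =>> hom f h :=
  hom_fact (tcomp_idl f) (tcomp_idl h)
    (paste (cells_two (cart (lid B) f g) (cart (lid B) g h)) (lid_mul B)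
       (tcomp_idr f) (tcomp_idr h)).

Definition hom_comp (Z W V B : X) (P : chains X Z W) (Q : chains X W V)
    (f : tight Z B) (g : tight W B) (h : tight V B)
    (a : P =>> hom f g) (b : Q =>> hom g h) : P +++ Q =>> hom f h :=
  paste (cells_two a b) (hom_mul f g h) (tcomp_idl _) (tcomp_idl _).

(* The loose-identities are functorial in tight-cells *)
Definition lid_map (B C : X) (k : tight B C) : cell [: lid B] (lid C) k k :=
  lid_fact (P := cnil B) (Q := cnil B)
    (paste (cells_nil k) (lunit C) (tcomp_idr k) (tcomp_idr k)).

(* B(f,g) => C(f',g') for f' = kf and g' = kg *)
Definition hom_map (Z W B C : X) (k : tight B C) (f : tight Z B) (g : tight W B)
    (f' : tight Z C) (g' : tight W C) (ef : f ;; k = f') (eg : g ;; k = g') :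
    [: hom f g] =>> hom f' g' :=
  hom_fact (tcomp_idl f') (tcomp_idl g')
    (paste (cells_one (cart (lid B) f g)) (lid_map k) ef eg).

(* The 2-cell phi(1,x) : B(f,g') => C(h,k') for phi : B(f,g) => C(h,k), where
   g' = gx and k' = kx *)
Definition hom_restr (Z W V B C : X) (f : tight Z B) (g : tight W B)
    (h : tight Z C) (k : tight W C) (phi : [: hom f g] =>> hom h k) (x : tight V W)
    (g' : tight V B) (k' : tight V C) (eg : x ;; g = g') (ek : x ;; k = k') :
    [: hom f g'] =>> hom h k' :=
  hom_fact (tcomp_idl h) (tcomp_idl k')
    (paste
       (cells_one
          (paste
             (cells_one (hom_fact (hn := x) (tcomp_idl f) eg (cart (lid B) f g')))
             phi (tcomp_idl _) (tcomp_idr x)))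
       (cart (lid C) h k) (tcomp_idl h) ek).

(** * Relative monads, algebras and adjunctions *)

(* Composition with eta : j => t, as a 2-cell E(t,g) => E(j,g) *)
Definition hom_precomp (A W E : X) (j t : tight A E) (eta : cnil A =>> hom j t)
    (g : tight W E) : [: hom t g] =>> hom j g :=
  hom_comp eta (idcell (hom t g)).

Record rel_monad (A E : X) (j : tight A E) := {
  mon : tight A E;
  mon_ext : [: hom j mon] =>> hom mon mon;
  mon_unit : cnil A =>> hom j mon;
  mon_ext_unit : gcomp mon_ext (hom_precomp mon_unit mon) = idcell (hom j mon);
  mon_unit_ext : gcomp mon_unit mon_ext = hom_id mon;
  mon_assoc : hom_comp mon_ext mon_ext =
    gcomp (hom_comp (idcell (hom j mon)) mon_ext) mon_ext
}.

Record algebra (A E : X) (j : tight A E) (T : rel_monad j) (D : X) := {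
  alg : tight D E;
  alg_act : [: hom j alg] =>> hom (mon T) alg;
  alg_unit : gcomp alg_act (hom_precomp (mon_unit T) alg) = idcell (hom j alg);
  alg_assoc : hom_comp (mon_ext T) alg_act =
    gcomp (hom_comp (idcell (hom j (mon T))) alg_act) alg_act
}.

Definition is_graded_morphism (A E : X) (j : tight A E) (T : rel_monad j) (D D' : X)
    (a : algebra T D) (a' : algebra T D') (P : chains X D D')
    (eps : P =>> hom (alg a) (alg a')) : Prop :=
  hom_comp (alg_act a) eps =
    gcomp (hom_comp (idcell (hom j (alg a))) eps) (alg_act a').

Record algebra_object (A E : X) (j : tight A E) (T : rel_monad j) := {
  Alg : X;
  ualg : algebra T Alg;
  alg_lift : forall (D : X), algebra T D -> tight D Alg;
  alg_liftE : forall (D : X) (a : algebra T D), alg_lift a ;; alg ualg = alg a;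
  alg_lift_act : forall (D : X) (a : algebra T D),
    hom_restr (alg_act ualg) (alg_liftE a) (alg_liftE a) = alg_act a;
  alg_lift_uniq : forall (D : X) (a : algebra T D) (x : tight D Alg)
    (ex : x ;; alg ualg = alg a),
    hom_restr (alg_act ualg) ex ex = alg_act a -> x = alg_lift a;
  alg_lift2 : forall (D D' : X) (a : algebra T D) (a' : algebra T D') (P : chains X D D')
    (eps : P =>> hom (alg a) (alg a')),
    is_graded_morphism eps ->
    exists! phi : P =>> hom (alg_lift a) (alg_lift a'),
      gcomp phi (hom_map (alg_liftE a) (alg_liftE a')) = eps
}.

(* A left j-adjoint of r *)
Record left_adjoint (A E C : X) (j : tight A E) (r : tight C E) := {
  ladj : tight A C;
  sharp : [: hom ladj (tid C)] =>> hom j r;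
  flat : [: hom j r] =>> hom ladj (tid C);
  sharpK : gcomp sharp flat = idcell (hom ladj (tid C));
  flatK : gcomp flat sharp = idcell (hom j r)
}.

End Hom.

(** ** Calculus of 2-cells into [hom f g] *)

Ltac pirr := repeat first [reflexivity | apply proof_irrelevance | progress f_equal].

Ltac sides := intros; subst; simpl;
  repeat rewrite ?tcomp_assoc, ?tcomp_idl, ?tcomp_idr; try congruence.

Section L.
Context {X : virtual_double_category}.

Lemma cells_app_cons (A0 A1 A2 An B0 B1 B2 Bn : X) (P1 : chains X A0 A1) (P2 : chains X A1 A2)
  (P3 : chains X A2 An) (q : loose B1 B0) (Q1 : chains X B1 B2) (Q2 : chains X B2 Bn)
  (R : chains X A0 A2) (S : chains X A0 An) (T : chains X A1 An) (U : chains X B1 Bn)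
  (f0 : tight A0 B0) (f1 : tight A1 B1) (f2 : tight A2 B2) (fn : tight An Bn)
  (a : cell P1 q f0 f1) (s : pcells P2 Q1 f1 f2) (t : pcells P3 Q2 f2 fn)
  (e : P1 +++ P2 = R) (e1 : R +++ P3 = S) (e2 : (q :-: Q1) +++ Q2 = q :-: U)
  (e3 : P2 +++ P3 = T) (e4 : Q1 +++ Q2 = U) (e5 : P1 +++ T = S) :
  cells_app (cells_cons a s e) t e1 e2 = cells_cons a (cells_app s t e3 e4) e5.
Proof.
  destruct e3, e4. rewrite (proof_irrelevance _ e2 eq_refl). simpl. pirr.
Qed.

Lemma cells_app_nil (A0 An B0 Bn : X) (P : chains X A0 An) (Q : chains X B0 Bn)
  (f : tight A0 B0) (g : tight An Bn) (s : pcells P Q f g)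
  (eP : P +++ cnil An = P) (eQ : Q +++ cnil Bn = Q) : cells_app s (cells_nil g) eP eQ = s.
Proof.
  induction s.
  - rewrite (proof_irrelevance _ eP eq_refl), (proof_irrelevance _ eQ eq_refl); reflexivity.
  - rewrite (@cells_app_cons _ _ _ _ _ _ _ _ _ _ _ _ _ _ _ _ _ _ _ _ _ _ a s (cells_nil fn) eP0 eP eQ
       (capp_nil P2) (capp_nil Q) eP0), IHs. reflexivity.
Qed.

Lemma paste1 (A0 An B0 Bn C0 Cn D0 Dn : X)
  (P : chains X A0 An) (Q : chains X B0 Bn) (r : loose Cn C0) (d : loose Dn D0)
  (f0 : tight A0 B0) (fn : tight An Bn) (g0 : tight B0 C0) (gn : tight Bn Cn)
  (k0 : tight C0 D0) (kn : tight Cn Dn) (h0 : tight A0 C0) (hn : tight An Cn)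
  (l0 : tight B0 D0) (ln : tight Bn Dn) (m0 : tight A0 D0) (mn : tight An Dn)
  (s : pcells P Q f0 fn) (b : cell Q r g0 gn) (c : cell [: r] d k0 kn)
  (e1 : g0 ;; k0 = l0) (e2 : gn ;; kn = ln) (e3 : f0 ;; l0 = m0) (e4 : fn ;; ln = mn)
  (e7 : f0 ;; g0 = h0) (e8 : fn ;; gn = hn) 
  (e5 : h0 ;; k0 = m0) (e6 : hn ;; kn = mn) :
  paste s (paste (cells_one b) c e1 e2) e3 e4 =
  paste (cells_one (paste s b e7 e8)) c e5 e6.
Proof.
  apply paste_assoc.
  pose proof (@cells_paste_cons X _ _ _ _ _ _ _ _ _ P (cnil An) P Q (cnil Bn) Q r (cnil Cn)
    _ _ _ _ _ _ _ _ _ s b (cells_nil fn) (cells_nil gn) (cells_nil hn)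
    (capp_nil P) (capp_nil Q) e7 e8 (cells_paste_nil e8)) as H.
  rewrite cells_app_nil in H. exact H.
Qed.

Lemma paste2 (A0 A1 An B0 B1 Bn C0 C1 Cn D0 Dn : X)
  (P1 : chains X A0 A1) (P2 : chains X A1 An) (Q1 : chains X B0 B1) (Q2 : chains X B1 Bn)
  (r1 : loose C1 C0) (r2 : loose Cn C1) (d : loose Dn D0)
  (f0 : tight A0 B0) (f1 : tight A1 B1) (fn : tight An Bn)
  (g0 : tight B0 C0) (g1 : tight B1 C1) (gn : tight Bn Cn)
  (k0 : tight C0 D0) (kn : tight Cn Dn)
  (h0 : tight A0 C0) (h1 : tight A1 C1) (hn : tight An Cn)
  (l0 : tight B0 D0) (ln : tight Bn Dn) (m0 : tight A0 D0) (mn : tight An Dn)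
  (s1 : pcells P1 Q1 f0 f1) (s2 : pcells P2 Q2 f1 fn)
  (b1 : cell Q1 r1 g0 g1) (b2 : cell Q2 r2 g1 gn) (c : cell [: r1; r2] d k0 kn)
  (e1 : g0 ;; k0 = l0) (e2 : gn ;; kn = ln) (e3 : f0 ;; l0 = m0) (e4 : fn ;; ln = mn)
  (e7 : f0 ;; g0 = h0) (e8 : f1 ;; g1 = h1) (e9 : fn ;; gn = hn) 
  (e5 : h0 ;; k0 = m0) (e6 : hn ;; kn = mn) :
  paste (cells_app s1 s2 eq_refl eq_refl) (paste (cells_two b1 b2) c e1 e2) e3 e4 =
  paste (cells_two (paste s1 b1 e7 e8) (paste s2 b2 e8 e9)) c e5 e6.
Proof.
  apply paste_assoc. unfold cells_two.
  apply cells_paste_cons.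
  pose proof (@cells_paste_cons X _ _ _ _ _ _ _ _ _ P2 (cnil An) P2 Q2 (cnil Bn) Q2 r2 (cnil Cn)
    _ _ _ _ _ _ _ _ _ s2 b2 (cells_nil fn) (cells_nil gn) (cells_nil hn)
    (capp_nil P2) (capp_nil Q2) e8 e9 (cells_paste_nil e9)) as H.
  rewrite cells_app_nil in H. exact H.
Qed.

Lemma paste_nil (A B C D : X) (q : loose D D) (f : tight A B) (g : tight B C) (h: tight C D)
  (l : tight B D) (k : tight A C) (m : tight A D) (b : cell (cnil C) q h h) e1 e2 e3 e4 e5 e6 (e : f ;; g = k) :
  paste (cells_nil f) (paste (cells_nil g) b e1 e2 : cell _ _ l l) e3 e4 =
  paste (cells_nil k) b e5 e6 :> cell _ _ m m.
Proof. apply paste_assoc. apply cells_paste_nil. assumption. Qed.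

Lemma paste1_idl (An A0 B0 Bn : X) (q : loose An A0) (r : loose Bn B0) f g (b : cell [: q] r f g) e1 e2 :
  paste (cells_one (idcell q)) b e1 e2 = b.
Proof.
  rewrite <- (paste_idl b e1 e2) at 2. simpl. unfold cells_one. pirr.
Qed.
End L.

Section V.
Context {X : virtual_equipment}.

Lemma cart_inj (Y Y' Z W A0 An : X) (p : loose Y Y') (f : tight Z Y') (g : tight W Y)
  (P : chains X A0 An) h0 hn k0 kn (b b' : cell P (restr p f g) h0 hn) 
  (e0 : h0 ;; f = k0) (en : hn ;; g = kn) :
  paste (cells_one b) (cart p f g) e0 en = paste (cells_one b') (cart p f g) e0 en -> b = b'.
Proof.
  destruct e0, en. intros H. apply (f_equal (@restr_fact _ _ _ _ _ _ _ _ _ _ _ _ _)) in H.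
  now rewrite !restr_fact_uniq in H.
Qed.

Lemma hom_factK (Z W B A0 An : X) (f : tight Z B) (g : tight W B) (P : chains X A0 An)
    (h0 : tight A0 Z) (hn : tight An W) (k0 : tight A0 B) (kn : tight An B)
    (e0 e0' : h0 ;; f = k0) (en en' : hn ;; g = kn) (a : cell P (lid B) k0 kn) :
  paste (cells_one (hom_fact e0 en a)) (cart (lid B) f g) e0' en' = a.
Proof.
  destruct e0, en. rewrite (proof_irrelevance _ e0' eq_refl), (proof_irrelevance _ en' eq_refl).
  apply restr_factK.
Qed.

Lemma hom_fact_eq (Z W B A0 An : X) (f : tight Z B) (g : tight W B) (P : chains X A0 An)
    (h0 : tight A0 Z) (hn : tight An W) (k0 : tight A0 B) (kn : tight An B)
    (e0 e0' : h0 ;; f = k0) (en en' : hn ;; g = kn) (b : cell P (hom f g) h0 hn) :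
  hom_fact e0 en (paste (cells_one b) (cart (lid B) f g) e0' en') = b.
Proof. eapply cart_inj. apply hom_factK. Unshelve. all: assumption. Qed.

(* The 2-cell with bottom B(1,1) corresponding to a 2-cell into B(f,g) *)
Definition tr (Z W B A0 An : X) (f : tight Z B) (g : tight W B) (P : chains X A0 An)
    (h0 : tight A0 Z) (hn : tight An W) k0 kn (e0 : h0 ;; f = k0) (en : hn ;; g = kn)
    (b : cell P (hom f g) h0 hn) : cell P (lid B) k0 kn :=
  paste (cells_one b) (cart (lid B) f g) e0 en.

Definition rcomp (Z W V B : X) (P : chains X Z W) (Q : chains X W V)
    (f : tight Z B) (g : tight W B) (h : tight V B)
    (a : cell P (lid B) f g) (b : cell Q (lid B) g h) : cell (P +++ Q) (lid B) f h :=
  paste (cells_two a b) (lid_mul B) (tcomp_idr f) (tcomp_idr h).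

Definition rmap (Z W B C : X) (P : chains X Z W) (k : tight B C)
    (f : tight Z B) (g : tight W B) f' g' (e0 : f ;; k = f') (en : g ;; k = g')
    (a : cell P (lid B) f g) : cell P (lid C) f' g' :=
  paste (cells_one a) (lid_map k) e0 en.

Definition rid (A B : X) (f : tight A B) : cell (cnil A) (lid B) f f :=
  paste (cells_nil f) (lunit B) (tcomp_idr f) (tcomp_idr f).

Lemma tr_inj (Z W B A0 An : X) (f : tight Z B) (g : tight W B) (P : chains X A0 An)
    (h0 : tight A0 Z) (hn : tight An W) k0 kn (e0 : h0 ;; f = k0) (en : hn ;; g = kn)
    (b b' : cell P (hom f g) h0 hn) : tr e0 en b = tr e0 en b' -> b = b'.
Proof. apply cart_inj. Qed.

Lemma tr_hom_id (A B : X) (f : tight A B) (e0 e1 : tid A ;; f = f) : tr e0 e1 (hom_id f) = rid f.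
Proof. apply hom_factK. Qed.

Lemma lid_mul_unit (B : X) e e' : paste (cells_two (lunit B) (idcell (lid B))) (lid_mul B) e e' = idcell (lid B).
Proof.
  transitivity (paste
      (cells_app (cells_id (cnil B)) (cells_cons (lunit B) (cells_id [: lid B]) eq_refl) eq_refl eq_refl)
      (lid_mul B) (tcomp_idl _) (tcomp_idl _)).
  - simpl. unfold cells_two, cells_one. pirr.
  - apply (@lid_factK X _ _ _ _ _ (cnil B) [: lid B]).
Qed.

Lemma paste_nil_one (A B A0 An : X) (P : chains X A An) (q : loose B A0) f g (b : cell P q f g) (e : cnil A +++ P = P) eQ :
  cells_app (cells_nil f) (cells_one b) e eQ = cells_one b.
Proof. simpl in *. rewrite (proof_irrelevance _ e eq_refl), (proof_irrelevance _ eQ eq_refl). reflexivity. Qed.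

Lemma rcomp_rid (A W B : X) (P : chains X A W) (f : tight A B) g (b : cell P (lid B) f g) :
  rcomp (rid f) b = b.
Proof.
  unfold rcomp, rid.
  assert (E : b = paste (cells_one b) (idcell _) (tcomp_idr f) (tcomp_idr _)) by (now rewrite paste_idr).
  rewrite E at 1.
  erewrite <- (paste2 (cells_nil f) (cells_one b) (lunit B) (idcell _) (lid_mul B)
     (tcomp_idl _) (tcomp_idl _) (tcomp_idr _) (tcomp_idr _)).
  rewrite lid_mul_unit. simpl. apply paste_idr.
Qed.

Lemma lid_ext2 (B C D0 Dn: X) (Q : chains X B C) (r : loose Dn D0) f g (b b' : cell (lid B :-: Q) r f g) :
  paste (cells_cons (lunit B) (cells_id Q) eq_refl) b (tcomp_idl _) (tcomp_idl _) =
  paste (cells_cons (lunit B) (cells_id Q) eq_refl) b' (tcomp_idl _) (tcomp_idl _) -> b = b'.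
Proof.
  intros H. apply (f_equal (@lid_fact X B B C D0 Dn (cnil B) Q r f g)) in H.
  rewrite <- (@lid_fact_uniq X B B C D0 Dn (cnil B) Q r f g b), <- (@lid_fact_uniq X B B C D0 Dn (cnil B) Q r f g b').
  exact H.
Qed.

Lemma lid_map_unit (B C : X) (k : tight B C) e1 e2 :
   paste (cells_one (lunit B)) (lid_map k) e1 e2 = rid k.
Proof.
  transitivity (paste
      (cells_app (cells_id (cnil B)) (cells_cons (lunit B) (cells_id (cnil B)) eq_refl) eq_refl eq_refl)
      (lid_map k) (tcomp_idl _) (tcomp_idl _)).
  - simpl. unfold cells_two, cells_one. pirr.
  - apply (@lid_factK X _ _ _ _ _ (cnil B) (cnil B)).
Qed.

Lemma rmap_rid (A B C : X) (f : tight A B) (k : tight B C) h (e : f ;; k = h) e' :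
  rmap e e' (rid f) = rid h.
Proof.
  unfold rmap, rid.
  erewrite <- (@paste1 X) with (e1 := tcomp_idl k) (e2 := tcomp_idl k). rewrite lid_map_unit. unfold rid.
  apply paste_nil. assumption.
  Unshelve. all: assumption.
Qed.

Lemma cells_one_eq (A B D0 Dn : X) (P : chains X A B) (r : loose Dn D0) f g (b : cell P r f g) e :
  cells_cons b (cells_nil g) e = cells_one b.
Proof. unfold cells_one; pirr. Qed.

Lemma lid_map_mul (B C : X) (k : tight B C) e1 e2 e3 e4 :
  paste (cells_one (lid_mul B)) (lid_map k) e1 e2 =
  paste (cells_two (lid_map k) (lid_map k)) (lid_mul C) e3 e4 :> cell _ _ k k.
Proof.
  apply lid_ext2. simpl cells_id. rewrite !cells_one_eq.
  change (cells_cons (lunit B) (cells_one (idcell (lid B))) eq_refl) with (cells_two (lunit B) (idcell (lid B))) at 1.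
  erewrite paste1 with (e7 := tcomp_idl (tid B)) (e8 := tcomp_idl (tid B)).
  rewrite lid_mul_unit. simpl capp. rewrite paste1_idl.
  transitivity (rcomp (rid k) (lid_map k)). now rewrite rcomp_rid.
  unfold rcomp.
  pose proof (paste2 
    (cells_one (lunit B)) (cells_one (idcell (lid B))) (lid_map k) (lid_map k) (lid_mul C) 
    e3 e4 (tcomp_idl k) (tcomp_idl k) (tcomp_idl k) (tcomp_idl k) (tcomp_idl k) (tcomp_idr k) (tcomp_idr k)) as H.
  rewrite lid_map_unit, paste1_idl in H. rewrite <- H. simpl. unfold cells_one. pirr.
  Unshelve. all: apply tcomp_idl.
Qed.

Lemma rmap_rcomp (Z W V B C : X) (P : chains X Z W) (Q : chains X W V)
    (f : tight Z B) (g : tight W B) (h : tight V B)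
    (a : cell P (lid B) f g) (b : cell Q (lid B) g h) (k : tight B C) f' g' h'
    (ef : f ;; k = f') (eg : g ;; k = g') (eh : h ;; k = h') :
  rmap ef eh (rcomp a b) = rcomp (rmap ef eg a) (rmap eg eh b).
Proof.
  unfold rmap, rcomp.
  erewrite <- paste1 with (e1 := tcomp_idl k) (e2 := tcomp_idl k) (e3 := ef) (e4 := eh). 
  erewrite (lid_map_mul _ _ (tcomp_idr k) (tcomp_idr k)).
  assert (E : cells_two a b = cells_app (cells_one a) (cells_one b) eq_refl eq_refl).
  { simpl. unfold cells_two, cells_one. pirr. }
  rewrite E. exact (paste2 (cells_one a) (cells_one b) (lid_map k) (lid_map k) (lid_mul C)
    (tcomp_idr k) (tcomp_idr k) ef eh ef eg eh (tcomp_idr f') (tcomp_idr h')).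
  Unshelve. all: apply tcomp_idl.
Qed.

Lemma tr_hom_comp (Z W V B : X) (P : chains X Z W) (Q : chains X W V)
    (f : tight Z B) (g : tight W B) (h : tight V B) (a : P =>> hom f g) (b : Q =>> hom g h)
    (e0 : tid Z ;; f = f) (e1 : tid W ;; g = g) (e2 : tid V ;; h = h) :
  tr e0 e2 (hom_comp a b) = rcomp (tr e0 e1 a) (tr e1 e2 b).
Proof.
  unfold tr, hom_comp, hom_mul, rcomp.
  erewrite <- paste1 with (e1 := tcomp_idl f) (e2 := tcomp_idl h) (e3 := e0) (e4 := e2).
  rewrite hom_factK.
  assert (E : cells_two a b = cells_app (cells_one a) (cells_one b) eq_refl eq_refl).
  { simpl. unfold cells_two, cells_one. pirr. }
  rewrite E. exact (paste2 (cells_one a) (cells_one b) (cart _ f g) (cart _ g h) (lid_mul B)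
    (tcomp_idr _) (tcomp_idr _) e0 e2 e0 e1 e2 (tcomp_idr _) (tcomp_idr _)).
  Unshelve. all: apply tcomp_idl.
Qed.

Lemma tr_hom_map (Z W B C : X) (P : chains X Z W) (k : tight B C)
    (f : tight Z B) (g : tight W B) f' g' (e0 : f ;; k = f') (en : g ;; k = g') 
    (a : P =>> hom f g) (ef : tid Z ;; f = f) (eg : tid W ;; g = g)
    (ef' : tid Z ;; f' = f') (eg' : tid W ;; g' = g') :
  tr ef' eg' (gcomp a (hom_map e0 en)) = rmap e0 en (tr ef eg a).
Proof.
  unfold tr, gcomp, hom_map, rmap.
  erewrite <- paste1 with (e1 := tcomp_idl f') (e2 := tcomp_idl g') (e3 := ef') (e4 := eg').
  rewrite hom_factK. apply paste1.
Qed.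

Lemma gcomp_id (A0 An : X) (P : chains X A0 An) (q : loose An A0) (a : P =>> q) : gcomp a (idcell q) = a.
Proof. apply paste_idr. Qed.
Lemma gcomp_idl (A0 An : X) (p q : loose An A0) (a : [: p] =>> q) : gcomp (idcell p) a = a.
Proof. apply paste1_idl. Qed.
Lemma gcompA (A0 An : X) (P : chains X A0 An) (q r s : loose An A0) (a : P =>> q) (b : [: q] =>> r) (c : [: r] =>> s) :
  gcomp a (gcomp b c) = gcomp (gcomp a b) c.
Proof. apply paste1. Qed.

(* The action of phi : B(f,g) => C(h,k), seen as a map from 2-cells into B(1,1) with left side f
   to 2-cells into C(1,1) with left side h *)
Section Act.
Context (Z W V B C : X) (f : tight Z B) (g : tight W B)
    (h : tight Z C) (k : tight W C) (phi : [: hom f g] =>> hom h k) (x : tight V W)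
    (g' : tight V B) (k' : tight V C) (eg : x ;; g = g') (ek : x ;; k = k').

Definition act (P : chains X Z V) (a : cell P (lid B) f g') : cell P (lid C) h k' :=
  paste (cells_one (paste (cells_one (hom_fact (tcomp_idl f) eg a)) phi (tcomp_idl _) (tcomp_idr x)))
   (cart (lid C) h k) (tcomp_idl h) ek.

Lemma hom_fact_sub (P : chains X Z V) (q : loose V Z) (y : P =>> q) (a : cell [: q] (lid B) f g')
   (e0 : tid Z ;; tid Z = tid Z) (en : tid V ;; x = x) :
  paste (cells_one y) (hom_fact (tcomp_idl f) eg a) e0 en =
  hom_fact (tcomp_idl f) eg (paste (cells_one y) a (tcomp_idl _) (tcomp_idl _)).
Proof.
  apply (tr_inj (e0:=tcomp_idl f) (en := eg)). unfold tr. rewrite hom_factK. erewrite <- paste1. rewrite hom_factK. reflexivity.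
  Unshelve. all: sides.
Qed.

Lemma act_sub (P : chains X Z V) (q : loose V Z) (y : P =>> q) (a : cell [: q] (lid B) f g')
   (e0 : tid Z ;; h = h) (en : tid V ;; k' = k') :
  paste (cells_one y) (act a) e0 en = act (paste (cells_one y) a (tcomp_idl _) (tcomp_idl _)).
Proof.
  unfold act. erewrite paste1. f_equal. f_equal. erewrite paste1. f_equal. f_equal. apply hom_fact_sub.
  Unshelve. all: apply tcomp_idl.
Qed.

Lemma tr_gcomp_restr (P : chains X Z V) (y : P =>> hom f g') (e0 : tid Z ;; h = h) (en : tid V ;; k' = k')
    (e1 : tid Z ;; f = f) (e2 : tid V ;; g' = g') :
  tr e0 en (gcomp y (hom_restr phi eg ek)) = act (tr e1 e2 y).
Proof.
  unfold tr, gcomp. rewrite <- paste1 with (e1 := tcomp_idl h) (e2 := tcomp_idl k') (e3 := e0) (e4 := en).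
  unfold hom_restr. rewrite hom_factK.
  change (paste (cells_one y) (act (cart (lid B) f g')) e0 en =  act (paste (cells_one y) (cart (lid B) f g') e1 e2)).
  rewrite act_sub. pirr.
  Unshelve. all: apply tcomp_idl.
Qed.
End Act.

Lemma tr_gcomp (Z W B C : X) (f : tight Z B) (g : tight W B)
    (h : tight Z C) (k : tight W C) (phi : [: hom f g] =>> hom h k)
    (P : chains X Z W) (y : P =>> hom f g) (e0 : tid Z ;; h = h) (en : tid W ;; k = k)
    (e1 : tid Z ;; f = f) (e2 : tid W ;; g = g) :
  tr e0 en (gcomp y phi) = act phi (tcomp_idl g) (tcomp_idl k) (tr e1 e2 y).
Proof. unfold act, tr. rewrite hom_fact_eq. unfold gcomp. pirr. Qed.

Section Adj.
Context {A E C : X} {j : tight A E} {r : tight C E} (a : left_adjoint j r).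
Context (V : X) (x : tight V C) (x' : tight V E) (e : x ;; r = x').

Definition sharp_act (P : chains X A V) : cell P (lid C) (ladj a) x -> cell P (lid E) j x' :=
  act (sharp a) (tcomp_idr x) e (P := P).
Definition flat_act (P : chains X A V) : cell P (lid E) j x' -> cell P (lid C) (ladj a) x :=
  act (flat a) e (tcomp_idr x) (P := P).

Lemma sactK P (y : cell P _ _ _) : flat_act (sharp_act y) = y.
Proof.
  unfold sharp_act, flat_act. unfold act at 1. unfold act at 1. rewrite hom_fact_eq.
  erewrite <- (paste1 _ (sharp a) (flat a) (tcomp_idl _) (tcomp_idl _)).
  change (paste _ (flat a) _ _) with (gcomp (sharp a) (flat a)) at 1.
  rewrite sharpK, paste_idr. apply hom_factK.
  Unshelve. all: sides.
Qed.

Lemma factK P (y : cell P _ _ _) : sharp_act (flat_act y) = y.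
Proof.
  unfold sharp_act, flat_act. unfold act at 1. unfold act at 1. rewrite hom_fact_eq.
  erewrite <- (paste1 _ (flat a) (sharp a) (tcomp_idl _) (tcomp_idl _)).
  change (paste _ (sharp a) _ _) with (gcomp (flat a) (sharp a)) at 1.
  rewrite flatK, paste_idr. apply hom_factK.
  Unshelve. all: sides.
Qed.
End Adj.

Lemma hom_fact_subs (Z W B A0 An B0 Bn : X) (f : tight Z B) (g : tight W B) (P : chains X A0 An)
    (Q : chains X B0 Bn)
    (h0 : tight B0 Z) (hn : tight Bn W) (k0 : tight B0 B) (kn : tight Bn B)
    (u0 : tight A0 B0) (un : tight An Bn) l0 ln (m0 : tight A0 B) (mn : tight An B)
    (s : pcells P Q u0 un) (a : cell Q (lid B) k0 kn)
    (e0 : h0 ;; f = k0) (en : hn ;; g = kn) (d0 : u0 ;; h0 = l0) (dn : un ;; hn = ln)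
    (e0' : l0 ;; f = m0) (en' : ln ;; g = mn) (d0' : u0 ;; k0 = m0) (dn' : un ;; kn = mn) :
  paste s (hom_fact e0 en a) d0 dn = hom_fact e0' en' (paste s a d0' dn').
Proof.
  apply (tr_inj (e0:=e0') (en := en')). unfold tr. rewrite hom_factK.
  rewrite <- paste1 with (e1 := e0) (e2 := en) (e3 := d0') (e4 := dn').
  rewrite hom_factK. reflexivity.
Qed.

Lemma rid_id (B : X) : rid (tid B) = lunit B.
Proof. apply (paste_idl (lunit B)). Qed.

Lemma lid_mul_unit_r (B : X) e e' : paste (cells_two (idcell (lid B)) (lunit B)) (lid_mul B) e e' = idcell (lid B) :> cell [: lid B] _ _ _.
Proof.
  apply (@lid_ext2 B B B B (cnil B) (lid B)). simpl cells_id. rewrite !cells_one_eq.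
  rewrite paste_idr.
  transitivity (rcomp (lunit B) (lunit B)).
  - unfold rcomp.
    pose proof (paste2 (cells_one (lunit B)) (cells_nil (tid B)) (idcell (lid B)) (lunit B) (lid_mul B)
      e e' (tcomp_idl _) (tcomp_idl _) (tcomp_idl _) (tcomp_idl _) (tcomp_idl _) (tcomp_idl _) (tcomp_idl _)) as H.
    rewrite paste_idr in H. change (cells_nil (tid B)) with (cells_id (cnil B)) in H.
    rewrite (paste_idl (lunit B)) in H. simpl capp in H.
    rewrite (proof_irrelevance _ (tcomp_idr (tid B)) (tcomp_idl (tid B))).
    etransitivity; [|exact H]. simpl cells_id. f_equal. symmetry. apply cells_app_nil.
  - rewrite <- (rid_id B) at 1. apply rcomp_rid.
Qed.

Lemma rcomp_rid_r (Z W B : X) (p : loose W Z) f g (a : cell [: p] (lid B) f g) :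
  rcomp a (rid g) = a.
Proof.
  unfold rcomp, rid.
  pose proof (paste2 (cells_one a) (cells_nil g) (idcell (lid B)) (lunit B) (lid_mul B)
      (tcomp_idl _) (tcomp_idl _) (tcomp_idr _) (tcomp_idr _) (tcomp_idr _) (tcomp_idr _) (tcomp_idr _) (tcomp_idr _) (tcomp_idr _)) as H.
  simpl capp in *. rewrite lid_mul_unit_r, paste_idr in H.
  rewrite <- H.
  etransitivity; [|exact (paste_idr a (tcomp_idr _) (tcomp_idr _))].
  f_equal. apply cells_app_nil.
Qed.



Lemma lid_ext_r (A0 A B0 B : X) (p : loose A A0) (q : loose B B0) u (un : tight A B)
    (b b' : cell ([: p] +++ [: lid A]) q u un) :
  paste (cells_app (cells_one (idcell p)) (cells_one (lunit A)) eq_refl eq_refl) b (tcomp_idl _) (tcomp_idl _) =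
  paste (cells_app (cells_one (idcell p)) (cells_one (lunit A)) eq_refl eq_refl) b' (tcomp_idl _) (tcomp_idl _) -> b = b'.
Proof.
  intros H.
  rewrite <- (@lid_fact_uniq X A0 A A B0 B [: p] (cnil A) q u un b),
   <- (@lid_fact_uniq X A0 A A B0 B [: p] (cnil A) q u un b').
  f_equal. simpl cells_id. rewrite !cells_one_eq. exact H.
Qed.

Lemma hom_fact_cart (Z W B : X) (f : tight Z B) (g : tight W B) e0 en :
  hom_fact (P := [: hom f g]) e0 en (cart (lid B) f g) = idcell (hom f g).
Proof.
  rewrite <- (hom_fact_eq e0 e0 en en (idcell (hom f g))). f_equal. symmetry. apply paste1_idl.
Qed.

Section Nat.
Context {A E C : X} {j : tight A E} {r : tight C E} (l : tight A C) (phi : [: hom l (tid C)] =>> hom j r).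
Context (Z V : X) (v : tight Z C) (u : tight V C) (v' : tight Z E) (u' : tight V E)
  (ev : v ;; r = v') (eu : u ;; r = u').

Let G1 : cell [: hom l (tid C); lid C] (lid C) l (tid C) :=
  paste (cells_two (P1 := [: hom l (tid C)]) (cart (lid C) l (tid C)) (idcell (lid C))) (lid_mul C) (tcomp_idr _) (tcomp_idr _).
Let F1 : [: hom l (tid C); lid C] =>> hom l (tid C) := hom_fact (tcomp_idl _) (tcomp_idl _) G1.
Let G1' : cell [: hom l (tid C); lid C] (lid E) j r := 
  paste (cells_one (gcomp F1 phi)) (cart (lid E) j r) (tcomp_idl _) (tcomp_idl _).
Let G2' : cell [: hom l (tid C); lid C] (lid E) j r := 
  paste (cells_two (tr (tcomp_idl j) (tcomp_idl r) phi) (lid_map r)) (lid_mul E) (tcomp_idr _) (tcomp_idr _).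

Lemma G1G2 : G1' = G2'.
Proof.
  apply lid_ext_r.
  unfold G1'.
  rewrite paste1 with (e7 := tcomp_idl _) (e8 := tcomp_idl _) (e5 := tcomp_idl _) (e6 := tcomp_idl _).
  unfold gcomp.
  rewrite paste1 with (e7 := tcomp_idl _) (e8 := tcomp_idl _) (e5 := tcomp_idl _) (e6 := tcomp_idl _).
  unfold F1.
  rewrite hom_fact_subs with (e0' := tcomp_idl _) (en' := tcomp_idl _) (d0' := tcomp_idl _) (dn' := tcomp_idl _).
  assert (HL : paste (cells_app (cells_one (idcell (hom l (tid C)))) (cells_one (lunit C)) eq_refl eq_refl)
     G1 (tcomp_idl l) (tcomp_idl (tid C)) = cart (lid C) l (tid C)).
  { etransitivity; [exact (paste2 (cells_one (idcell (hom l (tid C)))) (cells_one (lunit C))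
      (cart (lid C) l (tid C)) (idcell (lid C)) (lid_mul C) (tcomp_idr l) (tcomp_idr _) (tcomp_idl l) (tcomp_idl _)
      (tcomp_idl l) (tcomp_idl _) (tcomp_idl _) (tcomp_idr l) (tcomp_idr _))|].
    rewrite paste1_idl, paste_idr. 
    pose proof (rcomp_rid_r (cart (lid C) l (tid C))) as H. rewrite rid_id in H. exact H. }
  assert (HR : paste (cells_app (cells_one (idcell (hom l (tid C)))) (cells_one (lunit C)) eq_refl eq_refl)
     G2' (tcomp_idl j) (tcomp_idl r) = tr (tcomp_idl j) (tcomp_idl r) phi).
  { etransitivity; [exact (paste2 (cells_one (idcell (hom l (tid C)))) (cells_one (lunit C))
      (tr (tcomp_idl j) (tcomp_idl r) phi) (lid_map r) (lid_mul E) (tcomp_idr j) (tcomp_idr _) (tcomp_idl j) (tcomp_idl _)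
      (tcomp_idl j) (tcomp_idl r) (tcomp_idl r) (tcomp_idr j) (tcomp_idr _))|].
    rewrite paste1_idl, lid_map_unit. apply rcomp_rid_r. }
  etransitivity; [|symmetry; exact HR].
  refine (eq_trans (f_equal (fun c => paste (cells_one (gcomp (hom_fact (P:=[: hom l (tid C)])
    (tcomp_idl l) (tcomp_idl (tid C)) c) phi)) (cart (lid E) j r) (tcomp_idl j) (tcomp_idl r)) HL) _).
  rewrite hom_fact_cart. unfold tr. f_equal. f_equal. apply paste1_idl.
Qed.

Lemma act_nat (P : chains X A Z) (Q : chains X Z V) (a : cell P (lid C) l v) (b : cell Q (lid C) v u) :
  act phi (tcomp_idr u) eu (rcomp a b) = rcomp (act phi (tcomp_idr v) ev a) (rmap ev eu b).
Proof.
  set (fa := hom_fact (f := l) (tcomp_idl l) (tcomp_idr v) a).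
  pose proof (f_equal (fun G => paste (cells_two fa b) G (tcomp_idl j) eu) G1G2) as H.
  cbv beta in H. change (G1') with (paste (cells_one (gcomp F1 phi)) (cart (lid E) j r) (tcomp_idl _) (tcomp_idl _)) in H. unfold gcomp in H.
  rewrite paste1 with (e7 := tcomp_idl _) (e8 := tcomp_idr _) (e5 := tcomp_idl _) (e6 := eu) in H.
  rewrite paste1 with (e7 := tcomp_idl _) (e8 := tcomp_idr _) (e5 := tcomp_idl _) (e6 := tcomp_idr _) in H.
  unfold F1 in H.
  rewrite hom_fact_subs with (e0' := tcomp_idl _) (en' := tcomp_idr _) (d0' := tcomp_idl _) (dn' := tcomp_idr _) in H.
  assert (Et : cells_two fa b = cells_app (cells_one fa) (cells_one b) eq_refl eq_refl).
  { simpl. unfold cells_two, cells_one. pirr. }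
  assert (HL : paste (cells_two fa b) G1 (tcomp_idl l) (tcomp_idr u) = rcomp a b).
  { rewrite Et. etransitivity; [exact (paste2 (cells_one fa) (cells_one b)
      (cart (lid C) l (tid C)) (idcell (lid C)) (lid_mul C) (tcomp_idr l) (tcomp_idr _) (tcomp_idl l) (tcomp_idr _)
      (tcomp_idl l) (tcomp_idr _) (tcomp_idr _) (tcomp_idr l) (tcomp_idr _))|].
    unfold fa. rewrite hom_factK, paste_idr. reflexivity. }
  assert (HR : paste (cells_two fa b) G2' (tcomp_idl j) eu = rcomp (act phi (tcomp_idr v) ev a) (rmap ev eu b)).
  { rewrite Et. etransitivity; [exact (paste2 (cells_one fa) (cells_one b)
      (tr (tcomp_idl j) (tcomp_idl r) phi) (lid_map r) (lid_mul E) (tcomp_idr j) (tcomp_idr _) (tcomp_idl j) eu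
      (tcomp_idl j) ev eu (tcomp_idr j) (tcomp_idr _))|].
    unfold rcomp, act, rmap. f_equal. f_equal. unfold tr.
    apply paste1. }
  refine (eq_trans _ (eq_trans H HR)). unfold act. f_equal. f_equal. f_equal. f_equal. f_equal.
  exact (eq_sym HL).
Qed.
End Nat.
End V.

(** ** The monad and the algebra induced by a relative adjunction *)

Section Induced.
Context {X : virtual_equipment} {A E C : X} {j : tight A E} {r : tight C E}
  (a : left_adjoint j r).

Definition adj_unit : cnil A =>> hom j (ladj a ;; r) :=
  gcomp (hom_id (ladj a))
    (hom_restr (sharp a) (tcomp_idr (ladj a)) (eq_refl (ladj a ;; r))).

(* E(j,r) = C(l,1) => E(rl,r) *)
Definition adj_act : [: hom j r] =>> hom (ladj a ;; r) r :=
  gcomp (flat a) (hom_map (eq_refl (ladj a ;; r)) (tcomp_idl r)).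

(* E(j,rl) = C(l,l) => E(rl,rl) *)
Definition adj_ext : [: hom j (ladj a ;; r)] =>> hom (ladj a ;; r) (ladj a ;; r) :=
  gcomp (hom_restr (flat a) (eq_refl (ladj a ;; r)) (tcomp_idr (ladj a)))
    (hom_map (eq_refl (ladj a ;; r)) (eq_refl (ladj a ;; r))).

Local Notation t := (ladj a ;; r).

Lemma gcomp_precomp (W F : X) (u u' : tight F E) (eta : cnil F =>> hom u u') (q : loose W F)
    (g : tight W E) (c : [: q] =>> hom u' g) :
  gcomp c (hom_precomp eta g) = hom_comp eta c.
Proof.
  unfold gcomp, hom_precomp, hom_comp.
  pose proof (paste2 (cells_nil (tid F)) (cells_one c) eta (idcell (hom u' g)) (hom_mul u u' g)
    (tcomp_idl _) (tcomp_idl _) (tcomp_idl _) (tcomp_idl _) (tcomp_idl _) (tcomp_idl _) (tcomp_idl _)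
    (tcomp_idl _) (tcomp_idl _)) as H.
  simpl cells_app in H. 
  change (cells_nil (tid F)) with (cells_id (cnil F)) in H.
  rewrite (paste_idl eta) in H. 
  rewrite <- (paste_idr c (tcomp_idl _) (tcomp_idl _)) at 2.
  exact H.
Qed.

(* [adj_ext] and [adj_act] both have the form of K below, with x := ladj a and x := 1. *)
Section Gen.
Context (D : X) (x : tight D C) (x' : tight D E) (e : x ;; r = x').
Context (K : [: hom j x'] =>> hom t x').
Context (HK : forall (P : chains X A D) (y : P =>> hom j x'),
  tr (tcomp_idl t) (tcomp_idl x') (gcomp y K) =
  rmap (eq_refl t) e (act (flat a) e (tcomp_idr x) (tr (tcomp_idl j) (tcomp_idl x') y))).
Context (L : [: hom j t] =>> hom t t).
Context (HL : forall (P : chains X A A) (y : P =>> hom j t),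
  tr (tcomp_idl t) (tcomp_idl t) (gcomp y L) =
  rmap (eq_refl t) (eq_refl t) (act (flat a) (eq_refl t) (tcomp_idr (ladj a)) (tr (tcomp_idl j) (tcomp_idl t) y))).

Lemma tr_adj_unit :
  tr (tcomp_idl j) (tcomp_idl t) adj_unit = act (sharp a) (tcomp_idr _) (eq_refl t) (rid (ladj a)).
Proof.
  unfold adj_unit.
  rewrite tr_gcomp_restr with (e1 := tcomp_idl _) (e2 := tcomp_idl _).
  rewrite tr_hom_id. reflexivity.
Qed.

Lemma gen_unit : gcomp K (hom_precomp adj_unit x') = idcell (hom j x').
Proof.
  rewrite gcomp_precomp.
  apply (tr_inj (e0 := tcomp_idl j) (en := tcomp_idl x')).
  etransitivity; [exact (tr_hom_comp adj_unit K (tcomp_idl _) (tcomp_idl t) (tcomp_idl _))|].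
  rewrite tr_adj_unit. rewrite <- (gcomp_idl K), HK.
  rewrite <- act_nat. rewrite rcomp_rid. apply factK.
Qed.

Lemma gen_assoc : hom_comp L K = gcomp (hom_comp (idcell (hom j t)) K) K.
Proof.
  apply (tr_inj (e0 := tcomp_idl t) (en := tcomp_idl x')).
  rewrite HK.
  rewrite (tr_hom_comp L K (tcomp_idl _) (tcomp_idl t) (tcomp_idl _)).
  rewrite (tr_hom_comp (idcell (hom j t)) K (tcomp_idl _) (tcomp_idl t) (tcomp_idl _)).
  rewrite <- (gcomp_idl K), <- (gcomp_idl L), HK, HL.
  rewrite <- rmap_rcomp. f_equal.
  rewrite <- (factK a (eq_refl t) (tr (tcomp_idl j) (tcomp_idl t) (idcell (hom j t)))) at 2.
  unfold sharp_act. rewrite <- act_nat. symmetry. apply sactK.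
Qed.

Lemma gen_unit_ext : gcomp adj_unit L = hom_id t.
Proof.
  apply (tr_inj (e0 := tcomp_idl t) (en := tcomp_idl t)).
  rewrite HL, tr_adj_unit, tr_hom_id. 
  pose proof (sactK (a:=a) (eq_refl t) (rid (ladj a))) as H. unfold flat_act, sharp_act in H. rewrite H.
  apply rmap_rid.
Qed.
End Gen.

Lemma tr_adj_ext (P : chains X A A) (y : P =>> hom j t) :
  tr (tcomp_idl t) (tcomp_idl t) (gcomp y adj_ext) =
  rmap (eq_refl t) (eq_refl t) (act (flat a) (eq_refl t) (tcomp_idr (ladj a)) (tr (tcomp_idl j) (tcomp_idl t) y)).
Proof.
  unfold adj_ext. rewrite gcompA.
  rewrite tr_hom_map with (ef := tcomp_idl _) (eg := tcomp_idl _).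
  f_equal. apply tr_gcomp_restr.
Qed.

Lemma tr_adj_act (P : chains X A C) (y : P =>> hom j r) :
  tr (tcomp_idl t) (tcomp_idl r) (gcomp y adj_act) =
  rmap (eq_refl t) (tcomp_idl r) (act (flat a) (tcomp_idl r) (tcomp_idr (tid C)) (tr (tcomp_idl j) (tcomp_idl r) y)).
Proof.
  unfold adj_act. rewrite gcompA.
  rewrite tr_hom_map with (ef := tcomp_idl _) (eg := tcomp_idl _).
  f_equal. rewrite tr_gcomp with (e1 := tcomp_idl _) (e2 := tcomp_idl _).
  f_equal. apply proof_irrelevance.
Qed.

Definition induced_monad : rel_monad j := {|
  mon := ladj a ;; r;
  mon_ext := adj_ext;
  mon_unit := adj_unit;
  mon_ext_unit := gen_unit tr_adj_ext;
  mon_unit_ext := gen_unit_ext tr_adj_ext;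
  mon_assoc := gen_assoc tr_adj_ext tr_adj_ext
|}.

Definition induced_algebra : algebra induced_monad C := {|
  alg := r : tight C E;
  alg_act := adj_act : [: hom j r] =>> hom (mon induced_monad) r;
  alg_unit := gen_unit tr_adj_act;
  alg_assoc := gen_assoc tr_adj_act tr_adj_ext
|}.

Definition comparison (O : algebra_object induced_monad) : tight C (Alg O) :=
  alg_lift O induced_algebra.

End Induced.

(** * Strict monadicity *)

Section Monadicity.
Context {X : virtual_equipment}.

Definition is_iso (A B : X) (f : tight A B) : Prop :=
  exists g : tight B A, f ;; g = tid A /\ g ;; f = tid B.

Definition strictly_monadic (A E D : X) (j : tight A E) (r : tight D E) : Prop :=
  exists (a : left_adjoint j r) (O : algebra_object (induced_monad a)),
    is_iso (comparison O).

(** * Colimits *)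

Record cocone (V Y Z : X) (p : loose V Y) (f : tight Y Z) := {
  apex : tight V Z;
  leg : [: p] =>> hom f apex
}.

Definition is_colimit (V Y Z : X) (p : loose V Y) (f : tight Y Z) (c : cocone p f) : Prop :=
  forall (Q : chains X V Z) (psi : p :-: Q =>> hom f (tid Z)),
    exists! phi : Q =>> hom (apex c) (tid Z), hom_comp (leg c) phi = psi.

(* [c |> f], for c : D -> C' and f : D -> Z *)
Definition is_left_extension (D C' Z : X) (c : tight D C') (f : tight D Z)
    (k : cocone (hom c (tid C')) f) : Prop :=
  is_colimit k.

Definition dense (A E : X) (j : tight A E) : Prop :=
  is_left_extension {| apex := tid E; leg := idcell (hom j (tid E)) |}.

Definition left_opcartesian (A0 An : X) (P : chains X A0 An) (q : loose An A0)
    (a : P =>> q) : Prop :=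
  forall (Am : X) (Q : chains X An Am) (B0 Bm : X) (s : loose Bm B0)
    (f : tight A0 B0) (g : tight Am Bm) (psi : cell (P +++ Q) s f g),
    exists! phi : cell (q :-: Q) s f g,
      paste (cells_cons a (cells_id Q) eq_refl) phi (tcomp_idl f) (tcomp_idl g) = psi.

Definition is_absolute (A E V Y : X) (j : tight A E) (p : loose V Y) (f : tight Y E)
    (c : cocone p f) : Prop :=
  left_opcartesian (hom_comp (idcell (hom j f)) (leg c)).

(* The cocone (c;g, lambda;g) *)
Definition cocone_map (V Y Z W : X) (p : loose V Y) (f : tight Y Z) (c : cocone p f)
    (g : tight Z W) : cocone p (f ;; g) := {|
  apex := apex c ;; g;
  leg := gcomp (leg c) (hom_map (eq_refl (f ;; g)) (eq_refl (apex c ;; g)))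
|}.

Definition strictly_created (V Y Z W : X) (p : loose V Y) (f : tight Y Z) (g : tight Z W)
    (c : cocone p (f ;; g)) : Prop :=
  exists c' : cocone p f, unique (fun k => cocone_map k g = c) c' /\ is_colimit c'.

(* The r-extensions are the left extensions of r, written as 1_D followed by r. *)
Definition strictly_creates_absolute_extensions (A E D : X) (j : tight A E)
    (r : tight D E) : Prop :=
  forall (C' : X) (c : tight D C') (k : cocone (hom c (tid C')) (tid D ;; r)),
    is_left_extension k -> is_absolute j k -> strictly_created k.

End Monadicity.

(* Main.v *)
(* Let l be a left j-adjoint of r : D -> E with unit eta, and let (x, lam) be an r-extension along
   c : D -> C, with mu : r => c;x the 2-cell obtained from lam at the identity of c.  Since
   E(j,r) = D(l,1), and D(l,1), C(c,1) always composes to C(l;c,1), the extension is j-absolute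
   exactly when E(j,x) = C(l;c,1), that is, when every 2-cell y into E(j, v;x) is eta;mu;x(q) for
   a unique q into C(l;c, v).  In this form absoluteness involves no chain to the left of E(j,x)
   any more.  Sending eta;mu;x(q) to mu;x(q) makes x a T-algebra and lam a graded morphism, so if D
   is an algebra object, both lift uniquely to D, and the lift is again a colimit.

   Conversely, the free-algebra adjunction says E(j,u_T) = Alg(T)(l;K,1) for the comparison K, so
   u_T is an absolute extension of r along K; by density it is also a colimit.  Strict creation
   turns it into an inverse of K, one triangle coming from the uniqueness of lifts of algebras and
   the other from strict creation of the extension of r along the identity of D. *)

(* All laws are checked on elements. A 2-cell into B(f,g) is traded by [tr] for a cell into B(1,1)
   with sides f and g; composition becomes [rcomp], a tight-cell operates by [rmap], and a 2-cell
   from B(f,g) to C(h,k) by [act], which is determined by its value at the universal element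
   [hcart]. Laws are proved at universal elements and then substituted. Composites of tight-cells
   agree only propositionally, so statements take the composite as a variable together with an
   equation; this avoids transports.

   Density is what relates the two universal properties of an extension x of r: transposition
   concerns 2-cells with left side j, the colimit property those with left side r or x. Composing
   with E(j,r) or E(j,x) turns the latter into the former, and density makes this reversible.

   A lifted cocone is again a colimit because the mediating 2-cell found in E is a graded morphism:
   by absoluteness this may be tested after E(j,r), C(c,1) => E(j,x), where the colimit equation
   replaces it by the image under r of the given 2-cell. *)
From Stdlib Require Import ProofIrrelevance.
Require Import Defs.

Set Implicit Arguments.
Unset Strict Implicit.

(** * Pasting of sequences of 2-cells *)

Section Pasting.
Context {X : virtual_double_category}.

Lemma cells_app_one (A0 A1 An B0 B1 Bn : X) (P1 : chains X A0 A1) (P2 : chains X A1 An)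
    (P : chains X A0 An) (q : loose B1 B0) (Q : chains X B1 Bn)
    (f0 : tight A0 B0) (f1 : tight A1 B1) (fn : tight An Bn)
    (a : cell P1 q f0 f1) (s : pcells P2 Q f1 fn) (eP : P1 +++ P2 = P)
    (eQ : [: q] +++ Q = q :-: Q) :
  cells_app (cells_one a) s eP eQ = cells_cons a s eP.
Proof.
  unfold cells_one.
  rewrite (cells_app_cons a (cells_nil f1) s
    (capp_nil P1) eP eQ eq_refl eq_refl eP).
  reflexivity.
Qed.

(** The constructor [cells_paste_cons] yields its upper sequence as a [cells_app], which does not
    match a sequence written with [cells_cons]. This lemma and the next two restate it in cons form
    for blocks of one, no and two 2-cells. *)
Lemma cells_paste_one (A0 A1 An B0 B1 Bn C0 C1 Cn : X)
    (P1 : chains X A0 A1) (P2 : chains X A1 An) (P : chains X A0 An)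
    (q : loose B1 B0) (Q : chains X B1 Bn) (r : loose C1 C0) (R : chains X C1 Cn)
    (f0 : tight A0 B0) (f1 : tight A1 B1) (fn : tight An Bn)
    (g0 : tight B0 C0) (g1 : tight B1 C1) (gn : tight Bn Cn)
    (h0 : tight A0 C0) (h1 : tight A1 C1) (hn : tight An Cn)
    (a : cell P1 q f0 f1) (b : cell [: q] r g0 g1)
    (s : pcells P2 Q f1 fn) (t : pcells Q R g1 gn) (u : pcells P2 R h1 hn)
    (eP : P1 +++ P2 = P) (eQ : [: q] +++ Q = q :-: Q) (e0 : f0 ;; g0 = h0) (e1 : f1 ;; g1 = h1) :
  cells_paste s t u ->
  cells_paste (cells_cons a s eP) (cells_cons b t eQ)
    (cells_cons (paste (cells_one a) b e0 e1) u eP).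
Proof.
  intros H. rewrite <- (cells_app_one a s eP eQ). now apply cells_paste_cons.
Qed.

Lemma cells_paste_unit (A0 An B0 Bn C0 C1 Cn : X)
    (P : chains X A0 An)
    (Q : chains X B0 Bn) (r : loose C1 C0) (R : chains X C1 Cn)
    (f0 : tight A0 B0) (fn : tight An Bn)
    (g0 : tight B0 C0) (g1 : tight B0 C1) (gn : tight Bn Cn)
    (h0 : tight A0 C0) (h1 : tight A0 C1) (hn : tight An Cn)
    (b : cell (cnil B0) r g0 g1)
    (s : pcells P Q f0 fn) (t : pcells Q R g1 gn) (u : pcells P R h1 hn)
    (eP : cnil A0 +++ P = P) (eQ : cnil B0 +++ Q = Q)
    (e0 : f0 ;; g0 = h0) (e1 : f0 ;; g1 = h1) :
  cells_paste s t u ->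
  cells_paste s (cells_cons b t eQ) (cells_cons (paste (cells_nil f0) b e0 e1) u eP).
Proof.
  intros H. pose proof (cells_paste_cons (cells_nil f0) b eP eQ e0 e1 H) as H'.
  rewrite (proof_irrelevance _ eP eq_refl), (proof_irrelevance _ eQ eq_refl) in *.
  exact H'.
Qed.

Lemma cells_paste_two (A0 A1 A2 An B0 B1 B2 Bn C0 C1 Cn : X)
    (P1 : chains X A0 A1) (P2 : chains X A1 A2) (P3 : chains X A2 An)
    (P23 : chains X A1 An) (P : chains X A0 An)
    (q1 : loose B1 B0) (q2 : loose B2 B1) (Q : chains X B2 Bn)
    (r : loose C1 C0) (R : chains X C1 Cn)
    (f0 : tight A0 B0) (f1 : tight A1 B1) (f2 : tight A2 B2) (fn : tight An Bn)
    (g0 : tight B0 C0) (g1 : tight B2 C1) (gn : tight Bn Cn)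
    (h0 : tight A0 C0) (h1 : tight A2 C1) (hn : tight An Cn)
    (a1 : cell P1 q1 f0 f1) (a2 : cell P2 q2 f1 f2) (b : cell [: q1; q2] r g0 g1)
    (s : pcells P3 Q f2 fn) (t : pcells Q R g1 gn) (u : pcells P3 R h1 hn)
    (e23 : P2 +++ P3 = P23) (eP : P1 +++ P23 = P) (eP' : (P1 +++ P2) +++ P3 = P)
    (eQ : [: q1; q2] +++ Q = q1 :-: q2 :-: Q)
    (e0 : f0 ;; g0 = h0) (e1 : f2 ;; g1 = h1) :
  cells_paste s t u ->
  cells_paste (cells_cons a1 (cells_cons a2 s e23) eP) (cells_cons b t eQ)
    (cells_cons (paste (cells_two a1 a2) b e0 e1) u eP').
Proof.
  intros H. pose proof (cells_paste_cons (cells_two a1 a2) b eP' eQ e0 e1 H) as H'.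
  unfold cells_two in H'.
  rewrite (cells_app_cons a1 (cells_one a2) s
    eq_refl eP' eQ e23 eq_refl eP), cells_app_one in H'. exact H'.
Qed.

Lemma cells_paste_idr (A0 An B0 Bn : X) (P : chains X A0 An) (Q : chains X B0 Bn)
    (f : tight A0 B0) (g : tight An Bn) (s : pcells P Q f g) :
  cells_paste s (cells_id Q) s.
Proof.
  induction s.
  - simpl. apply cells_paste_nil. apply tcomp_idr.
  - simpl. pose proof (cells_paste_one a (idcell q) eP eq_refl (tcomp_idr _) (tcomp_idr _) IHs)
      as H.
    rewrite paste_idr in H. exact H.
Qed.

Lemma cells_paste_idl (A0 An B0 Bn : X) (P : chains X A0 An) (Q : chains X B0 Bn)
    (f : tight A0 B0) (g : tight An Bn) (s : pcells P Q f g) :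
  cells_paste (cells_id P) s s.
Proof.
  assert (happ : forall (C0 C1 C2 : X) (R : chains X C0 C1) (S : chains X C1 C2) e e',
     cells_app (cells_id R) (cells_id S) e e' = cells_id (R +++ S)).
  { clear. induction R; intros S e e'.
    - simpl in *. now rewrite (proof_irrelevance _ e eq_refl), (proof_irrelevance _ e' eq_refl).
    - etransitivity; [exact (cells_app_cons
        (idcell p) (cells_id R) (cells_id S) eq_refl e e' eq_refl eq_refl eq_refl)|].
      rewrite IHR. reflexivity. }
  induction s.
  - simpl. apply cells_paste_nil. apply tcomp_idl.
  - subst P. pose proof (cells_paste_cons (cells_id P1) a eq_refl eq_refl (tcomp_idl _)
      (tcomp_idl _) IHs) as H.
    rewrite paste_idl, happ in H. exact H.
Qed.
End Pasting.

(** * 2-cells into loose-identities *)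

Section Mul.
Context {X : virtual_equipment}.

(* [rcomp] with the top only propositionally equal to the concatenation, so that associativity
   and the right unit law can be stated without transports. *)
Definition mul (Z W V B : X) (P : chains X Z W) (Q : chains X W V) (S : chains X Z V)
    (e : P +++ Q = S) (f : tight Z B) (g : tight W B) (h : tight V B)
    (a : cell P (lid B) f g) (b : cell Q (lid B) g h) : cell S (lid B) f h :=
  paste (cells_cons a (cells_one b) e) (lid_mul B) (tcomp_idr f) (tcomp_idr h).

Lemma cells_paste_single (A0 An B0 Bn C0 Cn : X) (P : chains X A0 An) (Q : chains X B0 Bn)
    (r : loose Cn C0) (f0 : tight A0 B0) (fn : tight An Bn)
    (g0 : tight B0 C0) (gn : tight Bn Cn) (h0 : tight A0 C0) (hn : tight An Cn)
    (s : pcells P Q f0 fn) (b : cell Q r g0 gn) (e0 : f0 ;; g0 = h0) (en : fn ;; gn = hn) :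
  cells_paste s (cells_one b) (cells_one (paste s b e0 en)).
Proof.
  pose proof (cells_paste_cons s b (capp_nil P) (capp_nil Q) e0 en (cells_paste_nil en)) as H.
  rewrite cells_app_nil in H. exact H.
Qed.

(** Multicategorical associativity: substituting into a product acts on each factor separately. The
    [rcomp_sub] lemmas below are its instances for particular shapes of sequences. *)
Lemma mul_sub (A0 A1 An Z W V B : X) (P1 : chains X A0 A1) (P2 : chains X A1 An)
    (S' : chains X A0 An)
    (P : chains X Z W) (Q : chains X W V) (S : chains X Z V)
    (u0 : tight A0 Z) (u1 : tight A1 W) (un : tight An V)
    (s1 : pcells P1 P u0 u1) (s2 : pcells P2 Q u1 un)
    (e' : P1 +++ P2 = S') (e : P +++ Q = S) (f : tight Z B) (g : tight W B) (h : tight V B)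
    (a : cell P (lid B) f g) (b : cell Q (lid B) g h) f' g' h'
    (ef : u0 ;; f = f') (eg : u1 ;; g = g') (eh : un ;; h = h') :
  paste (cells_app s1 s2 e' e) (mul e a b) ef eh = mul e' (paste s1 a ef eg) (paste s2 b eg eh).
Proof.
  unfold mul. apply paste_assoc. apply cells_paste_cons. apply cells_paste_single.
Qed.

Lemma cells_id_one (A0 An : X) (p : loose An A0) : cells_id [: p] = cells_one (idcell p).
Proof. apply cells_one_eq. Qed.

(** A 2-cell out of a chain starting with B(1,1) is determined by what it becomes when the unit is
    inserted there; both sides then become [lid_mul]. *)
Lemma lid_mul_assoc (B : X) :
  paste (cells_two (lid_mul B) (idcell (lid B))) (lid_mul B) (tcomp_idl _) (tcomp_idl _) =
  paste (cells_two (idcell (lid B)) (lid_mul B)) (lid_mul B) (tcomp_idl _) (tcomp_idl _).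
Proof.
  apply (@lid_ext2 X B B B B [: lid B; lid B]).
  transitivity (lid_mul B).
  - transitivity (paste (cells_two (idcell (lid B)) (idcell (lid B))) (lid_mul B)
      (tcomp_idl _) (tcomp_idl _)).
    + apply paste_assoc.
      pose proof (cells_paste_two (lunit B) (idcell (lid B)) (lid_mul B) eq_refl
        eq_refl eq_refl eq_refl
        (tcomp_idl _) (tcomp_idl _) (cells_paste_idr (cells_id [: lid B]))) as H.
      rewrite lid_mul_unit, cells_id_one in H. unfold cells_two. simpl. rewrite cells_one_eq.
          exact H.
    + unfold cells_two. rewrite <- cells_id_one. apply (paste_idl (lid_mul B)).
  - transitivity (rcomp (rid (tid B)) (lid_mul B)); [symmetry; apply rcomp_rid|].
    unfold rcomp. rewrite rid_id, (proof_irrelevance _ (tcomp_idr (tid B)) (tcomp_idl (tid B))).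
    symmetry. apply paste_assoc. simpl cells_id. rewrite cells_one_eq.
    pose proof (cells_paste_one (lunit B) (idcell (lid B)) eq_refl eq_refl (tcomp_idl _)
        (tcomp_idl _)
      (cells_paste_idl (cells_one (lid_mul B)))) as H.
    rewrite paste_idr in H. simpl cells_id in H. rewrite cells_one_eq in H. exact H.
Qed.

Lemma mulA (Z W V Y B : X) (P : chains X Z W) (Q : chains X W V) (R : chains X V Y)
    (PQ : chains X Z V) (QR : chains X W Y) (S : chains X Z Y)
    (e1 : PQ +++ R = S) (e2 : P +++ Q = PQ) (e3 : P +++ QR = S) (e4 : Q +++ R = QR)
    (f : tight Z B) (g : tight W B) (h : tight V B) (k : tight Y B)
    (a : cell P (lid B) f g) (b : cell Q (lid B) g h) (c : cell R (lid B) h k) :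
  mul e1 (mul e2 a b) c = mul e3 a (mul e4 b c).
Proof.
  destruct e2, e4, e1. unfold mul.
  pose (s := cells_cons a (cells_cons b (cells_one c) eq_refl) e3).
  transitivity (paste s
    (paste (cells_two (lid_mul B) (idcell (lid B))) (lid_mul B) (tcomp_idl _) (tcomp_idl _))
    (tcomp_idr f) (tcomp_idr k)).
  - symmetry. apply paste_assoc. unfold s, cells_two.
    pose proof (cells_paste_single (cells_one c) (idcell (lid B)) (tcomp_idr _) (tcomp_idr _)) as H.
    rewrite paste_idr in H.
    exact (cells_paste_two a b (lid_mul B) eq_refl e3 eq_refl eq_refl (tcomp_idr f) (tcomp_idr h)
        H).
  - rewrite lid_mul_assoc. apply paste_assoc. unfold s, cells_two.
    pose proof (cells_paste_single (cells_cons b (cells_one c) eq_refl) (lid_mul B) (tcomp_idr _)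
        (tcomp_idr _)) as H.
    pose proof (cells_paste_one a (idcell (lid B)) e3 eq_refl (tcomp_idr _) (tcomp_idr _) H) as H'.
    rewrite paste_idr in H'. exact H'.
Qed.

Lemma rcompA_nil (Z V Y B : X) (Q : chains X Z V) (R : chains X V Y)
    (f : tight Z B) (g : tight Z B) (h : tight V B) (k : tight Y B)
    (a : cell (cnil Z) (lid B) f g) (b : cell Q (lid B) g h) (c : cell R (lid B) h k) :
  rcomp (rcomp a b) c = rcomp a (rcomp b c).
Proof. exact (mulA (P := cnil Z) (PQ := Q) (QR := Q +++ R) eq_refl eq_refl eq_refl eq_refl a b
    c). Qed.

Lemma rcompA_one (Z W V Y B : X) (p : loose W Z) (Q : chains X W V) (R : chains X V Y)
    (f : tight Z B) (g : tight W B) (h : tight V B) (k : tight Y B)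
    (a : cell [: p] (lid B) f g) (b : cell Q (lid B) g h) (c : cell R (lid B) h k) :
  rcomp (rcomp a b) c = rcomp a (rcomp b c).
Proof. exact (mulA (P := [: p]) (PQ := p :-: Q) (QR := Q +++ R) eq_refl eq_refl eq_refl eq_refl a
    b c). Qed.

(** Whiskering by [v] of a 2-cell f => g between tight-cells. *)
Definition pre (V D B : X) (v : tight V D) (f g : tight D B) f' g'
    (ef : v ;; f = f') (eg : v ;; g = g') (m : cell (cnil D) (lid B) f g) :
    cell (cnil V) (lid B) f' g' :=
  paste (cells_nil v) m ef eg.

Lemma rcomp_sub_nil (A0 Z V B : X) (Y : X) (P : chains X Z V) (Q : chains X A0 Y)
    (u0 : tight A0 Z) (un : tight Y V) (s : pcells Q P u0 un)
    (f g : tight Z B) (h : tight V B) (a : cell (cnil Z) (lid B) f g) (b : cell P (lid B) g h)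
    f' g' h' (ef : u0 ;; f = f') (eg : u0 ;; g = g') (eh : un ;; h = h') :
  paste s (rcomp a b) ef eh = rcomp (pre ef eg a) (paste s b eg eh).
Proof. exact (mul_sub (cells_nil u0) s eq_refl eq_refl a b ef eg eh). Qed.

Lemma pre_tid (D B : X) (f g : tight D B) (m : cell (cnil D) (lid B) f g) e e' :
  pre (v := tid D) e e' m = m.
Proof. apply (paste_idl m). Qed.

Lemma mul_rid (Z W B : X) (P : chains X Z W) (e : P +++ cnil W = P)
    (f : tight Z B) (g : tight W B) (a : cell P (lid B) f g) :
  mul e a (rid g) = a.
Proof.
  transitivity (paste (cells_one a)
    (paste (cells_two (idcell (lid B)) (lunit B)) (lid_mul B) (tcomp_idl _) (tcomp_idl _))
    (tcomp_idr _) (tcomp_idr _)).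
  - unfold mul. symmetry. apply paste_assoc. unfold cells_two.
    pose proof (cells_paste_single (cells_nil g) (lunit B) (tcomp_idr _) (tcomp_idr _)) as H.
    pose proof (cells_paste_one a (idcell (lid B)) e eq_refl (tcomp_idr _) (tcomp_idr _) H) as H'.
    rewrite paste_idr in H'. unfold cells_one at 1.
    rewrite (proof_irrelevance _ (capp_nil P) e).
    exact H'.
  - rewrite lid_mul_unit_r. apply paste_idr.
Qed.

Lemma rmap_tid (Z W B : X) (P : chains X Z W) (f : tight Z B) (g : tight W B)
    (a : cell P (lid B) f g) e e' : rmap (k := tid B) e e' a = a.
Proof.
  assert (E : lid_map (tid B) = idcell (lid B)).
  { apply (@lid_ext2 X B B B B (cnil B)). simpl cells_id.
    rewrite cells_one_eq. etransitivity; [apply lid_map_unit|]. rewrite rid_id, paste_idr.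
        reflexivity. }
  unfold rmap. rewrite E. apply paste_idr.
Qed.

Lemma lid_map_comp (B C D : X) (k : tight B C) (l : tight C D) (m : tight B D) (e : k ;; l = m) :
  paste (cells_one (lid_map k)) (lid_map l) e e = lid_map m.
Proof.
  apply (@lid_ext2 X B B D D (cnil B)). simpl cells_id. rewrite !cells_one_eq.
  etransitivity; [|symmetry; apply lid_map_unit].
  rewrite paste1 with (e7 := tcomp_idl k) (e8 := tcomp_idl k) (e5 := e) (e6 := e).
  etransitivity; [|exact (rmap_rid e e)]. unfold rmap. f_equal. f_equal. apply lid_map_unit.
Qed.

Lemma rmap_rmap (Z W B C D : X) (P : chains X Z W) (f : tight Z B) (g : tight W B)
    (a : cell P (lid B) f g) (k : tight B C) (l : tight C D) (m : tight B D) (e : k ;; l = m)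
    f' g' f'' g'' (ef : f ;; k = f') (eg : g ;; k = g') (ef' : f' ;; l = f'') (eg' : g' ;; l = g'')
    (ef'' : f ;; m = f'') (eg'' : g ;; m = g'') :
  rmap ef' eg' (rmap ef eg a) = rmap ef'' eg'' a.
Proof.
  unfold rmap. rewrite <- paste1 with (e1 := e) (e2 := e) (e3 := ef'') (e4 := eg'').
  rewrite lid_map_comp. reflexivity.
Qed.

Lemma paste_rmap (A0 An Z W B C : X) (R : chains X A0 An) (P : chains X Z W)
    (u0 : tight A0 Z) (un : tight An W) (s : pcells R P u0 un)
    (f : tight Z B) (g : tight W B) (a : cell P (lid B) f g) (k : tight B C) f' g'
    (ef : f ;; k = f') (eg : g ;; k = g') f1 g1 f2 g2
    (e1 : u0 ;; f' = f1) (e2 : un ;; g' = g1) (e3 : u0 ;; f = f2) (e4 : un ;; g = g2)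
    (e5 : f2 ;; k = f1) (e6 : g2 ;; k = g1) :
  paste s (rmap ef eg a) e1 e2 = rmap e5 e6 (paste s a e3 e4).
Proof. apply paste1. Qed.

Lemma rmap_pre (V D B C : X) (v : tight V D) (f g : tight D B) (m : cell (cnil D) (lid B) f g)
    (k : tight B C) f' g' f1 g1 f2 g2 (ef : f ;; k = f') (eg : g ;; k = g')
    (e1 : v ;; f' = f1) (e2 : v ;; g' = g1) (e3 : v ;; f = f2) (e4 : v ;; g = g2)
    (e5 : f2 ;; k = f1) (e6 : g2 ;; k = g1) :
  pre e1 e2 (rmap ef eg m) = rmap e5 e6 (pre e3 e4 m).
Proof. apply paste1. Qed.

Lemma pre_rid (V D B : X) (v : tight V D) (f : tight D B) f' (e e' : v ;; f = f') :
  pre e e' (rid f) = rid f'.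
Proof. unfold pre, rid. apply paste_nil. assumption. Qed.

End Mul.

(** * The operation on elements given by a 2-cell between hom loose-cells *)

Section Act.
Context {X : virtual_equipment}.

(* Has [hom f g] instead of [restr (lid B) f g] in its type, which rewriting depends on. *)
Definition hcart (Z W B : X) (f : tight Z B) (g : tight W B) : cell [: hom f g] (lid B) f g :=
  cart (lid B) f g.

Lemma hom_fact_hcart (Z W B : X) (f : tight Z B) (g : tight W B) e0 en :
  hom_fact (P := [: hom f g]) e0 en (hcart f g) = idcell (hom f g).
Proof. apply hom_fact_cart. Qed.

Lemma paste_hom_fact (Z W B A0 An : X) (f : tight Z B) (g : tight W B) (P : chains X A0 An)
    (h0 : tight A0 Z) (hn : tight An W) (k0 : tight A0 B) (kn : tight An B)
    (e0 e0' : h0 ;; f = k0) (en en' : hn ;; g = kn) (a : cell P (lid B) k0 kn) :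
  paste (cells_one (hom_fact e0 en a)) (hcart f g) e0' en' = a.
Proof. apply hom_factK. Qed.

Lemma tr_idcell (Z W B : X) (f : tight Z B) (g : tight W B) e0 en :
  tr e0 en (idcell (hom f g)) = hcart f g.
Proof. apply paste1_idl. Qed.

Lemma cells_two_app (A0 A1 A2 B0 B1 B2 : X) (P1 : chains X A0 A1) (P2 : chains X A1 A2)
    (q1 : loose B1 B0) (q2 : loose B2 B1) (f0 : tight A0 B0) (f1 : tight A1 B1) (f2 : tight A2 B2)
    (a : cell P1 q1 f0 f1) (b : cell P2 q2 f1 f2) :
  cells_app (cells_one a) (cells_one b) eq_refl eq_refl = cells_two a b.
Proof. apply cells_app_one. Qed.

Lemma rcomp_sub_cons (A0 Z W V B : X) (R : chains X A0 W) (p : loose W Z) (Q : chains X W V)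
    (u : tight A0 Z) (a : cell R p u (tid W)) (f : tight Z B) (g : tight W B) (h : tight V B)
    (b : cell [: p] (lid B) f g) (c : cell Q (lid B) g h) f'
    (e1 e3 : u ;; f = f') (e2 : tid V ;; h = h) (e4 : tid W ;; g = g) :
  paste (cells_cons a (cells_id Q) eq_refl) (rcomp b c) e1 e2 =
  rcomp (paste (cells_one a) b e3 e4) c.
Proof.
  etransitivity; [|refine (f_equal (fun c => rcomp _ c) (paste_idl c e4 e2))].
  rewrite (proof_irrelevance _ e3 e1).
  etransitivity; [|exact (mul_sub (cells_one a) (cells_id Q) eq_refl eq_refl b c e1 e4 e2)].
  exact (f_equal (fun s => paste s (rcomp b c) e1 e2)
    (eq_sym (cells_app_one a (cells_id Q) eq_refl eq_refl))).
Qed.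

Lemma rcomp_sub_one (A0 A1 An Z W V B : X) (R : chains X A0 A1) (p : loose W Z)
    (Q' : chains X A1 An) (Q : chains X W V)
    (u0 : tight A0 Z) (u1 : tight A1 W) (un : tight An V)
    (a : cell R p u0 u1) (s : pcells Q' Q u1 un) (f : tight Z B) (g : tight W B) (h : tight V B)
    (b : cell [: p] (lid B) f g) (c : cell Q (lid B) g h) f' g' h'
    (ef : u0 ;; f = f') (eg : u1 ;; g = g') (eh : un ;; h = h') :
  paste (cells_cons a s eq_refl) (rcomp b c) ef eh =
  rcomp (paste (cells_one a) b ef eg) (paste s c eg eh).
Proof.
  etransitivity; [|exact (mul_sub (cells_one a) s eq_refl eq_refl b c ef eg eh)].
  exact (f_equal (fun s => paste s (rcomp b c) ef eh)
    (eq_sym (cells_app_one a s eq_refl eq_refl))).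
Qed.

Lemma rcomp_sub_two (A0 A1 An Z W V B : X) (P1 : chains X A0 A1) (P2 : chains X A1 An)
    (p : loose W Z) (q : loose V W) (u0 : tight A0 Z) (u1 : tight A1 W) (un : tight An V)
    (s1 : cell P1 p u0 u1) (s2 : cell P2 q u1 un) (f : tight Z B) (g : tight W B) (h : tight V B)
    (a : cell [: p] (lid B) f g) (b : cell [: q] (lid B) g h) f' g' h'
    (ef : u0 ;; f = f') (eg : u1 ;; g = g') (eh : un ;; h = h') :
  paste (cells_two s1 s2) (rcomp a b) ef eh =
  rcomp (paste (cells_one s1) a ef eg) (paste (cells_one s2) b eg eh).
Proof.
  rewrite <- cells_two_app.
  exact (mul_sub (cells_one s1) (cells_one s2) eq_refl eq_refl a b ef eg eh).
Qed.

(** A Yoneda-type description: an element of B(f,gx) is read as a cell into B(f,g) with right side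
    x, and the fixed cell [tr phi] is pasted under it. Compatibility of [act] with substitution
    follows from this form. *)
Lemma actE (Z W V B C : X) (f : tight Z B) (g : tight W B)
    (h : tight Z C) (k : tight W C) (phi : [: hom f g] =>> hom h k) (x : tight V W)
    (g' : tight V B) (k' : tight V C) (eg : x ;; g = g') (ek : x ;; k = k')
    (P : chains X Z V) (a : cell P (lid B) f g')
    (e0 e1 : tid Z ;; h = h) (en : tid W ;; k = k) (e2 : x ;; k = k') :
  act phi eg ek a = paste (cells_one (hom_fact (tcomp_idl f) eg a)) (tr e0 en phi) e1 e2.
Proof.
  unfold act, tr. symmetry.
  rewrite paste1 with (e7 := tcomp_idl _) (e8 := tcomp_idr x) (e5 := tcomp_idl h) (e6 := ek).
  reflexivity.
Qed.

Lemma paste_act (Z W V Y B C : X) (f : tight Z B) (g : tight W B)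
    (h : tight Z C) (k : tight W C) (phi : [: hom f g] =>> hom h k) (x : tight V W)
    (g' : tight V B) (k' : tight V C) (eg : x ;; g = g') (ek : x ;; k = k')
    (P : chains X Z V) (a : cell P (lid B) f g') (Q : chains X Z Y) (y : tight Y V)
    (s : pcells Q P (tid Z) y) (x1 : tight Y W) (ex : y ;; x = x1) g1 k1
    (e1 : tid Z ;; h = h) (e2 : y ;; k' = k1) (e3 : tid Z ;; f = f) (e4 : y ;; g' = g1)
    (eg1 : x1 ;; g = g1) (ek1 : x1 ;; k = k1) :
  paste s (act phi eg ek a) e1 e2 = act phi eg1 ek1 (paste s a e3 e4).
Proof.
  rewrite !actE with (e0 := tcomp_idl h) (en := tcomp_idl k) (e1 := tcomp_idl h) (e2 := ek).
  rewrite actE with (e0 := tcomp_idl h) (en := tcomp_idl k) (e1 := tcomp_idl h) (e2 := ek1).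
  rewrite paste1 with (e7 := tcomp_idl (tid Z)) (e8 := ex) (e5 := tcomp_idl h) (e6 := ek1).
  rewrite hom_fact_subs with (e0' := tcomp_idl f) (en' := eg1) (d0' := e3) (dn' := e4).
  reflexivity.
Qed.

(** Only the universal case, with [hcart] for [a] and the identity of W(1,1) for [d], needs an
    argument ([H]): inserting the unit of W(1,1) turns both sides into [tr phi]. The general case is
    a substitution into it. *)
Lemma act_natural (Z W V Y B C : X) (f : tight Z B) (g : tight W B)
    (h : tight Z C) (k : tight W C) (phi : [: hom f g] =>> hom h k) (v : tight V W) (u : tight Y W)
    g0 g1 k0 k1 (eg0 : v ;; g = g0) (eg1 : u ;; g = g1) (ek0 : v ;; k = k0) (ek1 : u ;; k = k1)
    (P : chains X Z V) (Q : chains X V Y) (a : cell P (lid B) f g0) (d : cell Q (lid W) v u) :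
  act phi eg1 ek1 (rcomp a (rmap eg0 eg1 d)) = rcomp (act phi eg0 ek0 a) (rmap ek0 ek1 d).
Proof.
  assert (H : act phi (tcomp_idl g) (tcomp_idl k) (rcomp (hcart f g) (lid_map g)) =
    rcomp (tr (tcomp_idl h) (tcomp_idl k) phi) (lid_map k)).
  { apply lid_ext_r. simpl capp.
    rewrite paste_act with (e3 := tcomp_idl f) (e4 := tcomp_idl g)
      (eg1 := tcomp_idl g) (ek1 := tcomp_idl k) by apply tcomp_idl.
    transitivity (act phi (tcomp_idl g) (tcomp_idl k) (hcart f g)).
    - f_equal. rewrite cells_two_app.
      etransitivity; [exact (rcomp_sub_two (idcell (hom f g)) (lunit W) (hcart f g) (lid_map g)
        (tcomp_idl f) (tcomp_idl g) (tcomp_idl g))|].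
      rewrite paste1_idl. etransitivity; [|apply rcomp_rid_r]. f_equal. apply lid_map_unit.
    - rewrite actE with (e0 := tcomp_idl h) (en := tcomp_idl k) (e1 := tcomp_idl h) (e2 :=
        tcomp_idl k).
      rewrite hom_fact_hcart, paste1_idl. symmetry.
      rewrite cells_two_app.
      etransitivity; [exact (rcomp_sub_two (idcell (hom f g)) (lunit W)
        (tr (tcomp_idl h) (tcomp_idl k) phi) (lid_map k)
        (tcomp_idl h) (tcomp_idl k) (tcomp_idl k))|].
      rewrite paste1_idl. etransitivity; [|apply rcomp_rid_r]. f_equal. apply lid_map_unit. }
  transitivity (paste (cells_two (hom_fact (tcomp_idl f) eg0 a) d)
    (act phi (tcomp_idl g) (tcomp_idl k) (rcomp (hcart f g) (lid_map g))) (tcomp_idl h) ek1).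
  - symmetry. etransitivity; [apply paste_act with (e3 := tcomp_idl f) (e4 := eg1) (eg1 := eg1)
      (ek1 := ek1); apply tcomp_idr|].
    f_equal.
    etransitivity; [exact (rcomp_sub_two (hom_fact (tcomp_idl f) eg0 a) d (hcart f g) (lid_map g)
      (tcomp_idl f) eg0 eg1)|].
    rewrite paste_hom_fact. reflexivity.
  - rewrite H.
    etransitivity; [exact (rcomp_sub_two (hom_fact (tcomp_idl f) eg0 a) d
      (tr (tcomp_idl h) (tcomp_idl k) phi) (lid_map k)
      (tcomp_idl h) ek0 ek1)|].
    unfold rmap. f_equal. symmetry. apply actE.
Qed.

(** The interchange law for [m] and [d]. Its universal instance [H] is a 2-cell out of D(1,1), and
    both sides become [m] once the unit is inserted. *)
Lemma mul_pre (D B U V : X) (f g : tight D B) (m : cell (cnil D) (lid B) f g)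
    (P : chains X U V) (u : tight U D) (v : tight V D) (d : cell P (lid D) u v)
    (e : P +++ cnil V = P) fu fv gu gv
    (efu : u ;; f = fu) (efv : v ;; f = fv) (egu : u ;; g = gu) (egv : v ;; g = gv) :
  mul e (rmap efu efv d) (pre efv egv m) = rcomp (pre efu egu m) (rmap egu egv d).
Proof.
  assert (H : rcomp (lid_map f) m = rcomp m (lid_map g)).
  { apply (@lid_ext2 X D D B B (cnil D)). simpl cells_id.
    rewrite rcomp_sub_nil with (eg := tcomp_idl g). rewrite pre_tid.
    change (cells_nil (tid D)) with (cells_id (cnil D)).
    rewrite rcomp_sub_cons with (e3 := tcomp_idl f) (e4 := tcomp_idl f).
    transitivity m.
    - etransitivity; [|apply rcomp_rid]. f_equal. apply lid_map_unit.
    - symmetry. simpl cells_id. rewrite cells_one_eq.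
      etransitivity; [|exact (mul_rid eq_refl m)].
      change (rcomp m (paste (cells_one (lunit D)) (lid_map g) (tcomp_idl g) (tcomp_idl g)) =
          rcomp m (rid g)).
      f_equal. apply lid_map_unit. }
  apply (f_equal (fun G => paste (cells_one d) G efu egv)) in H.
  rewrite rcomp_sub_nil with (eg := egu) in H. refine (eq_trans _ H). clear H. symmetry.
  etransitivity; [|exact (mul_sub (cells_one d) (cells_nil v) e eq_refl (lid_map f) m efu efv egv)].
  exact (f_equal (fun s : pcells P [: lid D] u v => paste s (rcomp (lid_map f) m) efu egv)
    (eq_sym (eq_trans (cells_app_one d (cells_nil v) e eq_refl) (cells_one_eq d e)))).
Qed.

Lemma pre_nat (D B U V Y : X) (f g : tight D B) (m : cell (cnil D) (lid B) f g)
    (P : chains X U V) (u : tight U D) (v : tight V D) (d : cell P (lid D) u v)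
    fu fv gu gv
    (efu : u ;; f = fu) (efv : v ;; f = fv) (egu : u ;; g = gu) (egv : v ;; g = gv)
    (Q : chains X V Y) (h : tight Y B) (z : cell Q (lid B) gv h) :
  rcomp (rmap efu efv d) (rcomp (pre efv egv m) z) =
  rcomp (pre efu egu m) (rcomp (rmap egu egv d) z).
Proof.
  pose proof (mulA (P := P) (Q := cnil V) (PQ := P) (QR := Q) (R := Q) (S := P +++ Q)
    eq_refl (capp_nil P) eq_refl eq_refl (rmap efu efv d) (pre efv egv m) z) as H.
  rewrite mul_pre with (egu := egu) in H. refine (eq_trans (eq_sym H) _).
  exact (rcompA_nil _ _ _).
Qed.
End Act.

(** * Algebras and algebra objects *)

Section Algebras.
Context {X : virtual_equipment}.

Lemma tr_hom_fact (Z W B A0 An : X) (f : tight Z B) (g : tight W B) (P : chains X A0 An)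
    (h0 : tight A0 Z) (hn : tight An W) (k0 : tight A0 B) (kn : tight An B)
    (e0 e0' : h0 ;; f = k0) (en en' : hn ;; g = kn) (a : cell P (lid B) k0 kn) :
  tr e0' en' (hom_fact e0 en a) = a.
Proof. apply hom_factK. Qed.

Lemma act_hcart (Z W B C : X) (f : tight Z B) (g : tight W B)
    (h : tight Z C) (k : tight W C) (phi : [: hom f g] =>> hom h k)
    (eg : tid W ;; g = g) (ek : tid W ;; k = k) (e0 : tid Z ;; h = h) (en : tid W ;; k = k) :
  act phi eg ek (hcart f g) = tr e0 en phi.
Proof.
  rewrite actE with (e0 := e0) (en := en) (e1 := e0) (e2 := ek).
  rewrite hom_fact_hcart. apply paste1_idl.
Qed.

Lemma tr_hom_restr (Z W V B C : X) (f : tight Z B) (g : tight W B)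
    (h : tight Z C) (k : tight W C) (phi : [: hom f g] =>> hom h k) (x : tight V W)
    (g' : tight V B) (k' : tight V C) (eg : x ;; g = g') (ek : x ;; k = k')
    (e0 : tid Z ;; h = h) (en : tid V ;; k' = k') :
  tr e0 en (hom_restr phi eg ek) = act phi eg ek (hcart f g').
Proof.
  rewrite <- (gcomp_idl (hom_restr phi eg ek)).
  rewrite tr_gcomp_restr with (e1 := tcomp_idl f) (e2 := tcomp_idl g').
  rewrite tr_idcell. reflexivity.
Qed.

Lemma act_hom_restr (Z W V Y B C : X) (f : tight Z B) (g : tight W B)
    (h : tight Z C) (k : tight W C) (phi : [: hom f g] =>> hom h k) (x : tight V W)
    (g' : tight V B) (k' : tight V C) (eg : x ;; g = g') (ek : x ;; k = k')
    (y : tight Y V) (yx : tight Y W) (eyx : y ;; x = yx) g1 k1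
    (eg1 : y ;; g' = g1) (ek1 : y ;; k' = k1) (eg2 : yx ;; g = g1) (ek2 : yx ;; k = k1)
    (P : chains X Z Y) (a : cell P (lid B) f g1) :
  act (hom_restr phi eg ek) eg1 ek1 a = act phi eg2 ek2 a.
Proof.
  rewrite actE with (e0 := tcomp_idl h) (en := tcomp_idl k') (e1 := tcomp_idl h) (e2 := ek1).
  rewrite tr_hom_restr.
  rewrite paste_act with (x1 := yx) (e3 := tcomp_idl f) (e4 := eg1) (eg1 := eg2) (ek1 := ek2) by
      assumption.
  rewrite paste_hom_fact. reflexivity.
Qed.

Section Monad.
Context {A E : X} {j : tight A E} {T : rel_monad j}.
Local Notation t := (mon T).

Definition munit : cell (cnil A) (lid E) j t := tr (tcomp_idl j) (tcomp_idl t) (mon_unit T).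

Section Laws.
Context (D : X) (x : tight D E) (al : [: hom j x] =>> hom t x).

Lemma tr_unit_law :
  gcomp al (hom_precomp (mon_unit T) x) = idcell (hom j x) <->
  rcomp munit (tr (tcomp_idl t) (tcomp_idl x) al) = hcart j x.
Proof.
  rewrite gcomp_precomp.
  pose proof (tr_hom_comp (mon_unit T) al (tcomp_idl j) (tcomp_idl t) (tcomp_idl x)) as H.
  split; intros H'.
  - refine (eq_trans (eq_sym H) _). change (cnil A +++ [: hom j x]) with [: hom j x].
    rewrite H'. apply tr_idcell.
  - apply (tr_inj (e0 := tcomp_idl j) (en := tcomp_idl x)). rewrite tr_idcell, <- H'. exact H.
Qed.

Lemma tr_assoc_law :
  hom_comp (mon_ext T) al = gcomp (hom_comp (idcell (hom j t)) al) al <->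
  rcomp (tr (tcomp_idl t) (tcomp_idl t) (mon_ext T)) (tr (tcomp_idl t) (tcomp_idl x) al) =
  act al (tcomp_idl x) (tcomp_idl x) (rcomp (hcart j t) (tr (tcomp_idl t) (tcomp_idl x) al)).
Proof.
  pose proof (tr_hom_comp (mon_ext T) al (tcomp_idl t) (tcomp_idl t) (tcomp_idl x)) as H1.
  pose proof (tr_gcomp al (hom_comp (idcell (hom j t)) al)
     (tcomp_idl t) (tcomp_idl x) (tcomp_idl j) (tcomp_idl x)) as H2.
  rewrite (tr_hom_comp _ _ _ (tcomp_idl t)), tr_idcell in H2.
  split; intros H.
  - rewrite <- H1, <- H2, H. reflexivity.
  - apply (tr_inj (e0 := tcomp_idl t) (en := tcomp_idl x)). rewrite H1, H2. exact H.
Qed.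

Lemma graded_tr (D' : X) (x' : tight D' E) (al' : [: hom j x'] =>> hom t x') (P : chains X D D')
    (eps : P =>> hom x x') :
  hom_comp al eps = gcomp (hom_comp (idcell (hom j x)) eps) al' <->
  rcomp (tr (tcomp_idl t) (tcomp_idl x) al) (tr (tcomp_idl x) (tcomp_idl x') eps) =
  act al' (tcomp_idl x') (tcomp_idl x')
    (rcomp (hcart j x) (tr (tcomp_idl x) (tcomp_idl x') eps)).
Proof.
  pose proof (tr_hom_comp al eps (tcomp_idl t) (tcomp_idl x) (tcomp_idl x')) as H1.
  pose proof (tr_gcomp al' (hom_comp (idcell (hom j x)) eps)
     (tcomp_idl t) (tcomp_idl x') (tcomp_idl j) (tcomp_idl x')) as H2.
  rewrite (tr_hom_comp _ _ _ (tcomp_idl x)), tr_idcell in H2.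
  split; intros H.
  - rewrite <- H1, <- H2, H. reflexivity.
  - apply (tr_inj (e0 := tcomp_idl t) (en := tcomp_idl x')). rewrite H1, H2. exact H.
Qed.
End Laws.

Section El.
Context {D : X} (al : algebra T D) {V : X} {v : tight V D} {x' : tight V E} (e : v ;; alg al = x').

(** The law of the algebra is the case of the universal element; substituting [y] for it gives the
    law at an arbitrary element. The associativity law below is treated in the same way with two
    elements. *)
Lemma alg_unit_el (P : chains X A V) (y : cell P (lid E) j x') :
  rcomp munit (act (alg_act al) e e y) = y.
Proof.
  pose proof (proj1 (tr_unit_law _) (alg_unit al)) as H.
  apply (f_equal (fun G => paste (cells_one (hom_fact (tcomp_idl j) e y)) G (tcomp_idl j) e)) in H.
  rewrite paste_hom_fact in H. refine (eq_trans _ H). symmetry.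
  etransitivity; [exact (rcomp_sub_nil (cells_one (hom_fact (tcomp_idl j) e y)) munit
    (tr (tcomp_idl t) (tcomp_idl (alg al)) (alg_act al)) (tcomp_idl j) (tcomp_idl t) e)|].
  rewrite pre_tid. f_equal. symmetry. apply actE.
Qed.

Lemma alg_assoc_el (P : chains X A A) (Q : chains X A V) (b : cell P (lid E) j t)
    (y : cell Q (lid E) j x') :
  rcomp (act (mon_ext T) (tcomp_idl t) (tcomp_idl t) b) (act (alg_act al) e e y) =
  act (alg_act al) e e (rcomp b (act (alg_act al) e e y)).
Proof.
  pose proof (proj1 (tr_assoc_law _) (alg_assoc al)) as H.
  set (s := cells_two (hom_fact (tcomp_idl j) (tcomp_idl t) b) (hom_fact (tcomp_idl j) e y)).
  apply (f_equal (fun G => paste s G (tcomp_idl t) e)) in H.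
  refine (eq_trans _ (eq_trans H _)).
  - symmetry. etransitivity; [exact (rcomp_sub_two _ _ _ _ (tcomp_idl t) (tcomp_idl t) e)|].
    f_equal; symmetry; apply actE.
  - etransitivity; [apply paste_act with (e3 := tcomp_idl j) (e4 := e) (eg1 := e) (ek1 := e);
      apply tcomp_idr|].
    f_equal.
    etransitivity; [exact (rcomp_sub_two _ _ _ _ (tcomp_idl j) (tcomp_idl t) e)|].
    rewrite paste_hom_fact. f_equal. symmetry. apply actE.
Qed.
End El.

Definition restr_algebra (D V : X) (al : algebra T D) (x : tight V D) (x' : tight V E)
    (e : x ;; alg al = x') : algebra T V.
Proof.
  refine (@Build_algebra X A E j T V x' (hom_restr (alg_act al) e e) _ _).
  - apply tr_unit_law. rewrite tr_hom_restr. exact (alg_unit_el e (hcart j x')).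
  - apply tr_assoc_law. rewrite tr_hom_restr.
    rewrite act_hom_restr with (eg2 := e) (ek2 := e) by apply tcomp_idl.
    refine (eq_trans _ (alg_assoc_el e (hcart j t) (hcart j x'))).
    f_equal. symmetry. apply act_hcart.
Defined.

(* [algebra_object] without the chosen lifts, so that it transfers along isomorphisms. *)
Record algebra_universal (B : X) (u : tight B E) (U : [: hom j u] =>> hom t u) : Prop := {
  au_lift : forall (D : X) (al : algebra T D),
    exists (w : tight D B) (e : w ;; u = alg al), hom_restr U e e = alg_act al;
  au_lift_uniq : forall (D : X) (al : algebra T D) (w w' : tight D B)
    (e : w ;; u = alg al) (e' : w' ;; u = alg al),
    hom_restr U e e = alg_act al -> hom_restr U e' e' = alg_act al -> w = w';
  au_hom : forall (V V' : X) (x : tight V B) (x' : tight V' B) (y : tight V E) (y' : tight V' E)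
    (e : x ;; u = y) (e' : x' ;; u = y') (P : chains X V V') (eps : cell P (lid E) y y'),
    rcomp (act U e e (hcart j y)) eps = act U e' e' (rcomp (hcart j y) eps) ->
    exists! phi : cell P (lid B) x x', rmap e e' phi = eps
}.

Lemma algebra_object_universal (O : algebra_object T) :
  algebra_universal (alg_act (ualg O)).
Proof.
  constructor.
  - intros D al. exists (alg_lift O al), (alg_liftE O al). apply alg_lift_act.
  - intros D al w w' e e' H H'. transitivity (alg_lift O al).
    + exact (alg_lift_uniq H).
    + symmetry. exact (alg_lift_uniq H').
  - intros V V' x x' y y' e e' P eps H.
    (* The tight-cells [x] and [x'] are lifts of the restricted algebras, hence equal to the chosen
       lifts, between which [alg_lift2] provides a 2-cell. *)
    pose proof (@alg_lift_uniq _ _ _ _ _ O V (restr_algebra e) x e eq_refl) as E1.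
    pose proof (@alg_lift_uniq _ _ _ _ _ O V' (restr_algebra e') x' e' eq_refl) as E2.
    pose proof (@alg_lift2 _ _ _ _ _ O V V' (restr_algebra e) (restr_algebra e') P
      (hom_fact (tcomp_idl y) (tcomp_idl y') eps)) as H2.
    unfold is_graded_morphism in H2. rewrite graded_tr in H2.
    rewrite tr_hom_fact in H2.
    specialize (H2 ltac:(simpl; rewrite tr_hom_restr;
      rewrite act_hom_restr with (eg2 := e') (ek2 := e') by apply tcomp_idl; exact H)).
    (* Generalizing the chosen lifts together with their equations lets [x] and [x'] be substituted
       for them inside dependent types. *)
    revert E1 E2 H2.
    generalize (alg_liftE O (restr_algebra e)) (alg_liftE O (restr_algebra e')).
    generalize (alg_lift O (restr_algebra e)) (alg_lift O (restr_algebra e')).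
    simpl. intros z z' ez ez' <- <- [phi [H1 H2]].
    exists (tr (tcomp_idl x) (tcomp_idl x') phi). split.
    + apply (f_equal (tr (tcomp_idl y) (tcomp_idl y'))) in H1.
      rewrite tr_hom_fact in H1.
      rewrite tr_hom_map with (ef := tcomp_idl x) (eg := tcomp_idl x') in H1.
      rewrite <- H1. pirr.
    + intros psi Hpsi.
      rewrite (H2 (hom_fact (tcomp_idl x) (tcomp_idl x') psi)).
      * apply tr_hom_fact.
      * apply (tr_inj (e0 := tcomp_idl y) (en := tcomp_idl y')).
        rewrite tr_hom_map with (ef := tcomp_idl x) (eg := tcomp_idl x').
        rewrite !tr_hom_fact, <- Hpsi. pirr.
Qed.

Lemma algebra_universal_iso (B D : X) (u : tight B E) (U : [: hom j u] =>> hom t u)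
    (k : tight D B) (r : tight D E) (ek : k ;; u = r) :
  algebra_universal U -> is_iso k -> algebra_universal (hom_restr U ek ek).
Proof.
  intros HU [k' [kk' k'k]].
  assert (ek' : k' ;; r = u).
  { rewrite <- ek, <- tcomp_assoc, k'k. apply tcomp_idl. }
  assert (HR : forall V (w : tight V D) (w1 : tight V B) x (e : w ;; r = x) (e1 : w1 ;; u = x),
    w ;; k = w1 -> hom_restr (hom_restr U ek ek) e e = hom_restr U e1 e1).
  { intros V w w1 x e e1 Hw. apply (tr_inj (e0 := tcomp_idl t) (en := tcomp_idl x)).
    rewrite !tr_hom_restr. apply act_hom_restr. exact Hw. }
  constructor.
  - intros V al. destruct (au_lift HU al) as [w [e H]].
    assert (e1 : (w ;; k') ;; r = alg al) by now rewrite tcomp_assoc, ek'.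
    exists (w ;; k'), e1. rewrite <- H. apply HR. now rewrite tcomp_assoc, k'k, tcomp_idr.
  - intros V al w w' e e' H H'.
    assert (e1 : (w ;; k) ;; u = alg al) by now rewrite tcomp_assoc, ek.
    assert (e1' : (w' ;; k) ;; u = alg al) by now rewrite tcomp_assoc, ek.
    rewrite (HR _ _ _ _ _ e1 eq_refl) in H. rewrite (HR _ _ _ _ _ e1' eq_refl) in H'.
    pose proof (au_lift_uniq HU H H') as E0.
    rewrite <- (tcomp_idr w), <- (tcomp_idr w'), <- kk', <- !tcomp_assoc, E0. reflexivity.
  - intros V V' x x' y y' e e' P eps H.
    assert (e1 : (x ;; k) ;; u = y) by now rewrite tcomp_assoc, ek.
    assert (e1' : (x' ;; k) ;; u = y') by now rewrite tcomp_assoc, ek.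
    rewrite act_hom_restr with (eg2 := e1) (ek2 := e1) in H by reflexivity.
    rewrite act_hom_restr with (eg2 := e1') (ek2 := e1') in H by reflexivity.
    assert (ex : (x ;; k) ;; k' = x) by now rewrite tcomp_assoc, kk', tcomp_idr.
    assert (ex' : (x' ;; k) ;; k' = x') by now rewrite tcomp_assoc, kk', tcomp_idr.
    destruct (au_hom HU H) as [phi [H1 H2]].
    exists (rmap ex ex' phi). split.
    + rewrite <- H1. apply rmap_rmap. exact ek'.
    + intros psi Hpsi. rewrite (H2 (rmap eq_refl eq_refl psi)).
      * rewrite rmap_rmap with (m := tid D) (ef'' := tcomp_idr x) (eg'' := tcomp_idr x') by exact
          kk'.
        apply rmap_tid.
      * rewrite <- Hpsi. apply rmap_rmap. exact ek.
Qed.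
End Monad.
End Algebras.

(** * Relative adjunctions in terms of their units *)

Section Adj.
Context {X : virtual_equipment} {A E C : X} {j : tight A E} {r : tight C E}
  (a : left_adjoint j r).
Local Notation l := (ladj a).
Local Notation t := (ladj a ;; r).

Definition eta : cell (cnil A) (lid E) j t := tr (tcomp_idl j) (tcomp_idl t) (adj_unit a).

Section El.
Context {V : X} {v : tight V C} {x' : tight V E} (e : v ;; r = x').

(** Naturality of transposition, applied to the identity of [l]: transposing is applying r and
    precomposing with the unit. *)
Lemma sharp_act_eta (P : chains X A V) (d : cell P (lid C) l v) :
  sharp_act e d = rcomp eta (rmap eq_refl e d).
Proof.
  unfold eta. rewrite tr_adj_unit.
  rewrite <- (act_nat (sharp a) (eq_refl t) e (rid l) d). rewrite rcomp_rid. reflexivity.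
Qed.

Lemma eta_flat (P : chains X A V) (y : cell P (lid E) j x') :
  rcomp eta (rmap eq_refl e (flat_act a e y)) = y.
Proof. rewrite <- sharp_act_eta. apply factK. Qed.

Lemma flat_eta (P : chains X A V) (d : cell P (lid C) l v) :
  flat_act a e (rcomp eta (rmap eq_refl e d)) = d.
Proof. rewrite <- sharp_act_eta. apply sactK. Qed.

(** Every element of E(j,x') has the form eta;r(d), and in this form the action just drops the unit,
    because it is transposition back to D(l,v) followed by r. *)
Lemma adj_act_eta (P : chains X A V) (d : cell P (lid C) l v) :
  act (adj_act a) e e (rcomp eta (rmap eq_refl e d)) = rmap eq_refl e d.
Proof.
  rewrite <- (flat_eta d) at 2. generalize (rcomp eta (rmap eq_refl e d)). intros y.
  rewrite actE with (e0 := tcomp_idl t) (en := tcomp_idl r) (e1 := tcomp_idl t) (e2 := e).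
  rewrite <- (gcomp_idl (adj_act a)), tr_adj_act, tr_idcell.
  rewrite paste_rmap with (e3 := tcomp_idl l) (e4 := tcomp_idr v) (e5 := eq_refl) (e6 := e).
  f_equal.
  rewrite paste_act with (x1 := v) (e3 := tcomp_idl j) (e4 := e) (eg1 := e) (ek1 := tcomp_idr v)
      by apply tcomp_idr.
  rewrite paste_hom_fact. reflexivity.
Qed.
End El.

Lemma adj_ext_eta (P : chains X A A) (d : cell P (lid C) l l) :
  act (adj_ext a) (tcomp_idl t) (tcomp_idl t) (rcomp eta (rmap eq_refl eq_refl d)) =
  rmap eq_refl eq_refl d.
Proof.
  pose proof (tr_adj_ext (a := a) (hom_fact (tcomp_idl j) (tcomp_idl t) (rcomp eta (rmap eq_refl
      eq_refl d)))) as H.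
  rewrite tr_hom_fact in H.
  rewrite tr_gcomp with (e1 := tcomp_idl j) (e2 := tcomp_idl t) in H.
  rewrite tr_hom_fact in H. refine (eq_trans H _). f_equal.
  exact (flat_eta eq_refl d).
Qed.
End Adj.

(** * Colimits and density *)

Section Dense.
Context {X : virtual_equipment}.

(* [is_colimit] only speaks of 2-cells with identity right side: a right side g is traded for
   one more loose-cell Z(g,1) at the right end of the chain. *)
Lemma colimit_right (V Y Z W : X) (p : loose V Y) (f : tight Y Z) (c : cocone p f) :
  is_colimit c -> forall (Q : chains X V W) (g : tight W Z) (psi : cell (p :-: Q) (lid Z) f g),
  exists! phi : cell Q (lid Z) (apex c) g,
    rcomp (tr (tcomp_idl f) (tcomp_idl (apex c)) (leg c)) phi = psi.
Proof.
  intros Hc Q g psi.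
  set (lam := tr (tcomp_idl f) (tcomp_idl (apex c)) (leg c)).
  (* [rg] is the identity of [g] as a cell into Z(g,1) with right side g. By [K], pasting it at the
     right end undoes composition with [hcart g (tid Z)]. *)
  set (rg := hom_fact (tcomp_idl g) (tcomp_idr g) (rid g)).
  assert (K : forall (A0 : X) (S : chains X A0 W) (k : tight A0 Z) (x : cell S (lid Z) k g) (e :
      S +++ cnil W = S),
    paste (cells_app (cells_id S) (cells_one rg) e eq_refl)
      (rcomp x (hcart g (tid Z))) (tcomp_idl k) (tcomp_idr g) = x).
  { intros A0 S k x e.
    etransitivity; [exact (mul_sub (cells_id S) (cells_one rg) e eq_refl x (hcart g (tid Z))
      (tcomp_idl k) (tcomp_idl g) (tcomp_idr g))|].
    unfold rg. rewrite paste_idl, paste_hom_fact. apply mul_rid. }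
  destruct (Hc (Q +++ [: hom g (tid Z)])
    (hom_fact (tcomp_idl f) (tcomp_idl (tid Z)) (rcomp psi (hcart g (tid Z))))) as [phi [H1 H2]].
  apply (f_equal (tr (tcomp_idl f) (tcomp_idl (tid Z)))) in H1.
  rewrite tr_hom_fact in H1.
  rewrite (tr_hom_comp (leg c) phi (tcomp_idl f) (tcomp_idl (apex c)) (tcomp_idl (tid Z))) in H1.
  exists (paste (cells_app (cells_id Q) (cells_one rg) (capp_nil Q) eq_refl)
     (tr (tcomp_idl (apex c)) (tcomp_idl (tid Z)) phi) (tcomp_idl (apex c)) (tcomp_idr g)).
  split.
  - rewrite <- (K _ (p :-: Q) f psi (capp_nil (p :-: Q))).
    transitivity (paste (cells_app (cells_id (p :-: Q)) (cells_one rg) (capp_nil (p :-: Q)) eq_refl)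
      (rcomp lam (tr (tcomp_idl (apex c)) (tcomp_idl (tid Z)) phi)) (tcomp_idl f) (tcomp_idr g));
      [|f_equal; exact H1].
    simpl cells_id.
    transitivity (paste (cells_cons (idcell p) (cells_app (cells_id Q) (cells_one rg) (capp_nil
        Q) eq_refl) eq_refl)
      (rcomp lam (tr (tcomp_idl (apex c)) (tcomp_idl (tid Z)) phi)) (tcomp_idl f) (tcomp_idr g)).
    + symmetry.
      etransitivity; [exact (rcomp_sub_one _ _ _ _ (tcomp_idl f) (tcomp_idl (apex c)) (tcomp_idr
          g))|].
      rewrite paste1_idl. reflexivity.
    + symmetry.
      exact (f_equal (fun s => paste s (rcomp lam (tr (tcomp_idl (apex c)) (tcomp_idl (tid Z)) phi))
        (tcomp_idl f) (tcomp_idr g))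
        (cells_app_cons (idcell p) (cells_id Q) (cells_one rg) eq_refl (capp_nil (p :-: Q)) eq_refl
          (capp_nil Q) eq_refl eq_refl)).
  - intros phi' H'.
    rewrite (H2 (hom_fact (tcomp_idl (apex c)) (tcomp_idl (tid Z)) (rcomp phi' (hcart g (tid Z))))).
    + rewrite tr_hom_fact. apply K.
    + apply (tr_inj (e0 := tcomp_idl f) (en := tcomp_idl (tid Z))). rewrite tr_hom_fact.
      rewrite (tr_hom_comp (leg c) _ (tcomp_idl f) (tcomp_idl (apex c)) (tcomp_idl (tid Z))).
      rewrite tr_hom_fact. rewrite <- H'. symmetry. exact (rcompA_one lam phi' (hcart g (tid Z))).
Qed.

(* A left side x is traded for the loose-cell E(1,x) at the left end of the chain, and
   E(j,1), E(1,x) composes to E(j,x). *)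
Lemma dense_left (A E : X) (j : tight A E) :
  dense j -> forall (V W : X) (x : tight V E) (Q : chains X V W) (g : tight W E)
    (psi : cell (hom j x :-: Q) (lid E) j g),
  exists! phi : cell Q (lid E) x g, rcomp (hcart j x) phi = psi.
Proof.
  intros Hj V W x Q g psi.
  (* [M] composes E(j,1) with E(1,x). The cell [ax] reads the universal element of E(j,x) as a cell
     into E(j,1), and [lx] is the identity of x as a cell into E(1,x); together they are a section
     of [M] ([E0]). *)
  set (M := hom_fact (tcomp_idl j) (tcomp_idl x) (rcomp (hcart j (tid E)) (hcart (tid E) x))
     : [: hom j (tid E); hom (tid E) x] =>> hom j x).
  set (lx := hom_fact (tcomp_idr x) (tcomp_idl x) (rid x)).
  set (ax := hom_fact (tcomp_idl j) (tcomp_idr x) (hcart j x)).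
  destruct (colimit_right Hj (Q := hom (tid E) x :-: Q)
    (paste (cells_cons M (cells_id Q) eq_refl) psi (tcomp_idl j) (tcomp_idl g)))
    as [phi [H1 H2]].
  simpl in phi, H1, H2.
  assert (Hd : tr (tcomp_idl j) (tcomp_idl (tid E)) (idcell (hom j (tid E))) = hcart j (tid E))
      by apply tr_idcell.
  rewrite Hd in H1, H2.
  exists (paste (cells_cons lx (cells_id Q) eq_refl) phi (tcomp_idr x) (tcomp_idl g)). split.
  - apply (f_equal (fun G => paste (cells_cons ax (cells_cons lx (cells_id Q) eq_refl) eq_refl) G
      (tcomp_idl j) (tcomp_idl g))) in H1.
    transitivity (paste (cells_cons ax (cells_cons lx (cells_id Q) eq_refl) eq_refl)
      (rcomp (hcart j (tid E)) phi) (tcomp_idl j) (tcomp_idl g)).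
    + symmetry. etransitivity; [exact (rcomp_sub_one _ _ _ _ (tcomp_idl j) (tcomp_idr x)
        (tcomp_idl g))|].
      unfold ax. rewrite paste_hom_fact. reflexivity.
    + etransitivity; [exact H1|]. clear.
      transitivity (paste (cells_id (hom j x :-: Q)) psi (tcomp_idl j) (tcomp_idl g)); [|apply
          paste_idl].
      apply paste_assoc.
      pose proof (cells_paste_two ax lx M eq_refl eq_refl eq_refl eq_refl
        (tcomp_idl (tid A)) (tcomp_idl (tid V)) (cells_paste_idl (cells_id Q))) as H.
      assert (E0 : paste (cells_two ax lx) M (tcomp_idl (tid A)) (tcomp_idl (tid V)) = idcell
          (hom j x)).
      { unfold M.
        etransitivity; [exact (hom_fact_subs (cells_two ax lx) (rcomp (hcart j (tid E)) (hcart
            (tid E) x))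
          (tcomp_idl j) (tcomp_idl x) (tcomp_idl _) (tcomp_idl _) (tcomp_idl j) (tcomp_idl x)
              (tcomp_idl j) (tcomp_idl x))|].
        etransitivity; [|exact (hom_fact_hcart (tcomp_idl j) (tcomp_idl x))].
        assert (E1 : paste (cells_two ax lx) (rcomp (hcart j (tid E)) (hcart (tid E) x))
            (tcomp_idl j) (tcomp_idl x) = hcart j x).
        { etransitivity; [exact (rcomp_sub_two ax lx _ _ (tcomp_idl j) (tcomp_idr x) (tcomp_idl
            x))|].
          unfold ax, lx. rewrite !paste_hom_fact. apply rcomp_rid_r. }
        exact (f_equal (hom_fact (tcomp_idl j) (tcomp_idl x)) E1). }
      rewrite E0 in H. exact H.
  - intros phi' H'.
    rewrite (H2 (rcomp (hcart (tid E) x) phi')).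
    + etransitivity; [exact (rcomp_sub_cons lx (hcart (tid E) x) phi' (tcomp_idr x) (tcomp_idr x)
        (tcomp_idl g) (tcomp_idl x))|].
      unfold lx. rewrite paste_hom_fact. apply rcomp_rid.
    + rewrite <- H'. symmetry.
      etransitivity; [exact (rcomp_sub_cons M (hcart j x) phi' (tcomp_idl j) (tcomp_idl j)
          (tcomp_idl g) (tcomp_idl x))|].
      unfold M. rewrite paste_hom_fact.
      exact (rcompA_one (hcart j (tid E)) (hcart (tid E) x) phi').
Qed.
End Dense.

(** * Absolute extensions as relative adjunctions *)

Section Ext.
Context {X : virtual_equipment}.

Lemma left_opcartesian_ext (A0 An Am B0 Bm : X) (P : chains X A0 An) (q : loose An A0)
    (a : P =>> q) (Q : chains X An Am) (s : loose Bm B0) (f : tight A0 B0) (g : tight Am Bm)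
    (b b' : cell (q :-: Q) s f g) e0 en :
  left_opcartesian a ->
  paste (cells_cons a (cells_id Q) eq_refl) b e0 en =
  paste (cells_cons a (cells_id Q) eq_refl) b' e0 en :> cell _ s f g -> b = b'.
Proof.
  intros Ha H. destruct (Ha _ Q _ _ s f g (paste (cells_cons a (cells_id Q) eq_refl) b e0 en))
    as [c [H1 H2]].
  rewrite <- (H2 b), <- (H2 b'); [reflexivity| |].
  - rewrite H. pirr.
  - pirr.
Qed.

Lemma lid_ext_one (A0 A An B0 Bn : X) (p : loose A A0) (Q : chains X A An) (s : loose Bn B0)
    (f : tight A0 B0) (g : tight An Bn) (b b' : cell (p :-: lid A :-: Q) s f g) e0 en :
  paste (cells_cons (idcell p) (cells_cons (lunit A) (cells_id Q) eq_refl) eq_refl) b e0 en =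
  paste (cells_cons (idcell p) (cells_cons (lunit A) (cells_id Q) eq_refl) eq_refl) b' e0 en
    :> cell (p :-: Q) s f g ->
  b = b'.
Proof.
  intros H.
  rewrite <- (@lid_fact_uniq X _ _ _ _ _ [: p] Q s f g b), <- (@lid_fact_uniq X _ _ _ _ _ [: p] Q
      s f g b').
  f_equal.
  rewrite (proof_irrelevance _ e0 (tcomp_idl f)), (proof_irrelevance _ en (tcomp_idl g)) in H.
  assert (E : cells_app (cells_id [: p]) (cells_cons (lunit A) (cells_id Q) eq_refl) eq_refl
      eq_refl =
    cells_cons (idcell p) (cells_cons (lunit A) (cells_id Q) eq_refl) eq_refl
    :> pcells (p :-: Q) _ _ _).
  { simpl. f_equal. apply proof_irrelevance. }
  pose proof (f_equal (fun s0 => paste s0 b (tcomp_idl f) (tcomp_idl g)) E) as E1.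
  pose proof (f_equal (fun s0 => paste s0 b' (tcomp_idl f) (tcomp_idl g)) E) as E2.
  exact (eq_trans E1 (eq_trans H (eq_sym E2))).
Qed.

Context {A E D C : X} {j : tight A E} {r : tight D E} (a : left_adjoint j r)
  (c : tight D C) (x : tight C E) (m : cell (cnil D) (lid E) r (c ;; x))
  (lc : tight A C) (elc : ladj a ;; c = lc) (elcx : ladj a ;; (c ;; x) = lc ;; x).
Local Notation l := (ladj a).

(* The unit of the adjunction of x with the candidate left j-adjoint l;c *)
Definition ext_unit : cell (cnil A) (lid E) j (lc ;; x) :=
  rcomp (eta a) (pre (eq_refl (l ;; r)) elcx m).

Definition ext_universal : Prop :=
  forall (V : X) (v : tight V C) (x' : tight V E) (e : v ;; x = x') (P : chains X A V)
    (y : cell P (lid E) j x'),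
  exists! q : cell P (lid C) lc v, rcomp ext_unit (rmap eq_refl e q) = y.

(** Naturality of [m] moves r(d) across it and turns it into x(c(d)), which then merges with x(q)
    into the image of a single 2-cell. *)
Lemma ext_nat (V W : X) (v : tight V D) (w : tight W C) vr vc vcx wx
    (evr : v ;; r = vr) (evc : v ;; c = vc) (evx : vc ;; x = vcx) (evcx : v ;; (c ;; x) = vcx)
    (ew : w ;; x = wx) (P : chains X A V) (Q : chains X V W)
    (d : cell P (lid D) l v) (q : cell Q (lid C) vc w) :
  rcomp (rmap eq_refl evr d) (rcomp (pre evr evcx m) (rmap evx ew q)) =
  rcomp (pre (eq_refl (l ;; r)) elcx m) (rmap eq_refl ew (rcomp (rmap elc evc d) q)).
Proof.
  etransitivity; [exact (pre_nat m d eq_refl evr elcx evcx (rmap evx ew q))|].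
  f_equal.
  rewrite rmap_rcomp with (eg := evx). f_equal.
  symmetry. apply rmap_rmap. reflexivity.
Qed.

Lemma ext_unit_nat (V W : X) (v : tight V D) (w : tight W C) vr vc vcx wx
    (evr : v ;; r = vr) (evc : v ;; c = vc) (evx : vc ;; x = vcx) (evcx : v ;; (c ;; x) = vcx)
    (ew : w ;; x = wx) (P : chains X A V) (Q : chains X V W)
    (d : cell P (lid D) l v) (q : cell Q (lid C) vc w) :
  rcomp (rcomp (eta a) (rmap eq_refl evr d)) (rcomp (pre evr evcx m) (rmap evx ew q)) =
  rcomp ext_unit (rmap eq_refl ew (rcomp (rmap elc evc d) q)).
Proof.
  etransitivity; [exact (rcompA_nil _ _ _)|].
  etransitivity; [exact (f_equal (rcomp (eta a)) (ext_nat evr evc evx evcx ew d q))|].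
  symmetry. exact (rcompA_nil (eta a) (pre eq_refl elcx m) _).
Qed.

Lemma eta_rid : rcomp (eta a) (rid (l ;; r)) = eta a.
Proof. exact (mul_rid eq_refl (eta a)). Qed.

Lemma flat_act_eta : flat_act a (eq_refl (l ;; r)) (eta a) = rid l.
Proof.
  rewrite <- (flat_eta (a := a) (eq_refl (l ;; r)) (rid l)). f_equal.
  rewrite rmap_rid. symmetry. exact eta_rid.
Qed.

Context (k : [: hom c (tid C)] =>> hom r x)
  (Hk : act k (tcomp_idr c) (eq_refl (c ;; x)) (rid c) = m).
Local Notation lam := (rcomp m (rmap eq_refl (tcomp_idl x) (hcart c (tid C)))).
Local Notation kap := (hom_comp (idcell (hom j r)) k).

(** By Yoneda, [k] is recovered from its value [m] at the identity of [c]: the universal element of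
    C(c,1) is that identity followed by itself, and [act_natural] moves the second factor out. *)
Lemma tr_leg : tr (tcomp_idl r) (tcomp_idl x) k = lam.
Proof.
  rewrite <- (act_hcart k (tcomp_idl (tid C)) (tcomp_idl x)).
  rewrite <- Hk. symmetry.
  etransitivity; [symmetry; exact (act_natural k (tcomp_idr c) (tcomp_idl (tid C)) eq_refl
      (tcomp_idl x)
    (rid c) (hcart c (tid C)))|].
  f_equal. rewrite rmap_tid. apply rcomp_rid.
Qed.

Lemma tr_kap : tr (tcomp_idl j) (tcomp_idl x) kap = rcomp (hcart j r) lam.
Proof.
  rewrite (tr_hom_comp _ _ (tcomp_idl j) (tcomp_idl r) (tcomp_idl x)), tr_idcell, tr_leg.
      reflexivity.
Qed.

Local Notation eta' := (hom_fact (tcomp_idl j) (eq_refl (l ;; r)) (eta a)).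

(** Elements transposed along [ext_unit] are exactly values of [kap] at pairs whose first entry is
    the unit, read by [eta'] as a cell into E(j,r) with right side l. *)
Lemma ext_unit_kap (V : X) (v : tight V C) x' (e : v ;; x = x') (P : chains X A V)
    (q : cell P (lid C) lc v) :
  hom_fact (tcomp_idl j) e (rcomp ext_unit (rmap eq_refl e q)) =
  paste (cells_two eta' (hom_fact elc (tcomp_idr v) q)) kap (tcomp_idl (tid A)) (tcomp_idr v).
Proof.
  apply (tr_inj (e0 := tcomp_idl j) (en := e)). rewrite tr_hom_fact. symmetry.
  transitivity (paste (cells_two eta' (hom_fact elc (tcomp_idr v) q))
    (tr (tcomp_idl j) (tcomp_idl x) kap) (tcomp_idl j) e).
  - symmetry. apply paste1.
  - rewrite tr_kap.
    etransitivity; [exact (rcomp_sub_two _ _ _ _ (tcomp_idl j) (eq_refl (l ;; r)) e)|].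
    rewrite paste_hom_fact.
    rewrite rcomp_sub_nil with (eg := elcx).
    rewrite paste_rmap with (e3 := elc) (e4 := tcomp_idr v) (e5 := eq_refl) (e6 := e).
    rewrite paste_hom_fact. symmetry. exact (rcompA_nil (eta a) (pre eq_refl elcx m) _).
Qed.

Lemma paste_kap_tr : paste (cells_one kap) (hcart j x) (tcomp_idl j) (tcomp_idl x) =
  rcomp ext_unit (rmap eq_refl (tcomp_idl x)
    (rcomp (rmap elc (tcomp_idl c) (flat_act a (tcomp_idl r) (hcart j r))) (hcart c (tid C)))).
Proof.
  etransitivity; [exact tr_kap|].
  rewrite <- (ext_unit_nat (tcomp_idl r) (tcomp_idl c) eq_refl (tcomp_idl (c ;; x)) (tcomp_idl x)).
  rewrite eta_flat, pre_tid. reflexivity.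
Qed.

Lemma absolute_universal : left_opcartesian kap -> ext_universal.
Proof.
  intros Hop V v x' e P y.
  (* [psi] is the composition of D(l,1) and C(c,1) into C(lc,1), read through E(j,r) = D(l,1). Its
     factor [phi] through [kap] is the transposition from E(j,x) to C(lc,1). *)
  set (psi := rcomp (rmap elc (tcomp_idl c) (flat_act a (tcomp_idl r) (hcart j r))) (hcart c (tid
      C))).
  destruct (Hop _ (cnil C) _ _ (lid C) lc (tid C) psi) as [phi [H1 _]].
  simpl cells_id in H1. simpl in phi.
  assert (H1' : paste (cells_one kap) phi (tcomp_idl lc) (tcomp_idl (tid C)) = psi).
  { rewrite <- H1. f_equal. symmetry. apply cells_one_eq. }
  clear H1.
  (* Cancelling the left-opcartesian [kap] reduces this to [paste_kap_tr]. *)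
  assert (H2 : rcomp ext_unit (rmap eq_refl (tcomp_idl x) phi) = hcart j x).
  { apply (left_opcartesian_ext (Q := cnil C) (e0 := tcomp_idl j) (en := tcomp_idl x) Hop).
    simpl cells_id.
    rewrite (cells_one_eq kap eq_refl : cells_cons kap (cells_nil (tid C)) eq_refl = _).
    etransitivity; [|symmetry; exact paste_kap_tr].
    fold psi. rewrite <- H1'.
    etransitivity; [exact (rcomp_sub_nil (cells_one kap) ext_unit _ (tcomp_idl j) (tcomp_idl (lc
        ;; x)) (tcomp_idl x))|].
    rewrite pre_tid. f_equal. apply paste_rmap. }
  exists (paste (cells_one (hom_fact (tcomp_idl j) e y)) phi (tcomp_idl lc) (tcomp_idr v)). split.
  - apply (f_equal (fun G => paste (cells_one (hom_fact (tcomp_idl j) e y)) G (tcomp_idl j) e))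
      in H2.
    rewrite paste_hom_fact in H2. refine (eq_trans _ H2). symmetry.
    etransitivity; [exact (rcomp_sub_nil (cells_one (hom_fact (tcomp_idl j) e y)) ext_unit _
      (tcomp_idl j) (tcomp_idl (lc ;; x)) e)|].
    rewrite pre_tid. f_equal. apply paste_rmap.
  (* By [ext_unit_kap], applying [phi] amounts to evaluating [psi] at the pair [eta'], [q]. The
     transpose of the unit is the identity of [l], so only [q] remains. *)
  - intros q Hq.
    refine (eq_trans (f_equal (fun z : cell P (hom j x) (tid A) v =>
      paste (cells_one z) phi (tcomp_idl lc) (tcomp_idr v))
      (eq_trans (f_equal (hom_fact (tcomp_idl j) e) (eq_sym Hq)) (ext_unit_kap e q))) _).
    set (s := cells_two eta' (hom_fact elc (tcomp_idr v) q)).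
    transitivity (paste s psi (tcomp_idl lc) (tcomp_idr v)).
    { symmetry.
      exact (eq_trans (f_equal (fun G => paste s G (tcomp_idl lc) (tcomp_idr v)) (eq_sym H1'))
        (paste1 s kap phi (tcomp_idl lc) (tcomp_idl (tid C)) (tcomp_idl lc) (tcomp_idr v)
           (tcomp_idl (tid A)) (tcomp_idr v) (tcomp_idl lc) (tcomp_idr v))). }
    unfold psi, s.
    etransitivity; [exact (rcomp_sub_two eta' (hom_fact elc (tcomp_idr v) q)
      _ _ (tcomp_idl lc) elc (tcomp_idr v))|].
    rewrite paste_hom_fact.
    rewrite paste_rmap with (e3 := tcomp_idl l) (e4 := tcomp_idr l) (e5 := elc) (e6 := elc).
    unfold flat_act.
    rewrite paste_act with (x1 := l) (e3 := tcomp_idl j) (e4 := eq_refl (l ;; r)) (eg1 := eq_refl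
        (l ;; r)) (ek1 := tcomp_idr l)
      by apply tcomp_idr.
    rewrite paste_hom_fact.
    change (act _ _ _ (eta a)) with (flat_act a (eq_refl (l ;; r)) (eta a)).
    rewrite flat_act_eta, rmap_rid. apply rcomp_rid.
Qed.

Local Notation dd := (flat_act a (tcomp_idl r) (hcart j r)).

(* E(j,r), C(c,1) is D(l,1), C(c,1), and the actions of D(1,1) on its two entries agree under
   every 2-cell out of it, since they agree on the unit of D(1,1). *)
Lemma balanced (Am B0 Bm : X) (Q : chains X C Am) (s : loose Bm B0) (f : tight A B0)
    (g : tight Am Bm) (psi : cell (hom j r :-: hom c (tid C) :-: Q) s f g) :
  paste (cells_cons eta' (cells_cons
     (hom_fact elc (tcomp_idl (tid C)) (rcomp (rmap elc (tcomp_idl c) dd) (hcart c (tid C))))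
     (cells_id Q) eq_refl) eq_refl) psi (tcomp_idl f) (tcomp_idl g) = psi :> cell _ s f g.
Proof.
  (* [mr] and [mc] are the right action of D(1,1) on E(j,r) and its left action on C(c,1). *)
  set (mr := hom_fact (tcomp_idl j) (tcomp_idl r) (rcomp (hcart j r) (lid_map r))
    : [: hom j r; lid D] =>> hom j r).
  set (mc := hom_fact (tcomp_idl c) (tcomp_idl (tid C)) (rcomp (lid_map c) (hcart c (tid C)))
    : [: lid D; hom c (tid C)] =>> hom c (tid C)).
  assert (Emr : paste (cells_two (idcell (hom j r)) (lunit D)) mr (tcomp_idl (tid A)) (tcomp_idl
      (tid D)) = idcell (hom j r)).
  { apply (tr_inj (e0 := tcomp_idl j) (en := tcomp_idl r)).
    refine (eq_trans _ (eq_sym (tr_idcell (tcomp_idl j) (tcomp_idl r)))).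
    transitivity (paste (cells_two (idcell (hom j r)) (lunit D)) (rcomp (hcart j r) (lid_map r))
        (tcomp_idl j) (tcomp_idl r)).
    - unfold mr. rewrite <- (tr_hom_fact (tcomp_idl j) (tcomp_idl j) (tcomp_idl r) (tcomp_idl r)
        (rcomp (hcart j r) (lid_map r))) at 2.
      symmetry. apply paste1.
    - etransitivity; [exact (rcomp_sub_two (idcell (hom j r)) (lunit D) _ _ (tcomp_idl j)
        (tcomp_idl r) (tcomp_idl r))|].
      rewrite paste1_idl. etransitivity; [|apply rcomp_rid_r]. f_equal. apply lid_map_unit. }
  assert (Emc : paste (cells_two (lunit D) (idcell (hom c (tid C)))) mc (tcomp_idl (tid D))
      (tcomp_idl (tid C)) = idcell (hom c (tid C))).
  { apply (tr_inj (e0 := tcomp_idl c) (en := tcomp_idl (tid C))).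
    refine (eq_trans _ (eq_sym (tr_idcell (tcomp_idl c) (tcomp_idl (tid C))))).
    transitivity (paste (cells_two (lunit D) (idcell (hom c (tid C)))) (rcomp (lid_map c) (hcart
        c (tid C))) (tcomp_idl c) (tcomp_idl (tid C))).
    - unfold mc. rewrite <- (tr_hom_fact (tcomp_idl c) (tcomp_idl c) (tcomp_idl (tid C))
        (tcomp_idl (tid C)) (rcomp (lid_map c) (hcart c (tid C)))) at 2.
      symmetry. apply paste1.
    - etransitivity; [exact (rcomp_sub_two (lunit D) (idcell (hom c (tid C))) _ _ (tcomp_idl c)
        (tcomp_idl c) (tcomp_idl (tid C)))|].
      rewrite paste1_idl. etransitivity; [|apply rcomp_rid]. f_equal. apply lid_map_unit. }
  assert (B : paste (cells_cons mr (cells_id (hom c (tid C) :-: Q)) eq_refl) psi (tcomp_idl f)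
      (tcomp_idl g) =
    paste (cells_cons (idcell (hom j r)) (cells_cons mc (cells_id Q) eq_refl) eq_refl) psi
        (tcomp_idl f) (tcomp_idl g)
    :> cell (hom j r :-: lid D :-: hom c (tid C) :-: Q) s f g).
  { apply (lid_ext_one (e0 := tcomp_idl f) (en := tcomp_idl g)).
    transitivity (paste (cells_id (hom j r :-: hom c (tid C) :-: Q)) psi (tcomp_idl f) (tcomp_idl
        g)).
    - apply paste_assoc.
      pose proof (cells_paste_two (idcell (hom j r)) (lunit D) mr eq_refl eq_refl eq_refl eq_refl
        (tcomp_idl (tid A)) (tcomp_idl (tid D)) (cells_paste_idl (cells_id (hom c (tid C) :-:
            Q)))) as H.
      rewrite Emr in H. exact H.
    - symmetry. apply paste_assoc.
      pose proof (cells_paste_two (lunit D) (idcell (hom c (tid C))) mc eq_refl eq_refl eq_refl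
          eq_refl
        (tcomp_idl (tid D)) (tcomp_idl (tid C)) (cells_paste_idl (cells_id Q))) as H.
      pose proof (cells_paste_one (idcell (hom j r)) (idcell (hom j r)) eq_refl eq_refl
        (tcomp_idl (tid A)) (tcomp_idl (tid D)) H) as H'.
      rewrite Emc, paste1_idl in H'. exact H'. }
  (* Evaluate [B] at [eta'] and [dd]: the right action gives the identity of E(j,r), since [dd] is
     the transpose of its universal element, and the left action gives the sequence of the
     statement. *)
  apply (f_equal (fun G => paste (cells_cons eta' (cells_cons dd (cells_id (hom c (tid C) :-: Q))
      eq_refl) eq_refl)
    G (tcomp_idl f) (tcomp_idl g))) in B.
  etransitivity; [|etransitivity; [exact (eq_sym B)|]].
  - symmetry. apply paste_assoc.
    pose proof (cells_paste_two dd (idcell (hom c (tid C))) mc eq_refl eq_refl eq_refl eq_refl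
      (tcomp_idr l) (tcomp_idl (tid C)) (cells_paste_idl (cells_id Q))) as H.
    pose proof (cells_paste_one eta' (idcell (hom j r)) eq_refl eq_refl
      (tcomp_idl (tid A)) (tcomp_idr l) H) as H'.
    rewrite paste_idr in H'.
    assert (E1 : paste (cells_two dd (idcell (hom c (tid C)))) mc (tcomp_idr l) (tcomp_idl (tid
        C)) =
      hom_fact elc (tcomp_idl (tid C)) (rcomp (rmap elc (tcomp_idl c) dd) (hcart c (tid C)))).
    { apply (tr_inj (e0 := elc) (en := tcomp_idl (tid C))).
      refine (eq_trans _ (eq_sym (tr_hom_fact _ _ _ _ _))).
      transitivity (paste (cells_two dd (idcell (hom c (tid C)))) (rcomp (lid_map c) (hcart c
          (tid C))) elc (tcomp_idl (tid C))).
      - unfold mc. rewrite <- (tr_hom_fact (tcomp_idl c) (tcomp_idl c) (tcomp_idl (tid C))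
          (tcomp_idl (tid C)) (rcomp (lid_map c) (hcart c (tid C)))) at 2.
        symmetry. apply paste1.
      - etransitivity; [exact (rcomp_sub_two dd (idcell (hom c (tid C))) _ _ elc (tcomp_idl c)
          (tcomp_idl (tid C)))|].
        rewrite paste1_idl. reflexivity. }
    rewrite E1 in H'. exact H'.
  - transitivity (paste (cells_id (hom j r :-: hom c (tid C) :-: Q)) psi (tcomp_idl f) (tcomp_idl
      g)).
    + apply paste_assoc.
      pose proof (cells_paste_two eta' dd mr eq_refl eq_refl eq_refl eq_refl
        (tcomp_idl (tid A)) (tcomp_idl (tid D)) (cells_paste_idl (cells_id (hom c (tid C) :-:
            Q)))) as H.
      assert (E1 : paste (cells_two eta' dd) mr (tcomp_idl (tid A)) (tcomp_idl (tid D)) = idcell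
          (hom j r)).
      { apply (tr_inj (e0 := tcomp_idl j) (en := tcomp_idl r)).
        refine (eq_trans _ (eq_sym (tr_idcell (tcomp_idl j) (tcomp_idl r)))).
        transitivity (paste (cells_two eta' dd) (rcomp (hcart j r) (lid_map r)) (tcomp_idl j)
            (tcomp_idl r)).
        - unfold mr. rewrite <- (tr_hom_fact (tcomp_idl j) (tcomp_idl j) (tcomp_idl r) (tcomp_idl
            r) (rcomp (hcart j r) (lid_map r))) at 2.
          symmetry. apply paste1.
        - etransitivity; [exact (rcomp_sub_two eta' dd _ _ (tcomp_idl j) eq_refl (tcomp_idl r))|].
          rewrite paste_hom_fact. exact (eta_flat a (tcomp_idl r) (hcart j r)). }
      rewrite E1 in H. exact H.
    + apply paste_idl.
Qed.

(** The pair [eta'], [q], with [q] the transpose of the universal element of E(j,x), is a section of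
    [kap]; this gives uniqueness. In the other order, [kap] followed by the pair is not an identity
    sequence, but by [balanced] no 2-cell out of the chain can tell it from one; this gives
    existence. *)
Lemma universal_absolute : ext_universal -> left_opcartesian kap.
Proof.
  intros Hu Am Q B0 Bm s f g psi.
  destruct (Hu C (tid C) x (tcomp_idl x) [: hom j x] (hcart j x)) as [q0 [Hq0 _]].
  set (q := hom_fact elc (tcomp_idl (tid C)) q0).
  exists (paste (cells_cons eta' (cells_cons q (cells_id Q) eq_refl) eq_refl) psi
    (tcomp_idl f) (tcomp_idl g)). split.
  - refine (eq_trans _ (balanced psi)).
    apply paste_assoc.
    assert (E1 : paste (cells_one kap) q0 (tcomp_idl lc) (tcomp_idl (tid C)) =
      rcomp (rmap elc (tcomp_idl c) dd) (hcart c (tid C))).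
    { pose proof paste_kap_tr as H.
      destruct (Hu _ (tid C) x (tcomp_idl x) [: hom j r; hom c (tid C)]
        (paste (cells_one kap) (hcart j x) (tcomp_idl j) (tcomp_idl x))) as [q1 [_ Hq1]].
      transitivity q1; [symmetry|]; apply Hq1.
      - rewrite <- Hq0. symmetry.
        etransitivity; [exact (rcomp_sub_nil (cells_one kap) ext_unit _ (tcomp_idl j) (tcomp_idl
            (lc ;; x)) (tcomp_idl x))|].
        rewrite pre_tid. f_equal. apply paste_rmap.
      - symmetry. exact H. }
    assert (E2 : paste (cells_one kap) q (tcomp_idl l) (tcomp_idl (tid C)) =
      hom_fact elc (tcomp_idl (tid C)) (rcomp (rmap elc (tcomp_idl c) dd) (hcart c (tid C)))).
    { unfold q. etransitivity; [exact (hom_fact_subs (cells_one kap) q0 elc (tcomp_idl (tid C))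
        (tcomp_idl l) (tcomp_idl (tid C))
         elc (tcomp_idl (tid C)) (tcomp_idl lc) (tcomp_idl (tid C)))|].
      exact (f_equal (hom_fact elc (tcomp_idl (tid C))) E1). }
    pose proof (cells_paste_one kap q eq_refl eq_refl (tcomp_idl l) (tcomp_idl (tid C))
      (cells_paste_idl (cells_id Q))) as H.
    rewrite E2 in H.
    pose proof (cells_paste_unit eta' eq_refl eq_refl (tcomp_idl (tid A)) (tcomp_idl l) H) as H'.
    change (cells_nil (tid A)) with (cells_id (cnil A)) in H'.
    rewrite paste_idl in H'. exact H'.
  - intros phi Hphi. rewrite <- Hphi.
    transitivity (paste (cells_id (hom j x :-: Q)) phi (tcomp_idl f) (tcomp_idl g)); [|apply
        paste_idl].
    apply paste_assoc.
    pose proof (cells_paste_two eta' q kap eq_refl eq_refl eq_refl eq_refl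
      (tcomp_idl (tid A)) (tcomp_idl (tid C)) (cells_paste_idl (cells_id Q))) as H.
    assert (E1 : paste (cells_two eta' q) kap (tcomp_idl (tid A)) (tcomp_idl (tid C)) = idcell
        (hom j x)).
    { etransitivity; [|exact (hom_fact_hcart (tcomp_idl j) (tcomp_idl x))].
      etransitivity; [|exact (f_equal (hom_fact (tcomp_idl j) (tcomp_idl x)) Hq0)].
      symmetry. etransitivity; [exact (ext_unit_kap (tcomp_idl x) q0)|].
      unfold q. pirr. }
    rewrite E1 in H. exact H.
Qed.

(** After composition with E(j,r), the given 2-cell factors through [kap] as [Psi], and density at
    [x] writes [Psi] as the universal element of E(j,x) followed by [phi]. Density at [r] then
    cancels E(j,r) again. *)
Lemma universal_extension : dense j -> ext_universal ->
  is_colimit (f := r) {| apex := x; leg := k |}.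
Proof.
  intros Hj Hu Q psi0. simpl in *.
  pose proof (universal_absolute Hu) as Hop.
  set (psi := tr (tcomp_idl r) (tcomp_idl (tid E)) psi0).
  destruct (Hop _ Q _ _ (lid E) j (tid E) (rcomp (hcart j r) psi)) as [Psi [HPsi _]].
  destruct (dense_left Hj Psi) as [phi [Hphi _]].
  assert (K : forall phi1 : cell Q (lid E) x (tid E),
    rcomp lam phi1 = psi <-> rcomp (hcart j x) phi1 = Psi).
  { intros phi1.
    assert (K1 : paste (cells_cons kap (cells_id Q) eq_refl) (rcomp (hcart j x) phi1) (tcomp_idl
        j) (tcomp_idl (tid E))
       = rcomp (hcart j r) (rcomp lam phi1)).
    { etransitivity; [exact (rcomp_sub_cons kap (hcart j x) phi1 (tcomp_idl j) (tcomp_idl j)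
        (tcomp_idl (tid E)) (tcomp_idl x))|].
      etransitivity; [exact (f_equal (fun z => rcomp z phi1) tr_kap)|].
      exact (rcompA_one (hcart j r) lam phi1). }
    split; intros H.
    - apply (left_opcartesian_ext (e0 := tcomp_idl j) (en := tcomp_idl (tid E)) Hop).
      refine (eq_trans K1 (eq_trans _ (eq_sym HPsi))). now rewrite H.
    - destruct (dense_left Hj (rcomp (hcart j r) psi)) as [z [_ Hz]].
      transitivity z; [symmetry|]; apply Hz; [|reflexivity].
      refine (eq_trans (eq_sym K1) (eq_trans _ HPsi)). now rewrite H. }
  assert (K' : forall phi0 : Q =>> hom x (tid E), hom_comp k phi0 = psi0 <->
    rcomp lam (tr (tcomp_idl x) (tcomp_idl (tid E)) phi0) = psi).
  { intros phi0. unfold psi.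
    pose proof (tr_hom_comp k phi0 (tcomp_idl r) (tcomp_idl x) (tcomp_idl (tid E))) as H.
    rewrite tr_leg in H. split.
    - intros <-. exact (eq_sym H).
    - intros H'. apply (tr_inj (e0 := tcomp_idl r) (en := tcomp_idl (tid E))). exact (eq_trans H
        H'). }
  exists (hom_fact (tcomp_idl x) (tcomp_idl (tid E)) phi). split.
  - apply K'. rewrite tr_hom_fact. now apply K.
  - intros phi0 H0. apply K', K in H0.
    apply (tr_inj (e0 := tcomp_idl x) (en := tcomp_idl (tid E))). rewrite tr_hom_fact.
    destruct (dense_left Hj Psi) as [z [_ Hz]].
    rewrite <- (Hz _ Hphi). now apply Hz.
Qed.
End Ext.

(** * Strict creation *)

Section Creation.
Context {X : virtual_equipment}.

(* The cocones are under [tid D ;; r], which is only propositionally [r]; leaving [r'] free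
   lets us pass to cocones under [r]. *)
Definition creates (A E D : X) (j : tight A E) (r r' : tight D E) (er : tid D ;; r = r') : Prop :=
  forall (C : X) (c : tight D C) (k : cocone (hom c (tid C)) r'),
    is_colimit k -> is_absolute j k ->
    exists c' : cocone (hom c (tid C)) (tid D),
      unique (fun k1 : cocone (hom c (tid C)) (tid D) =>
        {| apex := apex k1 ;; r; leg := gcomp (leg k1) (hom_map er (eq_refl (apex k1 ;; r))) |} =
            k) c' /\
      is_colimit c'.

Lemma strictly_creates_iff (A E D : X) (j : tight A E) (r r' : tight D E) (er : tid D ;; r = r') :
  strictly_creates_absolute_extensions j r <-> creates j er.
Proof. destruct er. reflexivity. Qed.

(** Equality of cocones is dependent, since the type of the leg mentions the apex. Comparing legs as
    cells into E(1,1) leaves the equation [e] only in a side. *)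
Lemma cocone_map_eq (D E V : X) (p : loose V D) (r r' : tight D E) (er : tid D ;; r = r')
    (k1 : cocone p (tid D)) (k : cocone p r') :
  {| apex := apex k1 ;; r; leg := gcomp (leg k1) (hom_map er (eq_refl (apex k1 ;; r))) |} = k <->
  exists e : apex k1 ;; r = apex k,
    rmap er e (tr (tcomp_idl (tid D)) (tcomp_idl (apex k1)) (leg k1)) =
    tr (tcomp_idl r') (tcomp_idl (apex k)) (leg k).
Proof.
  split.
  - intros <-. simpl. exists eq_refl. symmetry. apply tr_hom_map.
  - destruct k as [x k]. simpl. intros [e H]. destruct e. f_equal.
    apply (tr_inj (e0 := tcomp_idl r') (en := tcomp_idl (apex k1 ;; r))).
    rewrite <- H. apply tr_hom_map.
Qed.

Lemma cocone_ext (V Y Z : X) (p : loose V Y) (f : tight Y Z) (k k' : cocone p f)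
    (e : apex k = apex k') (e' : tid V ;; apex k' = apex k) :
  tr (tcomp_idl f) (tcomp_idl (apex k)) (leg k) = tr (tcomp_idl f) e' (leg k') -> k = k'.
Proof.
  destruct k as [x k], k' as [x' k']. simpl in *. destruct e. intros H. f_equal.
  apply (tr_inj (e0 := tcomp_idl f) (en := tcomp_idl x)). rewrite H. pirr.
Qed.

Lemma act_hom_map (Z W V B C : X) (k : tight B C) (f : tight Z B) (g : tight W B)
    (f' : tight Z C) (g' : tight W C) (ef : f ;; k = f') (eg : g ;; k = g')
    (x : tight V W) g1 k1 (eg1 : x ;; g = g1) (ek1 : x ;; g' = k1) (e : g1 ;; k = k1)
    (P : chains X Z V) (y : cell P (lid B) f g1) :
  act (hom_map ef eg) eg1 ek1 y = rmap ef e y.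
Proof.
  rewrite actE with (e0 := tcomp_idl f') (en := tcomp_idl g') (e1 := tcomp_idl f') (e2 := ek1).
  rewrite <- (gcomp_idl (hom_map ef eg)).
  rewrite tr_hom_map with (ef := tcomp_idl f) (eg := tcomp_idl g), tr_idcell.
  rewrite paste_rmap with (e3 := tcomp_idl f) (e4 := eg1) (e5 := ef) (e6 := e).
  rewrite paste_hom_fact. reflexivity.
Qed.

Lemma rmap_act (Z W V B C D : X) (f : tight Z B) (g : tight W B)
    (h : tight Z C) (k : tight W C) (phi : [: hom f g] =>> hom h k)
    (r : tight C D) (h' : tight Z D) (k' : tight W D) (eh : h ;; r = h') (ek : k ;; r = k')
    (psi : [: hom f g] =>> hom h' k')
    (H : rmap eh ek (tr (tcomp_idl h) (tcomp_idl k) phi) = tr (tcomp_idl h') (tcomp_idl k') psi)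
    (x : tight V W) g1 k1 k2 (eg1 : x ;; g = g1) (ek1 : x ;; k = k1) (ek2 : k1 ;; r = k2)
    (ek2' : x ;; k' = k2) (P : chains X Z V) (y : cell P (lid B) f g1) :
  rmap eh ek2 (act phi eg1 ek1 y) = act psi eg1 ek2' y.
Proof.
  rewrite actE with (e0 := tcomp_idl h) (en := tcomp_idl k) (e1 := tcomp_idl h) (e2 := ek1).
  rewrite (actE psi) with (e0 := tcomp_idl h') (en := tcomp_idl k') (e1 := tcomp_idl h') (e2 :=
      ek2').
  rewrite <- H. symmetry. apply paste_rmap.
Qed.

Section U.
Context {A E : X} {j : tight A E} {T : rel_monad j} {B : X} {u : tight B E}
  {U : [: hom j u] =>> hom (mon T) u} (HU : algebra_universal U).

Lemma rmap_graded (V V' : X) (x : tight V B) (x' : tight V' B) (y : tight V E) (y' : tight V' E)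
    (e : x ;; u = y) (e' : x' ;; u = y') (P : chains X V V') (phi : cell P (lid B) x x') :
  rcomp (act U e e (hcart j y)) (rmap e e' phi) = act U e' e' (rcomp (hcart j y) (rmap e e' phi)).
Proof. symmetry. apply act_natural. Qed.

(** The image of any 2-cell under [u] is a graded morphism, so uniqueness of lifts applies to it. *)
Lemma universal_faithful (V V' : X) (x : tight V B) (x' : tight V' B) (y : tight V E)
    (y' : tight V' E) (e : x ;; u = y) (e' : x' ;; u = y') (P : chains X V V')
    (phi psi : cell P (lid B) x x') : rmap e e' phi = rmap e e' psi -> phi = psi.
Proof.
  intros H. destruct (au_hom HU (rmap_graded e e' phi)) as [z [_ Hz]].
  rewrite <- (Hz phi eq_refl). apply Hz. now symmetry.
Qed.
End U.

(** * Lifting absolute extensions to an algebra object *)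

Section Ext.
Context {A E D C : X} {j : tight A E} {r : tight D E} (a : left_adjoint j r)
  (c : tight D C) (x : tight C E) (m : cell (cnil D) (lid E) r (c ;; x))
  (lc : tight A C) (elc : ladj a ;; c = lc) (elcx : ladj a ;; (c ;; x) = lc ;; x)
  (er : tid D ;; r = r).
Local Notation l := (ladj a).
Local Notation t := (ladj a ;; r).
Local Notation nu := (ext_unit m elcx).
Local Notation lm := (pre (eq_refl t) elcx m).

(** When [m] itself lifts, mu;x(q) is r(d) for an explicit [d], so nu;x(q) is eta;r(d) and the
    action drops the unit. Thus any lift of the cocone induces one and the same action on [x], which
    forces its apex. *)
Lemma lift_act (w : tight C D) (ew : w ;; r = x) (m2 : cell (cnil D) (lid D) (tid D) (c ;; w))
    (em : (c ;; w) ;; r = c ;; x) (Hm : rmap er em m2 = m)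
    (V : X) (v : tight V C) x' vw (e : v ;; x = x') (evw : v ;; w = vw) (e2 : vw ;; r = x')
    (P : chains X A V) (q : cell P (lid C) lc v) :
  act (adj_act a) e2 e2 (rcomp nu (rmap eq_refl e q)) = rcomp lm (rmap eq_refl e q).
Proof.
  assert (e3 : l ;; (c ;; w) = lc ;; w) by now rewrite <- elc, tcomp_assoc.
  assert (e4 : (lc ;; w) ;; r = lc ;; x) by now rewrite tcomp_assoc, ew.
  set (d := rcomp (pre (tcomp_idr l) e3 m2) (rmap eq_refl evw q) : cell P (lid D) l vw).
  assert (Hd : rmap eq_refl e2 d = rcomp lm (rmap eq_refl e q)).
  { etransitivity; [exact (rmap_rcomp (pre (tcomp_idr l) e3 m2) (rmap eq_refl evw q) eq_refl e4
      e2)|]. f_equal.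
    - rewrite <- Hm. symmetry. apply rmap_pre.
    - apply rmap_rmap. exact ew. }
  etransitivity; [|exact Hd]. rewrite <- (adj_act_eta (a := a) e2 d). f_equal.
  etransitivity; [exact (rcompA_nil (eta a) lm _)|].
  exact (f_equal (rcomp (eta a)) (eq_sym Hd)).
Qed.

Context (Hu : ext_universal m elcx).

Lemma ext_action : exists al : algebra (induced_monad a) C, exists ea : x = alg al,
  forall (V : X) (v : tight V C) x' (e : v ;; x = x') (e' : v ;; alg al = x') (P : chains X A V)
    (q : cell P (lid C) lc v),
  act (alg_act al) e' e' (rcomp nu (rmap eq_refl e q)) = rcomp lm (rmap eq_refl e q).
Proof.
  (* The action is prescribed at the universal element of E(j,x), whose transpose is [q0]; [Ha]
     extends the formula to all elements by uniqueness of transposes. *)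
  destruct (Hu (tcomp_idl x) (hcart j x)) as [q0 [Hq0 _]].
  set (alx := hom_fact (tcomp_idl t) (tcomp_idl x) (rcomp lm (rmap eq_refl (tcomp_idl x) q0))
    : [: hom j x] =>> hom t x).
  assert (Ha : forall (V : X) (v : tight V C) x' (e : v ;; x = x') (P : chains X A V)
    (q : cell P (lid C) lc v),
    act alx e e (rcomp nu (rmap eq_refl e q)) = rcomp lm (rmap eq_refl e q)).
  { intros V v x' e P q. set (y := rcomp nu (rmap eq_refl e q) : cell P (lid E) j x').
    rewrite actE with (e0 := tcomp_idl t) (en := tcomp_idl x) (e1 := tcomp_idl t) (e2 := e).
    unfold alx. rewrite tr_hom_fact.
    set (s := cells_one (hom_fact (tcomp_idl j) e y)).
    assert (S : forall n (z : cell (cnil A) (lid E) n (lc ;; x)) en,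
      paste s (rcomp z (rmap eq_refl (tcomp_idl x) q0)) en e =
      rcomp z (rmap eq_refl e (paste s q0 (tcomp_idl lc) (tcomp_idr v)))).
    { intros n z en. etransitivity; [exact (rcomp_sub_nil s z _ en (tcomp_idl (lc ;; x)) e)|].
      rewrite pre_tid. f_equal. apply paste_rmap. }
    refine (eq_trans (S _ _ _) _). f_equal. f_equal.
    destruct (Hu e y) as [q1 [_ Hq1]].
    transitivity q1; [symmetry|]; apply Hq1; [|reflexivity].
    refine (eq_trans (eq_sym (S _ nu (tcomp_idl j))) _).
    refine (eq_trans (f_equal (fun G => paste s G (tcomp_idl j) e) Hq0) _).
    apply paste_hom_fact. }
  assert (Hx : tr (tcomp_idl t) (tcomp_idl x) alx = rcomp lm (rmap eq_refl (tcomp_idl x) q0)).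
  { apply tr_hom_fact. }
  assert (al_unit : gcomp alx (hom_precomp (mon_unit (induced_monad a)) x) = idcell (hom j x)).
  { refine (proj2 (tr_unit_law (T := induced_monad a) alx) (eq_trans _ Hq0)).
    refine (eq_trans (f_equal (rcomp (eta a)) Hx) _). symmetry. exact (rcompA_nil (eta a) lm _). }
  assert (al_assoc : hom_comp (mon_ext (induced_monad a)) alx =
    gcomp (hom_comp (idcell (hom j (mon (induced_monad a)))) alx) alx).
  { refine (proj2 (tr_assoc_law (T := induced_monad a) alx) _).
    change (mon (induced_monad a)) with t. rewrite Hx.
    (* Write the universal element of E(j,t) as eta;r(d), which the extension operator sends to
       r(d). Both sides of the law then become mu;x(c(d);q0). *)
    set (d := flat_act a (eq_refl t) (hcart j t)).
    assert (Hd : hcart j t = rcomp (eta a) (rmap eq_refl eq_refl d)).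
    { symmetry. apply eta_flat. }
    assert (He : tr (tcomp_idl t) (tcomp_idl t) (adj_ext a) = rmap eq_refl eq_refl d).
    { rewrite <- (act_hcart (adj_ext a) (tcomp_idl t) (tcomp_idl t)). rewrite Hd. apply
        adj_ext_eta. }
    refine (eq_trans (f_equal (fun z => rcomp z (rcomp lm (rmap eq_refl (tcomp_idl x) q0))) He) _).
    etransitivity; [exact (ext_nat m elc elcx eq_refl elc eq_refl elcx (tcomp_idl x) d q0)|].
    symmetry.
    etransitivity; [|exact (Ha _ _ _ (tcomp_idl x) _ _)]. f_equal.
    etransitivity; [|exact (ext_unit_nat m elc elcx eq_refl elc eq_refl elcx (tcomp_idl x) d q0)].
    exact (f_equal (fun z => rcomp z (rcomp lm (rmap eq_refl (tcomp_idl x) q0))) Hd). }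
  exists (@Build_algebra X A E j (induced_monad a) C x alx al_unit al_assoc), eq_refl.
  simpl. intros V v x' e e' P q. rewrite (proof_irrelevance _ e' e). apply Ha.
Qed.

Context (HU : algebra_universal (T := induced_monad a) (adj_act a)).

(** Existence lifts the algebra of [ext_action]. For uniqueness, [lift_act] shows that the action
    restricted along [w2] is that algebra again, so [w2] is a second lift of it. *)
Lemma ext_lift : exists (w : tight C D) (ew : w ;; r = x),
  (forall (V : X) (v : tight V C) x' vw (e : v ;; x = x') (evw : v ;; w = vw) (e2 : vw ;; r = x')
    (P : chains X A V) (q : cell P (lid C) lc v),
    act (adj_act a) e2 e2 (rcomp nu (rmap eq_refl e q)) = rcomp lm (rmap eq_refl e q)) /\
  (forall (w2 : tight C D) (ew2 : w2 ;; r = x) (m2 : cell (cnil D) (lid D) (tid D) (c ;; w2))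
    (em : (c ;; w2) ;; r = c ;; x), rmap er em m2 = m -> w2 = w).
Proof.
  destruct ext_action as [al [ea Hal]].
  destruct (au_lift HU al) as [w [ew0 Hw]].
  assert (ew : w ;; r = x) by now rewrite ea.
  exists w, ew. split.
  - intros V v x' vw e evw e2 P q.
    assert (e' : v ;; alg al = x') by now rewrite <- ea.
    rewrite <- (Hal V v x' e e' P q), <- Hw. symmetry. apply act_hom_restr. exact evw.
  - intros w2 ew2 m2 em Hm.
    assert (ew2' : w2 ;; r = alg al) by now rewrite <- ea.
    refine (au_lift_uniq HU (e := ew2') (e' := ew0) _ Hw).
    apply (tr_inj (e0 := tcomp_idl t) (en := tcomp_idl (alg al))).
    rewrite tr_hom_restr.
    assert (e1 : tid C ;; x = alg al) by now rewrite tcomp_idl.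
    destruct (Hu e1 (hcart j (alg al))) as [q [Hq _]].
    transitivity (act (adj_act a) ew2' ew2' (rcomp nu (rmap eq_refl e1 q))).
    + f_equal. symmetry. exact Hq.
    + rewrite (lift_act ew2 Hm e1 (tcomp_idl w2)).
      rewrite <- (Hal C (tid C) (alg al) e1 (tcomp_idl _)).
      transitivity (act (alg_act al) (tcomp_idl (alg al)) (tcomp_idl (alg al)) (hcart j (alg al))).
      * f_equal. exact Hq.
      * apply act_hcart.
Qed.

Context (k : [: hom c (tid C)] =>> hom r x)
  (Hk : act k (tcomp_idr c) (eq_refl (c ;; x)) (rid c) = m).
Local Notation lam := (rcomp m (rmap eq_refl (tcomp_idl x) (hcart c (tid C)))).
Local Notation kap := (hom_comp (idcell (hom j r)) k).

Lemma ext_strictly_created (Hc : is_colimit (f := r) {| apex := x; leg := k |}) :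
  exists c' : cocone (hom c (tid C)) (tid D),
    unique (fun k1 : cocone (hom c (tid C)) (tid D) =>
      {| apex := apex k1 ;; r; leg := gcomp (leg k1) (hom_map er (eq_refl (apex k1 ;; r))) |} =
      {| apex := x; leg := k |}) c' /\
    is_colimit c'.
Proof.
  destruct ext_lift as [w [ew [Hact Huniq]]].
  pose proof (tr_leg Hk) as Hlam.
  pose proof (tr_kap (j := j) Hk) as Hkap.
  pose proof (universal_absolute elc Hk Hu) as Hop.
  set (d := flat_act a er (hcart j r)).
  assert (Hd : rcomp (eta a) (rmap eq_refl er d) = hcart j r) by apply eta_flat.
  assert (Had : act (adj_act a) er er (hcart j r) = rmap eq_refl er d).
  { rewrite <- Hd. apply adj_act_eta. }
  (* The leg is a graded morphism: with the universal element of E(j,r) written as eta;r(d), both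
     sides equal mu;x applied to c(d) followed by the universal element of C(c,1). *)
  assert (Hg : rcomp (act (adj_act a) er er (hcart j r)) lam =
    act (adj_act a) ew ew (rcomp (hcart j r) lam)).
  { rewrite Had.
    pose proof (ext_nat m elc elcx er (tcomp_idl c) eq_refl (tcomp_idl (c ;; x)) (tcomp_idl x) d
      (hcart c (tid C))) as H1. rewrite pre_tid in H1.
    pose proof (ext_unit_nat m elc elcx er (tcomp_idl c) eq_refl (tcomp_idl (c ;; x)) (tcomp_idl
        x) d
      (hcart c (tid C))) as H2. rewrite pre_tid, Hd in H2.
    refine (eq_trans H1 (eq_trans _ (f_equal (act (adj_act a) ew ew (P := [: hom j r; hom c (tid
        C)])) (eq_sym H2)))).
    symmetry. apply Hact. apply tcomp_idl. }
  destruct (au_hom HU Hg) as [lam' [Hlam' _]].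
  set (c' := {| apex := w; leg := hom_fact (tcomp_idl (tid D)) (tcomp_idl w) lam' |}
    : cocone (hom c (tid C)) (tid D)).
  exists c'. split; [split|].
  - apply cocone_map_eq. exists ew. simpl. rewrite tr_hom_fact, Hlam. exact Hlam'.
  - intros c2 H. apply cocone_map_eq in H. destruct H as [ew2 H2]. simpl in ew2, H2.
    assert (em : (c ;; apex c2) ;; r = c ;; x) by now rewrite tcomp_assoc, ew2.
    assert (Hw : apex c2 = w).
    { refine (Huniq _ ew2 (act (leg c2) (tcomp_idr c) eq_refl (rid c)) em _).
      rewrite <- Hk. apply (rmap_act H2). }
    subst w. symmetry.
    apply (@cocone_ext _ _ _ _ _ c2 c' eq_refl (tcomp_idl _)). simpl. rewrite tr_hom_fact.
    apply (universal_faithful HU (e := er) (e' := ew2)).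
    rewrite H2, Hlam, <- Hlam'. pirr.
  - intros Q psi0. simpl in *.
    set (psi := tr (tcomp_idl (tid D)) (tcomp_idl (tid D)) psi0).
    destruct (colimit_right Hc (rmap er er psi)) as [phiE [HphiE HuE]].
    simpl in phiE, HphiE, HuE. rewrite Hlam in HphiE, HuE.
    (* Cancel [kap]: there [lam] followed by [phiE] is r(psi), and r(psi) is graded by naturality of
       the action. *)
    assert (Hgr : rcomp (act (adj_act a) ew ew (hcart j x)) phiE =
      act (adj_act a) er er (rcomp (hcart j x) phiE)).
    { apply (left_opcartesian_ext (e0 := tcomp_idl t) (en := tcomp_idl r) Hop).
      assert (K1 : paste (cells_one kap) (act (adj_act a) ew ew (hcart j x)) (tcomp_idl t)
          (tcomp_idl x)
        = rcomp (rmap eq_refl er d) lam).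
      { etransitivity; [apply paste_act with (x1 := w) (e3 := tcomp_idl j) (e4 := tcomp_idl x)
          (eg1 := ew) (ek1 := ew); apply tcomp_idl|].
        refine (eq_trans (f_equal (act (adj_act a) ew ew (P := [: hom j r; hom c (tid C)])) Hkap)
            _).
        refine (eq_trans (eq_sym Hg) _). now rewrite Had. }
      etransitivity; [exact (rcomp_sub_cons kap _ phiE (tcomp_idl t) (tcomp_idl t) (tcomp_idl r)
          (tcomp_idl x))|].
      refine (eq_trans (f_equal (fun z => rcomp z phiE) K1) _).
      refine (eq_trans (rcompA_one (rmap eq_refl er d) lam phiE) _).
      refine (eq_trans (f_equal (rcomp (rmap eq_refl er d)) HphiE) _).
      symmetry.
      etransitivity; [apply paste_act with (x1 := tid D) (e3 := tcomp_idl j) (e4 := tcomp_idl r)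
        (eg1 := er) (ek1 := er); apply tcomp_idl|].
      assert (K2 : paste (cells_cons kap (cells_id Q) eq_refl) (rcomp (hcart j x) phiE)
          (tcomp_idl j) (tcomp_idl r)
        = rcomp (hcart j r) (rmap er er psi)).
      { etransitivity; [exact (rcomp_sub_cons kap (hcart j x) phiE (tcomp_idl j) (tcomp_idl j)
          (tcomp_idl r) (tcomp_idl x))|].
        refine (eq_trans (f_equal (fun z => rcomp z phiE) Hkap) _).
        refine (eq_trans (rcompA_one (hcart j r) lam phiE) _).
        exact (f_equal (rcomp (hcart j r)) HphiE). }
      refine (eq_trans (f_equal (act (adj_act a) er er (P := hom j r :-: hom c (tid C) :-: Q))
          K2) _).
      rewrite <- Had. exact (act_natural (adj_act a) er er er er (hcart j r) psi). }
    destruct (au_hom HU Hgr) as [phi [Hphi _]].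
    assert (Hcomp : forall phi0 : Q =>> hom w (tid D),
      hom_comp (leg c') phi0 = psi0 <->
      rcomp lam (rmap ew er (tr (tcomp_idl w) (tcomp_idl (tid D)) phi0)) = rmap er er psi).
    { intros phi0.
      pose proof (tr_hom_comp (leg c') phi0 (tcomp_idl (tid D)) (tcomp_idl w) (tcomp_idl (tid
          D))) as H.
      simpl leg in H at 2. rewrite tr_hom_fact in H.
      pose proof (rmap_rcomp lam' (tr (tcomp_idl w) (tcomp_idl (tid D)) phi0) er ew er) as H'.
      rewrite Hlam' in H'.
      unfold psi. split.
      - intros <-. refine (eq_trans (eq_sym H') _). f_equal. exact (eq_sym H).
      - intros H0. apply (tr_inj (e0 := tcomp_idl (tid D)) (en := tcomp_idl (tid D))).
        apply (universal_faithful HU (e := er) (e' := er)).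
        refine (eq_trans _ (eq_trans H' H0)).
        exact (f_equal (rmap er er (P := hom c (tid C) :-: Q)) H). }
    exists (hom_fact (tcomp_idl w) (tcomp_idl (tid D)) phi). split.
    + apply Hcomp. rewrite tr_hom_fact, Hphi. exact HphiE.
    + intros phi0 H0. apply Hcomp in H0.
      apply (tr_inj (e0 := tcomp_idl w) (en := tcomp_idl (tid D))). rewrite tr_hom_fact.
      apply (universal_faithful HU (e := ew) (e' := er)).
      rewrite Hphi. exact (HuE _ H0).
Qed.
End Ext.
End Creation.

(** * Strict monadicity *)

Section Final.
Context {X : virtual_equipment} {A E D : X} {j : tight A E} {r : tight D E}.

Lemma monadic_creates (a : left_adjoint j r) (O : algebra_object (induced_monad a)) :
  is_iso (comparison O) -> strictly_creates_absolute_extensions j r.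
Proof.
  intros Hiso. apply (strictly_creates_iff j (tcomp_idl r)).
  intros C c [x k] Hc Habs.
  (* [D] inherits the universal property along the isomorphism; [alg_lift_act] identifies the action
     it inherits with that of the adjunction. *)
  pose proof (algebra_universal_iso (alg_liftE O (induced_algebra a)) (algebra_object_universal
      O) Hiso) as HU.
  rewrite alg_lift_act in HU.
  assert (elcx : ladj a ;; (c ;; x) = (ladj a ;; c) ;; x) by (symmetry; apply tcomp_assoc).
  refine (ext_strictly_created (a := a) eq_refl (elcx := elcx) (tcomp_idl r) _ HU (k := k)
      eq_refl Hc).
  exact (absolute_universal eq_refl elcx eq_refl Habs).
Qed.

(** * Extensions arising from a factorization of r through k *)

Section Through.
Context (a : left_adjoint j r) {B : X} {u : tight B E} (k : tight D B) (ek : k ;; u = r).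
Local Notation l := (ladj a).
Local Notation t := (ladj a ;; r).
Context (lc : tight A B) (elc : l ;; k = lc) (elcx : l ;; (k ;; u) = lc ;; u) (e1 : lc ;; u = t).
Local Notation m := (rmap ek (eq_refl (k ;; u)) (rid k)).

Lemma pre_rid_map : pre (eq_refl t) elcx m = rmap e1 eq_refl (rid lc).
Proof.
  rewrite rmap_pre with (e3 := elc) (e4 := elc) (e5 := e1) (e6 := eq_refl).
  rewrite pre_rid. reflexivity.
Qed.

Lemma pre_rid_map_rcomp (V : X) (v : tight V B) x' (e : v ;; u = x') (P : chains X A V)
    (q : cell P (lid B) lc v) :
  rcomp (pre (eq_refl t) elcx m) (rmap eq_refl e q) = rmap e1 e q.
Proof.
  rewrite pre_rid_map.
  etransitivity; [symmetry; exact (rmap_rcomp (rid lc) q e1 eq_refl e)|].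
  f_equal. apply rcomp_rid.
Qed.

(** Here [m] is an identity up to the equation k;u = r, so it drops out of the unit. This serves
    both for the comparison and for the identity of [D]. *)
Lemma ext_unit_map (V : X) (v : tight V B) x' (e : v ;; u = x') (P : chains X A V)
    (q : cell P (lid B) lc v) :
  rcomp (ext_unit m elcx) (rmap eq_refl e q) = rcomp (eta a) (rmap e1 e q).
Proof.
  etransitivity; [exact (rcompA_nil (eta a) (pre (eq_refl t) elcx m) _)|].
  f_equal. apply pre_rid_map_rcomp.
Qed.

Lemma act_hom_map_rid : act (hom_map ek (tcomp_idl u)) (tcomp_idr k) (eq_refl (k ;; u)) (rid k) = m.
Proof. apply act_hom_map. Qed.
End Through.

(** * Free algebras and invertibility of the comparison *)

Section Object.
Context (a : left_adjoint j r) (O : algebra_object (induced_monad a)).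
Local Notation l := (ladj a).
Local Notation t := (ladj a ;; r).
Local Notation K := (comparison O).
Local Notation B := (Alg O).
Local Notation u := (alg (ualg O)).
Local Notation U := (alg_act (ualg O) : [: hom j (alg (ualg O))] =>> hom t (alg (ualg O))).

Let HO := algebra_object_universal O.
Let eK : K ;; u = r := alg_liftE O (induced_algebra a).
Let HK : hom_restr U eK eK = adj_act a := alg_lift_act O (induced_algebra a).

Lemma free_act (lc : tight A B) (elc : l ;; K = lc) (e1 : lc ;; u = t) (P : chains X A A)
    (d : cell P (lid D) l l) :
  act U e1 e1 (rcomp (eta a) (rmap eq_refl eq_refl d)) = rmap eq_refl eq_refl d.
Proof.
  rewrite <- (adj_act_eta (a := a) (eq_refl t) d) at 2. rewrite <- HK.
  symmetry. apply act_hom_restr. exact elc.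
Qed.

Lemma free_act_eta (lc : tight A B) (elc : l ;; K = lc) (e1 : lc ;; u = t) :
  act U e1 e1 (eta a) = rid t.
Proof.
  pose proof (free_act elc e1 (rid l)) as H. rewrite rmap_rid, eta_rid in H. exact H.
Qed.

(** Along [lc] the carrier is [t] with the free action ([Hfree]), so associativity of the action on
    [u] says that acting on [y] gives a graded morphism out of a free algebra; its lift is the
    transpose of [y]. The unit law gives [y] back, and naturality with [free_act_eta] gives the
    converse. *)
Lemma free_universal (lc : tight A B) (elc : l ;; K = lc) (elcx : l ;; (K ;; u) = lc ;; u) :
  ext_universal (rmap eK (eq_refl (K ;; u)) (rid K)) elcx.
Proof.
  intros V v x' e P y.
  assert (e1 : lc ;; u = t) by now rewrite <- elc, tcomp_assoc, eK.
  assert (Hfree : act U e1 e1 (hcart j t) = act (adj_ext a) (tcomp_idl t) (tcomp_idl t) (hcart j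
      t)).
  { pose proof (eta_flat a (eq_refl t) (hcart j t)) as Hd.
    refine (eq_trans (f_equal (act U e1 e1 (P := [: hom j t])) (eq_sym Hd)) _).
    refine (eq_trans (free_act elc e1 _) (eq_trans (eq_sym (adj_ext_eta _)) _)).
    exact (f_equal (act (adj_ext a) _ _ (P := [: hom j t])) Hd). }
  pose proof (free_act_eta elc e1) as Heta.
  destruct (au_hom HO (e := e1) (e' := e) (eps := act U e e y)) as [q [Hq _]].
  { exact (eq_trans (f_equal (fun z => rcomp z (act U e e y)) Hfree) (alg_assoc_el e (hcart j t)
      y)). }
  assert (Hmap : forall q' : cell P (lid B) lc v,
    rcomp (ext_unit (rmap eK eq_refl (rid K)) elcx) (rmap eq_refl e q') = y <-> rmap e1 e q' =
        act U e e y).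
  { intros q'.
    pose proof (ext_unit_map eK elc elcx e1 e q') as H0. split; intros H.
    - rewrite <- H.
      refine (eq_trans _ (f_equal (act U e e (P := P)) (eq_sym H0))).
      symmetry. etransitivity; [exact (act_natural U e1 e e1 e (eta a) q')|].
      rewrite Heta. apply rcomp_rid.
    - refine (eq_trans H0 _). rewrite H. exact (alg_unit_el e y). }
  exists q. split.
  - apply Hmap. exact Hq.
  - intros q' H. apply Hmap in H. apply (universal_faithful HO (e := e1) (e' := e)).
    now rewrite H.
Qed.

Lemma creates_monadic : dense j -> strictly_creates_absolute_extensions j r -> is_iso K.
Proof.
  intros Hj Hcr. apply (strictly_creates_iff j (tcomp_idl r)) in Hcr.
  set (er := tcomp_idl r) in Hcr.
  set (lc := l ;; K).
  assert (elcx : l ;; (K ;; u) = lc ;; u) by (symmetry; apply tcomp_assoc).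
  assert (e1 : lc ;; u = t) by (unfold lc; now rewrite tcomp_assoc, eK).
  set (m := rmap eK (eq_refl (K ;; u)) (rid K)).
  pose proof (free_universal (eq_refl lc) elcx) as Hu. fold m in Hu.
  pose proof (act_hom_map_rid eK) as Hk.
  destruct (Hcr B K {| apex := u; leg := hom_map eK (tcomp_idl u) |}
    (universal_extension (eq_refl lc) Hk Hj Hu) (universal_absolute (eq_refl lc) Hk Hu))
    as [[w lw] [[Hw _] _]].
  apply cocone_map_eq in Hw. destruct Hw as [ew Hw]. simpl in ew, Hw.
  assert (em : (K ;; w) ;; r = K ;; u) by now rewrite tcomp_assoc, ew.
  set (m2 := act lw (tcomp_idr K) (eq_refl (K ;; w)) (rid K)).
  assert (Hm : rmap er em m2 = m).
  { refine (eq_trans _ Hk). apply (rmap_act Hw). }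
  exists w. split.
  (* For K;w = 1, view r as its own extension along the identity of [D]; its transposition is that
     of the adjunction. The identity cocone and the one with apex K;w both lie over it, so strict
     creation identifies their apexes. *)
  - assert (elr : l ;; (tid D ;; r) = l ;; r) by now rewrite tcomp_idl.
    set (m1 := rmap er (eq_refl (tid D ;; r)) (rid (tid D))).
    assert (Hu1 : ext_universal (a := a) m1 elr).
    { intros V v x' e P y.
      pose proof (fun q => ext_unit_map (a := a) er (tcomp_idr l) elr (eq_refl t) e (P := P) q)
          as H.
      exists (flat_act a e y). split.
      - refine (eq_trans (H _) _). apply eta_flat.
      - intros q Hq. rewrite <- (flat_eta (a := a) e q).
        exact (f_equal (flat_act a e (P := P)) (eq_trans (eq_sym Hq) (H q))). }
    pose proof (act_hom_map_rid er) as Hk1.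
    destruct (Hcr D (tid D) {| apex := r; leg := hom_map er (tcomp_idl r) |}
      (universal_extension (tcomp_idr l) Hk1 Hj Hu1) (universal_absolute (tcomp_idr l) Hk1 Hu1))
      as [c1 [[_ Hc1] _]].
    assert (Hleg : tr (tcomp_idl r) (tcomp_idl r) (hom_map er (tcomp_idl r)) =
      rmap er er (hcart (tid D) (tid D))).
    { rewrite <- (gcomp_idl (hom_map er (tcomp_idl r))).
      rewrite tr_hom_map with (ef := tcomp_idl (tid D)) (eg := tcomp_idl (tid D)), tr_idcell.
          pirr. }
    assert (HA : c1 = {| apex := tid D; leg := idcell (hom (tid D) (tid D)) |}).
    { apply Hc1. apply cocone_map_eq. exists er. simpl. rewrite tr_idcell. symmetry. exact Hleg. }
    assert (eKw : (K ;; w) ;; r = r) by now rewrite tcomp_assoc, ew.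
    assert (HB : c1 = {| apex := K ;; w; leg := hom_fact (tcomp_idl (tid D)) (tcomp_idl (K ;; w))
      (rcomp m2 (rmap (tcomp_idl (K ;; w)) (tcomp_idl (K ;; w)) (hcart (tid D) (tid D)))) |}).
    { apply Hc1. apply cocone_map_eq. exists eKw. simpl. rewrite tr_hom_fact.
      refine (eq_trans _ (eq_sym Hleg)).
      refine (eq_trans (rmap_rcomp m2 _ er eKw eKw) _).
      (* The right side K;u equals r only propositionally; with a variable [g] in its place the
         equation can be eliminated. *)
      assert (Hm2 : forall g (h : K ;; u = g) (h' : (K ;; w) ;; r = g),
        rmap er h' m2 = rmap eK h (rid K)).
      { intros g h h'. destruct h. refine (eq_trans _ Hm). pirr. }
      rewrite (Hm2 r eK eKw), rmap_rid.
      refine (eq_trans (rcomp_rid _) _). apply rmap_rmap. exact eKw. }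
    rewrite HA in HB. symmetry. exact (f_equal (apex (f := tid D)) HB).
  (* For w;K = 1, both sides are lifts of the algebra carried by [u]. Writing the universal element
     of E(j,u) as nu;u(q), the action along [w] yields u(q) by [lift_act]; the action on [u] yields
     the same, as it sends the unit to an identity. *)
  - assert (e2 : (w ;; K) ;; u = u) by now rewrite tcomp_assoc, eK.
    refine (au_lift_uniq HO (al := ualg O) (e := e2) (e' := tcomp_idl u) _ _).
    + apply (tr_inj (e0 := tcomp_idl t) (en := tcomp_idl u)). rewrite tr_hom_restr.
      refine (eq_trans _ (act_hcart U (tcomp_idl u) (tcomp_idl u) (tcomp_idl t) (tcomp_idl u))).
      destruct (Hu _ _ _ (tcomp_idl u) _ (hcart j u)) as [q [Hq _]].
      transitivity (act (adj_act a) ew ew (hcart j u)).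
      { rewrite <- HK. symmetry. apply act_hom_restr. reflexivity. }
      refine (eq_trans (f_equal (act (adj_act a) ew ew (P := [: hom j u])) (eq_sym Hq)) _).
      refine (eq_trans _ (f_equal (act U (tcomp_idl u) (tcomp_idl u) (P := [: hom j u])) Hq)).
      refine (eq_trans (lift_act (eq_refl lc) elcx ew Hm (tcomp_idl u) (tcomp_idl w) ew q) _).
      refine (eq_trans (pre_rid_map_rcomp eK (eq_refl lc) elcx e1 (tcomp_idl u) q) _).
      symmetry.
      refine (eq_trans (f_equal (act U (tcomp_idl u) (tcomp_idl u) (P := [: hom j u]))
        (ext_unit_map eK (eq_refl lc) elcx e1 (tcomp_idl u) q)) _).
      etransitivity; [exact (act_natural U e1 (tcomp_idl u) e1 (tcomp_idl u) (eta a) q)|].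
      rewrite (free_act_eta (eq_refl lc) e1). apply rcomp_rid.
    + apply (tr_inj (e0 := tcomp_idl t) (en := tcomp_idl u)). rewrite tr_hom_restr.
      apply act_hcart.
Qed.
End Object.
End Final.

Theorem theorem4p7 (X : virtual_equipment) (A E D : X) (j : tight A E) (r : tight D E)
    (dense_j : dense j) :
  strictly_monadic j r <->
  (exists a : left_adjoint j r, inhabited (algebra_object (induced_monad a))) /\
  strictly_creates_absolute_extensions j r.
Proof.
  split.
  - intros [a [O Hiso]]. split; [exists a; now constructor|]. exact (monadic_creates Hiso).
  - intros [[a [O]] Hcr]. exists a, O. now apply creates_monadic.
Qed.
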